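(* Let $S\subset[0,\infty)$ be an additive sub-semigroup satisfying (S1) and (S2) and let $\mu$ be a probability measure on $\mathbb{R}$. Then $\mu\in\mathcal{P}_S$ if and only if there exist $(c_\gamma)_{\gamma\in S}\subset\mathbb{C}$ and $A>0$ such that: (1) $|c_\gamma|\le A^\gamma$ for every $\gamma\in S$ with $\gamma>0$, and $c_0=1$; (2) $\mathcal{F}_\mu(z)=\sum_{\gamma\in S}\frac{c_\gamma}{\Gamma(\gamma+1)}\,i^\gamma z^\gamma$ for all $z>0$.
   Context: $\mathbb{N}=\{0,1,2,\dots\}$. Conditions on the additive sub-semigroup $S\subset[0,\infty)$: (S1) $\mathbb{N}\subset S$; (S2) there is a constant $c>0$ such that $\sharp(S\cap[n,n+1))\le c^{n+1}$ for every $n\in\mathbb{N}$. Such a constant $c$ is fixed. The class $\mathcal{P}_S$: a probability measure $\mu$ on $\mathbb{R}$ belongs to $\mathcal{P}_S$ if there exist $\{a_\beta\}_{\beta\in S,\beta>0}\subset\mathbb{C}$ and $r,R>0$ such that the restriction of $\mu$ to $\{|x|\ge R\}$ is $$\mu|_{|x|\ge R}(dx)=\sum_{\beta\in S,\,\beta>0}\mathrm{Im}\left(a_\beta\left(\tfrac1x\right)^{\beta+1}\right)dx,$$ with $|a_\beta|\le r^\beta$ for all $\beta$ and $r<c^{-1}R$. Here $(1/x)^{\beta+1}$ is understood as $e^{i(\beta+1)\pi}|x|^{-\beta-1}$ for $x\le -R$ (and as the usual positive power for $x\ge R$). $\mathcal{F}_\mu(z)=\int_{\mathbb{R}}e^{ixz}\mu(dx)$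 is the Fourier transform. Powers are principal: $z^\beta=e^{\beta\log z}$ with $-\pi<\mathrm{Im}\log z<\pi$; in particular $i^\gamma=e^{i\pi\gamma/2}$. *)

(* Defs.v *)
From HB Require Import structures.
From mathcomp Require Import all_boot all_order all_algebra finmap complex.
From mathcomp Require Import all_classical all_reals all_analysis.

Set Implicit Arguments.
Unset Strict Implicit.
Unset Printing Implicit Defensive.

Import Order.TTheory GRing.Theory Num.Theory.

Local Open Scope classical_set_scope.
Local Open Scope ring_scope.
Local Open Scope complex_scope.

(* Sums indexed by a set, understood as unconditional sums: limits along the
   finite subsets of D directed by inclusion. With K := R[i], [0 < e] means
   that e is a positive real number. *)
Definition has_sum (T : choiceType) (K : numDomainType) (D : set T)
    (f : T -> K) (l : K) : Prop :=
  forall e : K, 0 < e ->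
    exists F0 : set T, [/\ finite_set F0, F0 `<=` D &
      forall F : set T, finite_set F -> F0 `<=` F -> F `<=` D ->
        `| \sum_(i \in F) f i - l | < e].

Section Definitions.
Variable R : realType.
Implicit Types (S : set R) (c x z : R).

Definition subsemigroup_nonneg S : Prop :=
  S `<=` [set x | 0 <= x] /\ forall x y, S x -> S y -> S (x + y).

Definition S1 S : Prop := forall n : nat, S n%:R.

Definition S2 c S : Prop := forall n : nat,
  let Sn := S `&` [set x | n%:R <= x < n.+1%:R] in
  finite_set Sn /\ (#|` fset_set Sn|)%:R <= c ^+ n.+1.

Definition expi (t : R) : R[i] := cos t +i* sin t.

(* (1/x)^b with the convention (1/x)^b = e^{i b pi} |x|^{-b} for x < 0. *)
Definition inv_pow x (b : R) : R[i] :=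
  if 0 < x then (x `^ (- b))%:C else expi (b * pi) * (`|x| `^ (- b))%:C.

(* The density g is determined on {|x| >= rho} by its series, and its values
   elsewhere are irrelevant. *)
Definition class_P c S (mu : probability (measurableTypeR R) R) : Prop :=
  exists (a : R -> R[i]) (r rho : R) (g : R -> R),
    [/\ 0 < r, 0 < rho, r < c^-1 * rho,
        forall b, S b -> 0 < b -> `|a b| <= (r `^ b)%:C &
        (forall x, rho <= `|x| ->
           has_sum (S `&` [set b | 0 < b])
             (fun b => complex.Im (a b * inv_pow x (b + 1))) (g x)) /\
        (forall B : set (measurableTypeR R), measurable B ->
           B `<=` [set x | rho <= `|x|] ->
           mu B = (\int[lebesgue_measure]_(x in B) (g x)%:E)%E)].

Definition fourier (mu : probability (measurableTypeR R) R) z : R[i] :=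
  (\int[mu]_x cos (x * z)) +i* (\int[mu]_x sin (x * z)).

Definition Gamma (s : R) : R :=
  \int[lebesgue_measure]_(t in `]0%R, +oo[) (t `^ (s - 1) * expR (- t)).

(* Principal value of i^g, that is, e^{i pi g / 2}. *)
Definition i_pow (g : R) : R[i] := expi (pi * g / 2).

End Definitions.

(* Main.v *)
Require Import Defs.
From mathcomp Require Import all_boot all_order all_algebra finmap complex.
From mathcomp Require Import ring lra.
From mathcomp Require Import all_classical all_reals all_analysis.
From mathcomp Require Import measurable_realfun.

Set Implicit Arguments.
Unset Strict Implicit.
Unset Printing Implicit Defensive.

Import Order.TTheory GRing.Theory Num.Theory.
Import numFieldNormedType.Exports.

Local Open Scope classical_set_scope.
Local Open Scope ring_scope.

(* Put [a_b * i ^ b = u 0 b + i * u 1 b]. Then [Im (a_b * (1 / x) ^ (b + 1))] is half the sum of the even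
   function [w_0 * u 0 b * |x| ^ (- b - 1)] and the odd function [sg x * w_1 * u 1 b * |x| ^ (- b - 1)],
   where [w_p = - 2 * sin ((b - p) * pi / 2)], so its cosine and sine transforms over [{|x| >= rho}]
   reduce to [\int_rho^oo x ^ (- b - 1) * trig p (x * z) dx]. Integrating the power series of [trig p]
   termwise, this tail is a multiple of [z ^ b / Gamma (b + 1)] plus a power series in [z] that is
   entire of exponential type [rho]. After multiplication by [w_p] the multiple is bounded above and
   away from zero, or it vanishes because [b - p] is an even integer; in that resonant case
   [z ^ b / Gamma (b + 1)] is itself a monomial admitted in the power series.

   If [mu] has such a density on [{|x| >= rho}], summing over [b] and expanding the transform of the
   restriction of [mu] to [{|x| < rho}] in its moments gives the expansion of the Fourier transform.

   Conversely, divide the given coefficients by those multiples, let [g] be the resulting density, and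
   set [L f := \int f dmu - \int_{|x| >= rho} f g]. The cosine and sine transforms of [L] are entire of
   exponential type [rho]. Symmetric difference operators map monomials to polynomials with
   nonnegative coefficients, so [|L (sin (h x) ^ m)| <= C * sinh (rho * h) ^ m]. Expanding
   [exp (- ((sin (h x) / h - a) / s) ^ (2 n)) - 1] in powers of [sin (h x)] and letting [h -> 0], then
   [n -> oo], yields [L \1_(]a - s, a + s[) = L 1], up to the endpoints, for [s > rho + |a|]. Hence [L]
   vanishes on [{|x| > rho}], that is, [mu] has density [g] there. *)

(** * Power series, trigonometric functions and integrals *)

(** Exponents of [S] may come arbitrarily close to integers, so integrating term by term meets small
    divisors [j - b]. All estimates must nevertheless be uniform in [b], because they are summed
    over [S] and, in the converse, divided by. The factor [w_p] makes this possible: it has a simple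
    zero at every resonance, which tames the divisors and the multiple of [z ^ b / Gamma (b + 1)] at
    once. The growth bound in (S2) acts through the convergence of [\sum_b q ^ b] for [q * c < 1];
    this is the source of [r < c^-1 * rho]. In the converse, [mu] need not have moments, and [L] is
    known only through the Taylor coefficients of its transforms at [0]. Powers of [x] are therefore
    replaced by powers of the bounded function [sin (h x) / h]. Nonnegativity of the differences
    prevents any loss when absolute values are taken, so that the radius [rho] is recovered exactly
    as [h -> 0]. *)

Section PowerSeries.
Variable R : realType.
Implicit Types (c : R^nat) (C x y : R).

Lemma cvg_normed_expmaj c C x : (forall j, `|c j| <= C / j`!%:R) ->
  cvgn [normed pseries c x].
Proof.
move=> cC.
have hE : cvgn (series (fun j => C * exp_coeff `|x| j)).
  by apply: is_cvg_seriesZ; exact: is_cvg_series_exp_coeff.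
rewrite /pseries.
apply: (series_le_cvg _ _ _ hE) => n /=; first by [].
- rewrite /exp_coeff/= mulr_ge0//.
  by have := le_trans (normr_ge0 _) (cC 0%N); rewrite divr1.
- by rewrite normrM normrX /exp_coeff/= [leRHS]mulrCA [leRHS]mulrC ler_wpM2r.
Qed.

Lemma cvg_expmaj c C x : (forall j, `|c j| <= C / j`!%:R) -> cvgn (pseries c x).
Proof. by move=> /cvg_normed_expmaj h; apply: normed_cvg. Qed.

(** The factor [j + 1] is absorbed by [(j + 1)! = (j + 1) * j!], so the majorant [C / j!] survives
    differentiation with the same [C]; [is_derive_expmaj] uses this twice. *)
Lemma pseries_diffs_expmaj c C : (forall j, `|c j| <= C / j`!%:R) ->
  forall j, `|pseries_diffs c j| <= C / j`!%:R.
Proof.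
move=> cC j; rewrite /pseries_diffs normrM ger0_norm//.
rewrite -ler_pdivlMl ?ltr0n//; apply: le_trans (cC _) _.
by rewrite factS natrM invfM mulrCA.
Qed.

Lemma is_derive_expmaj c C x : (forall j, `|c j| <= C / j`!%:R) ->
  is_derive x 1 (fun x => limn (pseries c x)) (limn (pseries (pseries_diffs c) x)).
Proof.
move=> cC; have dC := pseries_diffs_expmaj cC; have ddC := pseries_diffs_expmaj dC.
apply: (@pseries_snd_diffs _ _ (`|x| + 1));
    [exact: cvg_expmaj cC|exact: cvg_expmaj dC|exact: cvg_expmaj ddC|].
by rewrite [ltRHS]ger0_norm ?ltrDl.
Qed.

End PowerSeries.

(** * Cosine and sine as one family, with their Taylor series *)

Section Trig.
Variable R : realType.
Implicit Types (x y z b : R).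

(* [trig p] runs through [cos], [sin], [- cos], [- sin], and [tau p j] is its [j]-th derivative at [0]. *)
Definition trig (p : nat) y : R := cos (y - p%:R * (pi / 2)).
Definition tau (p j : nat) : R := cos ((j%:R - p%:R) * (pi / 2)).

Lemma trig0 y : trig 0 y = cos y.
Proof. by rewrite /trig mul0r subr0. Qed.

Lemma trig1 y : trig 1 y = sin y.
Proof. by rewrite /trig mul1r cosBpihalf. Qed.

Lemma trigS p y : trig p.+1 y = sin (y - p%:R * (pi / 2)).
Proof. by rewrite /trig -cosBpihalf -natr1; congr cos; lra. Qed.

Lemma trigSS p y : trig p.+2 y = - trig p y.
Proof. by rewrite trigS -natr1 mulrDl mul1r opprD addrA sinBpihalf. Qed.

Lemma tauS p j : tau p.+1 j.+1 = tau p j.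
Proof. by rewrite /tau -!natr1; congr cos; lra. Qed.

Lemma tauSS p j : tau p.+2 j = - tau p j.
Proof.
rewrite /tau (_ : (j%:R - p%:R) * _ = (j%:R - p.+2%:R) * (pi / 2) + pi); last first.
  by rewrite -addn2 natrD; field.
by rewrite cosDpi opprK.
Qed.

Lemma tau_double p j : tau p j.+2 = - tau p j.
Proof. by rewrite /tau -cosDpi -addn2 natrD; congr cos; lra. Qed.

Lemma sin_natpi n : sin (n%:R * pi) = 0 :> R.
Proof.
elim: n => [|n ih]; first by rewrite mul0r sin0.
by rewrite -natr1 mulrDl mul1r sinDpi ih oppr0.
Qed.

(** Twice the angle is a multiple of [pi], and [sin t * cos t = sin (2 * t) / 2]. This makes the
    phase vanish at a resonance and moves it from [p] to [j] in [tail_coefE]. *)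
Lemma sin_tau p j : sin ((j%:R - p%:R) * (pi / 2)) * tau p j = 0.
Proof.
rewrite /tau; set t := (_ - _) * _.
have : sin (t *+ 2) = 0.
  rewrite (_ : t *+ 2 = j%:R * pi - p%:R * pi); last by rewrite /t -mulr_natr; field.
  by rewrite sinB !sin_natpi mul0r mulr0 subr0.
by rewrite sin_mulr2n mulrC => /eqP; rewrite mulrn_eq0/= => /eqP.
Qed.

Lemma tau0_cos j y : tau 0 j * y ^+ j / j`!%:R = cos_coeff y j.
Proof.
suff -> : tau 0 j = (~~ odd j)%:R * (-1) ^+ j./2 by [].
elim/ltn_ind: j => -[|[|j]] ih.
- by rewrite /tau mulr1 subrr mul0r cos0.
- by rewrite /tau subr0 !mul1r cos_pihalf mul0r.
- by rewrite tau_double ih//= negbK exprS; ring.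
Qed.

Lemma tau1_sin j y : tau 1 j * y ^+ j / j`!%:R = sin_coeff y j.
Proof.
suff -> : tau 1 j = (odd j)%:R * (-1) ^+ j.-1./2 by [].
elim/ltn_ind: j => -[|[|j]] ih.
- by rewrite /tau sub0r mulN1r cosN cos_pihalf mul0r.
- by rewrite /tau subrr mul0r cos0 mulr1.
- rewrite tau_double ih//= negbK; case: j {ih} => [|j] /=; first by rewrite !mul0r oppr0.
  by rewrite exprS; ring.
Qed.

Lemma cvg_trig p y : series (fun j => tau p j * y ^+ j / j`!%:R) @ \oo --> trig p y.
Proof.
elim/ltn_ind: p => -[|[|p]] ih.
- rewrite trig0; under eq_fun do rewrite tau0_cos.
  rewrite cos.unlock; exact: is_cvg_series_cos_coeff.
- rewrite trig1; under eq_fun do rewrite tau1_sin.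
  rewrite sin.unlock; exact: is_cvg_series_sin_coeff.
- rewrite trigSS (_ : series _ = - series (fun j => tau p j * y ^+ j / j`!%:R)).
    by apply: cvgN; apply: ih.
  apply/funext => n /=; rewrite fctE /series/= -sumrN; apply: eq_bigr => i _.
  by rewrite tauSS !mulNr.
Qed.

Lemma tau_le1 p j : `|tau p j| <= 1.
Proof. exact: cos_max. Qed.

End Trig.

(** * Domination and linearity for real-valued integrals *)

Section RealIntegral.
Context d (T : measurableType d) (R : realType) (mu : {measure set T -> \bar R}).
Implicit Types (D : set T) (f g : T -> R).

Lemma le_integrable_real D f g : measurable D -> measurable_fun D f ->
  (forall x, D x -> `|f x| <= g x) -> mu.-integrable D (EFin \o g) ->
  mu.-integrable D (EFin \o f).
Proof.
move=> mD mf fg ig; apply: le_integrable ig => //; first exact/measurable_EFinP.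
by move=> x Dx /=; rewrite lee_fin (le_trans (fg _ Dx))// ler_norm.
Qed.

Lemma norm_Rintegral_le D f g : measurable D -> measurable_fun D f ->
  (forall x, D x -> `|f x| <= g x) -> mu.-integrable D (EFin \o g) ->
  `|\int[mu]_(x in D) f x| <= \int[mu]_(x in D) g x.
Proof.
move=> mD mf fg ig; have iF := le_integrable_real mD mf fg ig.
apply: le_trans (le_normr_Rintegral mD iF) _.
apply: le_Rintegral => //.
apply: (le_integrable_real mD _ _ ig); first exact: measurableT_comp.
by move=> x Dx; rewrite normr_id fg.
Qed.

Lemma Rintegral_dominated D (f_ : (T -> R)^nat) f g : measurable D ->
  (forall n, measurable_fun D (f_ n)) ->
  (forall x, D x -> f_ n x @[n --> \oo] --> f x) ->
  (forall n x, D x -> `|f_ n x| <= g x) -> mu.-integrable D (EFin \o g) ->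
  \int[mu]_(x in D) f_ n x @[n --> \oo] --> \int[mu]_(x in D) f x.
Proof.
move=> mD mf_ f_f f_g ig.
have mf : measurable_fun D f by exact: (measurable_fun_cvg mf_ f_f).
have [] := @dominated_convergence _ _ _ mu D mD (fun n => EFin \o f_ n)
  (EFin \o f) (EFin \o g) _ _ _ ig.
- by move=> n; exact/measurable_EFinP.
- exact/measurable_EFinP.
- by apply: aeW => x Dx; apply: cvg_EFin; [exact: nearW|exact: f_f].
- by apply: aeW => x n Dx; exact: f_g.
move=> i1 _ i3.
apply: fine_cvg; rewrite fineK//.
exact: integrable_fin_num.
Qed.

Lemma integrableD_real D f g : measurable D -> mu.-integrable D (EFin \o f) ->
  mu.-integrable D (EFin \o g) -> mu.-integrable D (EFin \o (fun x => f x + g x)).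
Proof. by move=> mD fi gi; have := integrableD mD fi gi; apply: eq_integrable. Qed.

Lemma integrableZ_real D (k : R) f : measurable D -> mu.-integrable D (EFin \o f) ->
  mu.-integrable D (EFin \o (fun x => k * f x)).
Proof. by move=> mD fi; have := integrableZl mD k fi; apply: eq_integrable. Qed.

Lemma integrableB_real D f g : measurable D -> mu.-integrable D (EFin \o f) ->
  mu.-integrable D (EFin \o g) -> mu.-integrable D (EFin \o (fun x => f x - g x)).
Proof. by move=> mD fi gi; have := integrableB mD fi gi; apply: eq_integrable. Qed.

Lemma ge0_subset_Rintegral (A B : set T) f : measurable A -> measurable B -> A `<=` B ->
  (forall x, B x -> 0 <= f x) -> mu.-integrable B (EFin \o f) ->
  \int[mu]_(x in A) f x <= \int[mu]_(x in B) f x.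
Proof.
move=> mA mB AB f0 fi; rewrite /Rintegral; apply: fine_le.
- by apply: integrable_fin_num => //; exact: integrableS fi.
- exact: integrable_fin_num.
- by apply: ge0_subset_integral => //; exact: measurable_int fi.
Qed.

End RealIntegral.

(** * The fundamental theorem of calculus and negative powers on half-lines *)

Section HalfLine.
Variable R : realType.
Notation mu := (@lebesgue_measure R).
Implicit Types (f F : R -> R) (a b x y : R).

Lemma Rintegral_FTC f F a b : a <= b ->
  (forall x, a <= x <= b -> is_derive x 1 F (f x)) ->
  (forall x, a <= x <= b -> {for x, continuous f}) ->
  \int[mu]_(x in `[a, b]) f x = F b - F a.
Proof.
rewrite le_eqVlt => /predU1P[->|ab] dF cf.
  by rewrite set_itv1 Rintegral_set1 subrr.
have cF x : a <= x <= b -> {for x, continuous F}.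
  move=> xab; apply/differentiable_continuous/derivable1_diffP.
  by have [] := dF x xab.
rewrite /Rintegral (@continuous_FTC2 _ f F)//.
- apply: continuous_in_subspaceT => x; rewrite inE/= in_itv/=; exact: cf.
- split.
  + by move=> x /[!in_itv]/= /andP[ax xb]; have [] := dF x; rewrite ?ltW.
  + by apply: cvg_at_right_filter; apply: cF; rewrite lexx ltW.
  + by apply: cvg_at_left_filter; apply: cF; rewrite lexx ltW.
- move=> x /[!in_itv]/= /andP[ax xb]; rewrite derive1E.
  have xab : a <= x <= b by rewrite !ltW.
  by have [_] := dF x xab.
Qed.

Lemma Rintegral_split f a b : a <= b -> mu.-integrable `[a, +oo[ (EFin \o f) ->
  \int[mu]_(x in `[a, +oo[) f x = \int[mu]_(x in `[a, b]) f x + \int[mu]_(x in `[b, +oo[) f x.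
Proof.
move=> ab itf; apply/eqP; rewrite addrC -subr_eq; apply/eqP.
rewrite Rintegral_itvB// ?bnd_simp// Rintegral_itv_obnd_cbnd//.
apply: integrableS itf => //; apply: subset_itvr; rewrite bnd_simp//.
Qed.

Lemma cvg_powRN0 b : 0 < b -> x `^ (- b) @[x --> +oo%R] --> (0 : R).
Proof.
move=> b0; apply/cvgrPdist_le => e e0.
near=> x; rewrite sub0r normrN ger0_norm ?powR_ge0//.
have x0 : 0 < x by near: x; exact: nbhs_pinfty_gt.
rewrite powRN invf_ple ?posrE ?powR_gt0//.
have : (e^-1) `^ (b^-1) < x by near: x; exact: nbhs_pinfty_gt.
move=> ex.
have : (e^-1 `^ b^-1) `^ b < x `^ b.
  by apply: gt0_ltr_powR; rewrite // nnegrE ?powR_ge0 ?ltW.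
by rewrite -powRrM mulVf ?gt_eqF// powRr1 ?invr_ge0 ?(ltW e0)// => /ltW.
Unshelve. all: by end_near. Qed.

Lemma is_derive_powR b x : 0 < x -> is_derive x 1 (@powR R ^~ b) (b * x `^ (b - 1)).
Proof. exact: is_derive1_powR. Qed.

Lemma continuous_powR b x : 0 < x -> {for x, continuous (@powR R ^~ b)}.
Proof.
move=> x0; apply/differentiable_continuous/derivable1_diffP.
by have [] := is_derive_powR b x0.
Qed.

Lemma integral_powRN b y : 0 < b -> 0 < y ->
  (\int[mu]_(x in `[y, +oo[) (x `^ (- b - 1))%:E = (y `^ (- b) / b)%:E)%E.
Proof.
move=> b0 y0; rewrite (@ge0_continuous_FTC2y _ _ (fun x => - b^-1 * x `^ (- b)) y 0).
- by rewrite sub0e -EFinN mulNr opprK mulrC.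
- by move=> x _; exact: powR_ge0.
- apply: continuous_in_subspaceT => x; rewrite inE/= in_itv/= andbT => yx.
  by apply: continuous_powR; exact: lt_le_trans yx.
- by rewrite -(mulr0 (- b^-1)); apply: cvgMr; exact: cvg_powRN0.
- move=> x yx; have [] := is_deriveZ (- b^-1) (is_derive_powR (- b) (lt_trans y0 yx)).
  by [].
- apply: cvg_at_right_filter; apply: cvgMr; exact: continuous_powR.
- move=> x; rewrite in_itv/= andbT => yx; rewrite derive1E.
  have [_ ->] := is_deriveZ (- b^-1) (is_derive_powR (- b) (lt_trans y0 yx)).
  by rewrite /GRing.scale/= mulrA mulrNN mulVf ?mul1r// gt_eqF.
Qed.

Lemma integrable_powRN b y : 0 < b -> 0 < y ->
  mu.-integrable `[y, +oo[ (EFin \o (fun x => x `^ (- b - 1))).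
Proof.
move=> b0 y0; apply/integrableP; split.
  by apply/measurable_EFinP; apply: measurable_funTS; exact: measurable_powR.
under eq_integral do rewrite /= ger0_norm ?powR_ge0//.
by rewrite integral_powRN// ltry.
Qed.

Lemma Rintegral_powRN b y : 0 < b -> 0 < y ->
  \int[mu]_(x in `[y, +oo[) (x `^ (- b - 1)) = y `^ (- b) / b.
Proof. by move=> b0 y0; rewrite /Rintegral integral_powRN. Qed.

End HalfLine.

(** * The Gamma function *)

Section Gamma.
Variable R : realType.
Notation mu := (@lebesgue_measure R).
Implicit Types (f F : R -> R) (s u t T : R).

Lemma is_derive_expRN (x : R) : is_derive x (1 : R) (fun x => expR (- x)) (- expR (- x)).
Proof.
have h := is_derive1_comp (is_derive_expR (- x)) (is_deriveN (is_derive_id x (1 : R))).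
by apply: (is_derive_eq h); rewrite mulrN1.
Qed.

Lemma continuous_expRN : continuous (fun x : R => expR (- x)).
Proof. by move=> x; apply: continuous_comp; [exact: continuousN|exact: continuous_expR]. Qed.

(** Exhaustion by the intervals [[1 / n.+1, n.+1]] and dominated convergence allow a signed [f] and
    an [F] controlled only on the open half-line, as for [t ^ u * exp (- t)]. *)
Lemma Rintegral_FTC_oo f F (l m : R) :
  (forall x : R, 0 < x -> is_derive x (1 : R) F (f x)) ->
  (forall x : R, 0 < x -> {for x, continuous f}) ->
  mu.-integrable `]0, +oo[ (EFin \o f) ->
  F n.+1%:R^-1 @[n --> \oo] --> m -> F n.+1%:R @[n --> \oo] --> l ->
  \int[mu]_(x in `]0, +oo[) f x = l - m.
Proof.
move=> dF cf itf Fm Fl.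
pose A n := [set` `[n.+1%:R^-1, n.+1%:R : R]].
have A0 n x : A n x -> 0 < x.
  by rewrite /A/= in_itv/= => /andP[h _]; apply: lt_le_trans h; rewrite invr_gt0 ltr0n.
have mf : measurable_fun (`]0, +oo[%classic : set R) f by apply/measurable_EFinP; exact: measurable_int itf.
have h1 : (\int[mu]_(x in `]0, +oo[) (f \_ (A n)) x) @[n --> \oo] --> \int[mu]_(x in `]0%R, +oo[) f x.
  apply: (@Rintegral_dominated _ _ _ mu _ _ _ (fun x => `|f x|)) => //.
  - move=> n; apply/measurable_restrict => //; first exact: measurable_itv.
    by apply: measurable_funS mf => //; exact: subIsetl.
  - move=> x /=; rewrite in_itv/= andbT => x0.
    apply: (@cvg_near_cst _ _ _ _ _ _).
    near=> n; rewrite patchE mem_set// /A/= in_itv/=; apply/andP; split.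
      rewrite invf_ple ?posrE ?ltr0n//; apply: (@le_trans _ _ n%:R); last by rewrite ler_nat.
      by near: n; exact: nbhs_infty_ger.
    apply: (@le_trans _ _ n%:R); last by rewrite ler_nat.
    by near: n; exact: nbhs_infty_ger.
  - move=> n x _; rewrite patchE; case: ifPn => // _; by rewrite normr0.
  - exact: integrable_norm itf.
have h2 n : \int[mu]_(x in `]0, +oo[) (f \_ (A n)) x = F n.+1%:R - F n.+1%:R^-1.
  rewrite -Rintegral_mkcondr setIidr; last by move=> x /A0 x0; rewrite /= in_itv/= x0.
  apply: Rintegral_FTC.
  - by rewrite (@le_trans _ _ 1) ?invf_le1 ?ler1n ?ltr0n.
  - by move=> x ?; apply: dF; apply: (A0 n); rewrite /A/= in_itv.
  - by move=> x ?; apply: cf; apply: (A0 n); rewrite /A/= in_itv.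
move: h1; under eq_fun do rewrite h2.
move=> h1; have h3 : F n.+1%:R - F n.+1%:R^-1 @[n --> \oo] --> l - m by exact: cvgB.
exact: (cvg_unique _ h1 h3).
Unshelve. all: by end_near. Qed.

(** With [k = 2 * (s + 1)], raising [t / k <= exp (t / k)] to the power [s] gives
    [t ^ s <= k ^ s * exp (s * t / k)], and [s / k <= 1 / 2]. *)
Lemma powR_expR_le s t : 0 <= s -> 0 < t ->
  t `^ s * expR (- t) <= (2 * (s + 1)) `^ s * expR (- (t / 2)).
Proof.
move=> s0 t0; have s1 : 0 < 2 * (s + 1) by rewrite mulr_gt0// ltr_wpDl.
suff h : t `^ s <= (2 * (s + 1)) `^ s * expR (t / 2).
  rewrite -ler_pdivlMr ?expR_gt0// -expRN opprK -mulrA -expRD.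
  by apply: le_trans h _; rewrite ler_wpM2l ?powR_ge0// ler_expR; lra.
have h1 : t <= 2 * (s + 1) * expR (t / (2 * (s + 1))).
  rewrite -ler_pdivrMl// mulrC; apply: le_trans (expR_ge1Dx _).
  by rewrite lerDr.
have /(_ t) := @ge0_ler_powR R s s0; rewrite nnegrE ltW// => /(_ _ isT _ h1).
rewrite nnegrE mulr_ge0 ?expR_ge0 ?(ltW s1)// => /(_ isT) h.
apply: le_trans h _; rewrite powRM ?expR_ge0 ?(ltW s1)//.
rewrite ler_wpM2l ?powR_ge0// -expRM ler_expR.
rewrite -mulrA ler_wpM2l ?(ltW t0)// -ler_pdivlMl ?invr_gt0// invrK.
by rewrite mulrAC mulfV ?mul1r; lra.
Qed.

Lemma integral_expR_half (a : R) : (\int[mu]_(x in `[a,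
    +oo[) (expR (- (x / 2)))%:E = (2 * expR (- (a / 2)))%:E)%E.
Proof.
have dE (x : R) : is_derive x (1 : R) (fun x : R => - 2 * expR (- (x / 2))) (expR (- (x / 2))).
  apply: is_derive_eq; rewrite /GRing.scale/=; lra.
rewrite (@ge0_continuous_FTC2y _ _ (fun x => - 2 * expR (- (x / 2))) a 0).
- by rewrite sub0e -EFinN mulNr opprK.
- by move=> x _; exact: expR_ge0.
- apply: continuous_subspaceT => x.
  apply: continuous_comp; last exact: continuous_expR.
  by apply: cvgN; apply: cvgMl.
- rewrite -(mulr0 (- 2)); apply: cvgMr.
  apply: (@cvg_comp _ _ _ (fun x : R => x / 2) (fun x => expR (- x)) _ (+oo%R) _); last exact: cvgr_expR.
  apply/cvgryPge => A; near=> x; rewrite ler_pdivlMr//; near: x; exact: nbhs_pinfty_ge.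
- by move=> x _; have [] := dE x.
- apply: cvg_at_right_filter.
  have [dEa _] := dE a.
  by move/derivable1_diffP : dEa => /differentiable_continuous.
- by move=> x _; rewrite derive1E; have [_ ->] := dE x.
Unshelve. all: by end_near. Qed.

Lemma integrable_expR_half : mu.-integrable `]0, +oo[ (EFin \o (fun x : R => expR (- (x / 2)))).
Proof.
apply: (@integrableS _ _ _ mu `[0, +oo[) => //; first by apply: subset_itvr; rewrite bnd_simp.
apply/integrableP; split.
  apply/measurable_EFinP; apply: measurable_funTS; apply: continuous_measurable_fun.
  move=> x; apply: continuous_comp; last exact: continuous_expR.
  by apply: cvgN; apply: cvgMl.
under eq_integral do rewrite /= ger0_norm ?expR_ge0//.
by rewrite integral_expR_half ltry.
Qed.

Lemma integrable_Gamma s : 0 <= s ->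
  mu.-integrable `]0, +oo[ (EFin \o (fun t : R => t `^ s * expR (- t))).
Proof.
move=> s0.
apply: (@le_integrable_real _ _ _ mu _ _ (fun t => (2 * (s + 1)) `^ s * expR (- (t / 2)))) => //.
- apply: measurable_funTS; apply: measurable_funM; first exact: measurable_powR.
  by apply: continuous_measurable_fun => x; apply: continuous_comp;
      [exact: continuousN|exact: continuous_expR].
- move=> t /=; rewrite in_itv/= andbT => t0.
  by rewrite ger0_norm ?powR_expR_le// mulr_ge0 ?powR_ge0 ?expR_ge0.
- by apply: integrableZ_real => //; exact: integrable_expR_half.
Qed.

(** Integration by parts; the boundary term [t ^ u * exp (- t)] vanishes at both ends. The bound
    [1 <= u] keeps both exponents nonnegative, as [integrable_Gamma] asks. *)
Lemma GammaS u : 1 <= u -> Gamma (u + 1) = u * Gamma u.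
Proof.
move=> u1; rewrite /Gamma.
have u0 : 0 < u by lra.
have i1 : mu.-integrable `]0, +oo[ (EFin \o (fun t : R => t `^ u * expR (- t))).
  by apply: integrable_Gamma; lra.
have i2 : mu.-integrable `]0, +oo[ (EFin \o (fun t : R => t `^ (u - 1) * expR (- t))).
  by apply: integrable_Gamma; lra.
rewrite addrK -RintegralZl//.
apply/eqP; rewrite eq_sym -subr_eq0 -RintegralB//; last exact: integrableZ_real.
apply/eqP; rewrite -[RHS](subrr 0).
apply: (@Rintegral_FTC_oo _ (fun t => t `^ u * expR (- t))).
- move=> x x0.
  have h1 := is_derive_powR u x0.
  have h2 := is_derive_expRN x.
  apply: (is_derive_eq (is_deriveM h1 h2)); rewrite /GRing.scale/=; ring.
- move=> x x0; apply: cvgB; last first.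
    by apply: cvgM; [exact: continuous_powR|exact: continuous_expRN].
  by apply: cvgMr; apply: cvgM; [exact: continuous_powR|exact: continuous_expRN].
- by apply: integrableB_real => //; exact: integrableZ_real.
- apply: (@squeeze_cvgr _ _ _ _ (fun=> 0) (fun n => n.+1%:R^-1)).
  + near=> n; rewrite mulr_ge0 ?powR_ge0 ?expR_ge0//=.
    rewrite -[leRHS]mulr1; apply: ler_pM; rewrite ?powR_ge0 ?expR_ge0//.
    by apply: ge1r_powR => //; rewrite invr_gt0 ltr0n/= invf_le1 ?ltr0n ?ler1n.
  + exact: cvg_cst.
  + exact: cvg_harmonic.
- apply: (@squeeze_cvgr _ _ _ _ (fun=> 0) (fun n => (2 * (u + 1)) `^ u * expR (- (n.+1%:R / 2)))).
  + by near=> n; rewrite mulr_ge0 ?powR_ge0 ?expR_ge0//= powR_expR_le ?ltr0n// ltW.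
  + exact: cvg_cst.
  + rewrite -(mulr0 ((2 * (u + 1)) `^ u)); apply: cvgMr.
    apply: (@cvg_comp _ _ _ (fun n => n.+1%:R / 2 : R) (fun x => expR (- x)) _ (+oo%R) _);
        last exact: cvgr_expR.
    apply/cvgryPge => A; near=> n; rewrite ler_pdivlMr//.
    apply: (@le_trans _ _ n%:R); last by rewrite ler_nat.
    by near: n; exact: nbhs_infty_ger.
Unshelve. all: by end_near. Qed.

Lemma integrable_expRN : mu.-integrable `]0, +oo[ (EFin \o (fun t : R => expR (- t))).
Proof.
apply: (@le_integrable_real _ _ _ mu _ _ (fun t : R => t `^ 0 * expR (- t))) => //.
- by apply: measurable_funTS; apply: continuous_measurable_fun; exact: continuous_expRN.
- by move=> t _; rewrite powRr0 mul1r ger0_norm ?expR_ge0.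
- exact: integrable_Gamma.
Qed.

Lemma Gamma1 : Gamma (1 : R) = 1.
Proof.
rewrite /Gamma -[RHS]opprK -[RHS]sub0r.
under eq_Rintegral do rewrite subrr powRr0 mul1r.
apply: (@Rintegral_FTC_oo _ (fun t => - expR (- t))).
- by move=> x x0; apply: (is_derive_eq (is_deriveN (is_derive_expRN x))); rewrite opprK.
- by move=> x x0; exact: continuous_expRN.
- exact: integrable_expRN.
- apply: cvgN; rewrite -[X in _ --> X]expR0 -[X in expR X]oppr0.
  apply: continuous_cvg; first exact: continuous_expR.
  by apply: cvgN; exact: cvg_harmonic.
- rewrite -oppr0; apply: cvgN.
  apply: (@cvg_comp _ _ _ (fun n => n.+1%:R : R) (fun x => expR (- x)) _ (+oo%R) _); last exact: cvgr_expR.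
  apply/cvgryPge => A; near=> n.
  apply: (@le_trans _ _ n%:R); last by rewrite ler_nat.
  by near: n; exact: nbhs_infty_ger.
Unshelve. all: by end_near. Qed.

Lemma Gamma_nat n : Gamma (n%:R + 1 : R) = n`!%:R.
Proof.
elim: n => [|n ih]; first by rewrite add0r Gamma1.
by rewrite GammaS ?ler1n// -natr1 ih factS natrM natr1.
Qed.

(** Only the part [t >= T] of the integral is kept, where [t ^ s >= T ^ s]. The free parameter [T]
    later gives bounds on [z ^ s / Gamma (s + 1)] that are uniform in [s]. *)
Lemma Gamma_ge T s : 0 <= s -> 0 < T -> T `^ s * expR (- T) <= Gamma (s + 1).
Proof.
move=> s0 T0; rewrite /Gamma addrK.
have iG := integrable_Gamma s0.
have sub : `[T, +oo[ `<=` `]0%R, +oo[ by apply: subset_itvr; rewrite bnd_simp.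
have iE : mu.-integrable `[T, +oo[ (EFin \o (fun t : R => expR (- t))).
  by apply: integrableS integrable_expRN.
have eE : \int[mu]_(t in `[T, +oo[) expR (- t) = expR (- T).
  rewrite (@Rintegral_ge0_continuous_FTC2y _ _ (fun t => - expR (- t)) T 0) ?sub0r ?opprK//.
  - exact/continuous_subspaceT/continuous_expRN.
  - by rewrite -oppr0; apply: cvgN; exact: cvgr_expR.
  - by apply: cvg_at_right_filter; apply: cvgN; exact: continuous_expRN.
  - move=> x _; rewrite derive1E.
    by have [_ ->] := is_deriveN (is_derive_expRN x); rewrite opprK.
have <- : \int[mu]_(t in `[T, +oo[) (T `^ s * expR (- t)) = T `^ s * expR (- T).
  by rewrite RintegralZl// eE.
apply: (@le_trans _ _ (\int[mu]_(t in `[T, +oo[) (t `^ s * expR (- t)))).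
  apply: le_Rintegral => //; first exact: integrableZ_real.
    by apply: integrableS iG.
  move=> t /=; rewrite in_itv/= andbT => Tt; rewrite ler_wpM2r ?expR_ge0//.
  by apply: ge0_ler_powR; rewrite ?nnegrE ?(ltW T0)// (le_trans _ Tt)// ltW.
apply: ge0_subset_Rintegral => //.
by move=> t _; rewrite mulr_ge0 ?powR_ge0 ?expR_ge0.
Qed.

Lemma Gamma_gt0 s : 0 <= s -> 0 < Gamma (s + 1).
Proof.
move=> s0; apply: lt_le_trans (Gamma_ge s0 ltr01).
by rewrite mulr_gt0 ?powR_gt0 ?expR_gt0.
Qed.

(** On this range [t ^ s <= t ^ 0 + t ^ 2], which integrates to [0! + 2! = 3]. *)
Lemma Gamma_le3 s : 0 <= s <= 2 -> Gamma (s + 1) <= 3.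
Proof.
move=> /andP[s0 s2].
have -> : 3 = Gamma (0%:R + 1) + Gamma (2%:R + 1) :> R by rewrite !Gamma_nat.
rewrite /Gamma !addrK -RintegralD//; [|exact: integrable_Gamma..].
apply: le_Rintegral => //; first exact: integrable_Gamma.
  by apply: integrableD_real => //; exact: integrable_Gamma.
move=> t /=; rewrite in_itv/= andbT => t0.
rewrite -mulrDl ler_wpM2r ?expR_ge0// powRr0.
have [t1|t1] := leP t 1.
  rewrite -[leLHS]addr0 lerD ?powR_ge0//.
  by rewrite -(powRr0 t); apply: ger_powR => //; rewrite t0.
by rewrite -[leLHS]add0r lerD// ler_powR// ltW.
Qed.

End Gamma.

(** * Tails of trigonometric integrals *)

Section Tails.
Variable R : realType.
Notation mu := (@lebesgue_measure R).
Implicit Types (f F : R -> R) (p j : nat) (a b s x y z rho : R).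

(** A conserved quantity, stated without the limit of [F] at infinity: for [F = anti p b] that limit
    is the unknown constant [anti_cst p b]. *)
Lemma tail_antiderivative f F a b : a <= b ->
  (forall x : R, a <= x -> is_derive x (1 : R) F (f x)) ->
  (forall x : R, a <= x -> {for x, continuous f}) ->
  mu.-integrable `[a, +oo[ (EFin \o f) ->
  \int[mu]_(x in `[a, +oo[) f x + F a = \int[mu]_(x in `[b, +oo[) f x + F b.
Proof.
move=> ab dF cf itf; rewrite (Rintegral_split ab itf).
have -> : \int[mu]_(x in `[a, b]) f x = F b - F a; last by ring.
by apply: Rintegral_FTC => // x /andP[ax _]; [exact: dF|exact: cf].
Qed.

Lemma powRN_bound_eq0 (c C t b : R) : 0 < b -> (forall y, t <= y -> `|c| <= C * y `^ (- b)) -> c = 0.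
Proof.
move=> b0 h; apply/normr0_eq0/eqP; rewrite eq_le normr_ge0 andbT.
have hC : C * y `^ (- b) @[y --> +oo%R] --> C * 0 by apply: cvgMr; exact: cvg_powRN0.
rewrite -[leRHS](mulr0 C).
apply: (@cvgr_to_ge _ (pinfty_nbhs R) _ _ _ _ _ hC).
by near=> y; apply: h; near: y; apply: nbhs_pinfty_ge; exact: num_real.
Unshelve. all: by end_near. Qed.

Lemma is_derive_trig p x : is_derive x (1 : R) (trig p) (- trig p.+1 x).
Proof.
rewrite trigS /trig.
have h := @is_derive1_comp _ cos (fun x => x - p%:R * (pi / 2)) x _ _ (is_derive_cos _)
  (is_deriveB (is_derive_id x (1 : R)) (is_derive_cst (p%:R * (pi / 2)) x (1 : R))).
by apply: (is_derive_eq h); rewrite subr0 mulr1.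
Qed.

Lemma continuous_trig p : continuous (@trig R p).
Proof.
move=> x; apply/differentiable_continuous/derivable1_diffP.
by have [] := is_derive_trig p x.
Qed.

Lemma norm_trig p x : `|trig p x| <= 1.
Proof. exact: cos_max. Qed.

Lemma measurable_powR_trig (D : set R) b p z :
  measurable_fun (D : set (measurableTypeR R)) (fun x : R => x `^ b * trig p (x * z)).
Proof.
apply: measurable_funTS; apply: measurable_funM; first exact: measurable_powR.
apply: continuous_measurable_fun => x.
by apply: continuous_comp; [exact: cvgMl|exact: continuous_trig].
Qed.

Lemma integrable_powR_trig b p z y : 0 < b -> 0 < y ->
  mu.-integrable `[y, +oo[ (EFin \o (fun x => x `^ (- b - 1) * trig p (x * z))).
Proof.
move=> b0 y0; apply: (le_integrable_real _ _ _ (integrable_powRN b0 y0)) => //.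
  exact: measurable_powR_trig.
by move=> x _; rewrite normrM ger0_norm ?powR_ge0// ler_piMr ?powR_ge0 ?norm_trig.
Qed.

Definition trig_tail p b y z : R := \int[mu]_(x in `[y, +oo[) (x `^ (- b - 1) * trig p (x * z)).

Lemma trig_tail_le p b y z : 0 < b -> 0 < y -> `|trig_tail p b y z| <= y `^ (- b) / b.
Proof.
move=> b0 y0; rewrite -Rintegral_powRN//.
apply: norm_Rintegral_le => //; last exact: integrable_powRN.
  exact: measurable_powR_trig.
by move=> x _; rewrite normrM ger0_norm ?powR_ge0// ler_piMr ?powR_ge0 ?norm_trig.
Qed.

Lemma trig_tailSS p b y z : 0 < b -> 0 < y -> trig_tail p.+2 b y z = - trig_tail p b y z.
Proof.
move=> b0 y0; rewrite /trig_tail -[RHS]mulN1r -RintegralZl//; last exact: integrable_powR_trig.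
by apply: eq_Rintegral => x _; rewrite trigSS mulrN mulN1r.
Qed.

(* The termwise antiderivative of [x `^ (- b - 1) * trig p x]; the junk value [0] of the coefficient
   [j%:R = b] is harmless exactly when [p] and [b] are nonresonant. *)
Definition antic p b j : R := tau R p j / ((j%:R - b) * j`!%:R).
Definition antis p b y : R := limn (pseries (antic p b) y).
Definition anti p b y : R := y `^ (- b) * antis p b y.

(** This fails exactly when [b] is a natural number with [b - p] even; the term [j = b] would then
    integrate to a logarithm. *)
Definition nonresonant p b := forall j, j%:R = b -> tau R p j = 0.

(** Only finitely many [j] have [j - b < 1]. The constant is not uniform in [b] and serves
    convergence for fixed [b] alone; uniform bounds come from [tail_coef_le]. *)
Lemma antic_le p b : exists2 C, 0 <= C & forall j, `|antic p b j| <= C / j`!%:R.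
Proof.
have [C C0 hC] : exists2 C, 0 <= C & forall j : nat, `|(j%:R - b)^-1| <= C.
  pose n := (Num.truncn `|b|).+1.
  pose C0 := \sum_(j < n.+1) `|(j%:R - b)^-1|.
  exists (1 + C0); first by rewrite addr_ge0// sumr_ge0.
  move=> j; have [jn|jn] := ltnP j n.+1.
    apply: (@le_trans _ _ C0); last by rewrite lerDr.
    by rewrite /C0 (bigD1 (Ordinal jn))//= lerDl sumr_ge0.
  apply: (@le_trans _ _ 1); last by rewrite lerDl sumr_ge0.
  have h : 1 <= j%:R - b.
    have h1 : b < n%:R by apply: le_lt_trans (truncnS_gt _); exact: ler_norm.
    have h2 : n%:R + 1 <= j%:R :> R by rewrite natr1 ler_nat.
    lra.
  by rewrite normfV invf_le1 ?normr_gt0 ?gt_eqF ?(lt_le_trans _ h)// (le_trans h)// ler_norm.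
exists C => // j; rewrite /antic invfM mulrA normrM [X in _ * X]ger0_norm//.
rewrite ler_wpM2r// normrM -[leRHS]mul1r; apply: ler_pM => //; exact: tau_le1.
Qed.

Lemma pseries_diffsE c C y : (forall j, `|c j| <= C / j`!%:R) ->
  series (fun j => j%:R * c j * y ^+ j) @ \oo --> y * limn (pseries (pseries_diffs c) y).
Proof.
move=> cC; have dC := pseries_diffs_expmaj cC.
have := pseries_diffs_equiv (cvg_expmaj (x := y) dC) => h.
rewrite (_ : series _ = (fun n => y * series (fun i => i%:R * c i * y ^+ i.-1) n)).
  exact: cvgMr.
apply/funext => n; rewrite /series/= mulr_sumr; apply: eq_bigr => -[_|i _].
  by rewrite !mul0r mulr0.
by rewrite exprS; ring.
Qed.

(** The Euler operator [y * d/dy - b] multiplies the [j]-th term by [j - b], which cancels the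
    denominator of [antic]. Nonresonance settles [j = b], where [tau p j] has to be zero already. *)
Lemma antis_ode p b y : nonresonant p b ->
  y * limn (pseries (pseries_diffs (antic p b)) y) = trig p y + b * antis p b y.
Proof.
move=> nr; have [C _ hC] := antic_le p b.
have h1 := pseries_diffsE (y := y) hC.
have h2 : (fun n => series (fun j => tau R p j * y ^+ j / j`!%:R) n + b * pseries (antic p b) y n) @ \oo -->
    trig p y + b * antis p b y.
  by apply: cvgD; [exact: cvg_trig|apply: cvgMr; exact: cvg_expmaj hC].
move: h1; rewrite (_ : series _ =
  (fun n => series (fun j => tau R p j * y ^+ j / j`!%:R) n + b * pseries (antic p b) y n)).
  by move=> h1; exact: (cvg_unique _ h1 h2).
apply/funext => n; rewrite /pseries /series/= mulr_sumr -big_split/=; apply: eq_bigr => i _.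
suff : i%:R * antic p b i - b * antic p b i = tau R p i / i`!%:R.
  move=> e; rewrite -[LHS](subrK (b * (antic p b i * y ^+ i))); congr (_ + _).
  by rewrite mulrA -mulrBl e mulrAC.
rewrite -mulrBl /antic; have [/eqP ib|ib] := eqVneq i%:R b.
  by rewrite nr ?mul0r ?mulr0//; exact/eqP.
have ib' : i%:R - b != 0 by rewrite subr_eq0.
have fi : i`!%:R != 0 :> R by rewrite pnatr_eq0 -lt0n fact_gt0.
by field; rewrite ib' fi.
Qed.

Lemma is_derive_anti p b y : nonresonant p b -> 0 < y ->
  is_derive y (1 : R) (anti p b) (y `^ (- b - 1) * trig p y).
Proof.
move=> nr y0; have [C _ hC] := antic_le p b.
have h := is_deriveM (is_derive_powR (- b) y0) (is_derive_expmaj y hC).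
apply: (is_derive_eq h); rewrite /GRing.scale/=.
have yb : y `^ (- b) = y `^ (- b - 1) * y.
  by rewrite -{3}[y]powRr1 ?(ltW y0)// -powRD ?subrK// (gt_eqF y0) implybT.
rewrite {1}yb -mulrA antis_ode// /antis; ring.
Qed.

(** The limit of [anti p b] at infinity; by [trig_tail_anti] any other base point in place of [1]
    gives the same number. *)
Definition anti_cst p b : R := trig_tail p b 1 1 + anti p b 1.

Lemma continuous_powR_trig b p z x : 0 < x ->
  {for x, continuous (fun x : R => x `^ b * trig p (x * z))}.
Proof.
move=> x0; apply: cvgM; first exact: continuous_powR.
by apply: continuous_comp; [exact: cvgMl|exact: continuous_trig].
Qed.

Lemma trig_tail_anti p b y : nonresonant p b -> 0 < b -> 0 < y ->
  trig_tail p b y 1 + anti p b y = anti_cst p b.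
Proof.
move=> nr b0.
have key u v : 0 < u -> u <= v -> trig_tail p b u 1 + anti p b u = trig_tail p b v 1 + anti p b v.
  move=> u0 uv; apply: tail_antiderivative => //.
  - move=> x ux; rewrite mulr1; apply: is_derive_anti => //; exact: lt_le_trans ux.
  - move=> x ux; apply: continuous_powR_trig; exact: lt_le_trans ux.
  - exact: integrable_powR_trig.
move=> y0; have [y1|/ltW y1] := leP y 1; first exact: key.
by rewrite /anti_cst (key 1 y).
Qed.

(** The change of variable [x * z] is made on antiderivatives. The difference of the two sides
    equals, for every [t >= y], a difference of tails beyond [t], which is [O(t ^ - b)]; hence it is
    zero. *)
Lemma trig_tailE p b y z : nonresonant p b -> 0 < b -> 0 < y -> 0 < z ->
  trig_tail p b y z = z `^ b * (anti_cst p b - anti p b (y * z)).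
Proof.
move=> nr b0 y0 z0.
have key v : y <= v -> trig_tail p b y z + z `^ b * anti p b (y * z) = trig_tail p b v z
    + z `^ b * anti p b (v * z).
  move=> yv; apply: (@tail_antiderivative _ (fun x => z `^ b * anti p b (x * z)) _ _ yv).
  - move=> x yx; have x0 : 0 < x by exact: lt_le_trans yx.
    have h1 : is_derive x (1 : R) (fun x : R => x * z) z.
      by apply: (is_derive_eq (is_deriveM (is_derive_id x (1 : R)) (is_derive_cst z x (1 : R))));
          rewrite /GRing.scale/= mulr0 mulr1 add0r.
    have h2 := @is_derive1_comp _ (anti p b) (fun x => x * z) x _ _ (is_derive_anti nr (mulr_gt0 x0 z0)) h1.
    apply: (is_derive_eq (is_deriveZ (z `^ b) h2)); rewrite /GRing.scale/=.
    rewrite powRM ?ltW//.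
    have -> : z `^ b * (x `^ (- b - 1) * z `^ (- b - 1) * trig p (x * z) * z) =
        (z `^ b * z `^ 1 * z `^ (- b - 1)) * (x `^ (- b - 1) * trig p (x * z)).
      by rewrite powRr1 ?ltW//; ring.
    by rewrite -!powRD ?(gt_eqF z0) ?implybT// (_ : b + 1 + _ = 0) ?powRr0 ?mul1r//; ring.
  - move=> x yx; apply: continuous_powR_trig; exact: lt_le_trans yx.
  - exact: integrable_powR_trig.
apply/eqP; rewrite -subr_eq0; apply/eqP.
apply: (@powRN_bound_eq0 _ (2 / b) y b) => // t yt.
have t0 : 0 < t by exact: lt_le_trans yt.
have -> : trig_tail p b y z - z `^ b * (anti_cst p b - anti p b (y * z)) =
   trig_tail p b t z - z `^ b * trig_tail p b (t * z) 1.
  by rewrite -(trig_tail_anti nr b0 (mulr_gt0 t0 z0)); have := key t yt; lra.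
apply: (le_trans (ler_normB _ _)).
have -> : 2 / b * t `^ (- b) = t `^ (- b) / b + z `^ b * ((t * z) `^ (- b) / b).
  have -> : z `^ b * ((t * z) `^ (- b) / b) = (z `^ b * z `^ (- b)) * (t `^ (- b) / b).
    by rewrite powRM ?ltW//; ring.
  by rewrite -powRD ?(gt_eqF z0) ?implybT// subrr powRr0; ring.
rewrite normrM (ger0_norm (powR_ge0 z b)).
by apply: lerD; rewrite ?ler_wpM2l ?powR_ge0 ?trig_tail_le ?mulr_gt0.
Qed.

Lemma antic_shift p b j : antic p.+1 (b - 1) j = - pseries_diffs (antic p b) j.
Proof.
rewrite /antic /pseries_diffs -tauS tauSS factS natrM -natr1.
rewrite (_ : j%:R - (b - 1) = j%:R + 1 - b); last by ring.
(* At [j + 1 = b] both sides are [0], because the inverse of [0] is [0]. *)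
have [->|jb] := eqVneq (j%:R + 1 - b) 0; first by rewrite !(mul0r, invr0, mulr0) oppr0.
have fi : j`!%:R != 0 :> R by rewrite pnatr_eq0 -lt0n fact_gt0.
have j1 : j%:R + 1 != 0 :> R by rewrite natr1 pnatr_eq0.
by field; rewrite fi jb j1.
Qed.

Lemma anti_shift p b y : nonresonant p b -> b != 0 -> 0 < y ->
  anti p b y + anti p.+1 (b - 1) y / b = - (y `^ (- b) * trig p y / b).
Proof.
move=> nr b0 y0; rewrite /anti.
have -> : antis p.+1 (b - 1) y = - limn (pseries (pseries_diffs (antic p b)) y).
  have [C _ hC] := antic_le p b.
  rewrite /antis -limN; last exact: cvg_expmaj (pseries_diffs_expmaj hC).
  congr (limn _); apply/funext => n; rewrite fctE /pseries /series/= -sumrN.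
  by apply: eq_bigr => i _; rewrite antic_shift mulNr.
have -> : y `^ (- (b - 1)) = y `^ (- b) * y.
  by rewrite -{3}[y]powRr1 ?ltW// -powRD ?(gt_eqF y0) ?implybT//; congr (_ `^ _); ring.
have := antis_ode y nr; set L := limn _ => hL.
have -> : y `^ (- b) * y * - L = - (y `^ (- b) * (y * L)) by ring.
by rewrite hL; field.
Qed.

(** Integration by parts, using that [trig p] has derivative [- trig p.+1]. It trades [b] for
    [b - 1] and [p] for [p + 1]; the condition [1 < b] keeps the new tail convergent. *)
Lemma trig_tail_shift p b y : 1 < b -> 0 < y ->
  trig_tail p b y 1 + trig_tail p.+1 (b - 1) y 1 / b = y `^ (- b) * trig p y / b.
Proof.
move=> b1 y0; have b0 : 0 < b by lra.
have b10 : 0 < b - 1 by lra.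
pose f x := x `^ (- b - 1) * trig p (x * 1) + b^-1 * (x `^ (- (b - 1) - 1) * trig p.+1 (x * 1)).
pose F x := - (b^-1 * (x `^ (- b) * trig p x)).
have i1 t : 0 < t -> mu.-integrable `[t, +oo[ (EFin \o (fun x => x `^ (- b - 1) * trig p (x * 1))).
  by move=> t0; exact: integrable_powR_trig.
have i2 t : 0 < t -> mu.-integrable `[t, +oo[ (EFin \o (fun x => x `^ (- (b - 1) - 1) * trig p.+1 (x * 1))).
  by move=> t0; exact: integrable_powR_trig.
have fE t : 0 < t -> \int[mu]_(x in `[t, +oo[) f x = trig_tail p b t 1 + trig_tail p.+1 (b - 1) t 1 / b.
  move=> t0; rewrite /f RintegralD//; [|exact: i1|by apply: integrableZ_real => //; exact: i2].
  by rewrite RintegralZl//; [rewrite [_ / b]mulrC|exact: i2].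
have key t : y <= t -> \int[mu]_(x in `[y, +oo[) f x + F y = \int[mu]_(x in `[t, +oo[) f x + F t.
  move=> yt; apply: (tail_antiderivative yt).
  - move=> x yx; have x0 := lt_le_trans y0 yx.
    have h := is_deriveZ (b^-1) (is_deriveM (is_derive_powR (- b) x0) (is_derive_trig p x)).
    apply: (is_derive_eq (is_deriveN h)); rewrite /GRing.scale/= /f !mulr1.
    rewrite (_ : - (b - 1) - 1 = - b); last by ring.
    by field; rewrite gt_eqF.
  - move=> x yx; have x0 := lt_le_trans y0 yx.
    by apply: cvgD; [|apply: cvgMr]; exact: continuous_powR_trig.
  - by apply: integrableD_real; [|exact: i1|apply: integrableZ_real => //; exact: i2].
rewrite -fE//; apply/eqP; rewrite -subr_eq0; apply/eqP.
(* The three summands bound the two tails beyond [t] and the boundary term at [t]; taking [t >= 1]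
   gives [t ^ - b <= t ^ - (b - 1)]. *)
apply: (@powRN_bound_eq0 (_ - _) (b^-1 + (b - 1)^-1 / b + b^-1) (Num.max y 1) (b - 1)) => // t.
rewrite ge_max => /andP[yt t1]; have t0 : 0 < t by exact: lt_le_trans yt.
have -> : \int[mu]_(x in `[y, +oo[) f x - y `^ (- b) * trig p y / b =
    trig_tail p b t 1 + (trig_tail p.+1 (b - 1) t 1 / b - b^-1 * (t `^ (- b) * trig p t)).
  have := key t yt; rewrite fE// /F => e.
  by rewrite [RHS]addrA -(fE t t0) -e; ring.
have tb : t `^ (- b) <= t `^ (- (b - 1)) by apply: ler_powR => //; lra.
have bi : 0 <= b^-1 by rewrite invr_ge0 ltW.
apply: (le_trans (ler_normD _ _)); rewrite mulrDl mulrDl -addrA; apply: lerD.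
  apply: le_trans (trig_tail_le _ _ b0 t0) _.
  by rewrite mulrC ler_wpM2l.
apply: (le_trans (ler_normB _ _)); apply: lerD.
  rewrite normrM [X in _ * X]ger0_norm// mulrAC ler_wpM2r// mulrC.
  exact: trig_tail_le.
rewrite normrM [X in X * _]ger0_norm// ler_wpM2l// normrM ger0_norm ?powR_ge0//.
by apply: le_trans tb; rewrite ler_piMr ?powR_ge0 ?norm_trig.
Qed.

Lemma nonresonantS p b : nonresonant p b -> nonresonant p.+1 (b - 1).
Proof.
by move=> nr j jb; rewrite -tauS tauSS nr ?oppr0// -natr1 jb subrK.
Qed.

(** The right-hand sides of [trig_tail_shift] and [anti_shift] are opposite, so adding the two
    identities at [1] leaves only the constants. *)
Lemma anti_cst_shift p b : nonresonant p b -> 1 < b ->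
  anti_cst p b = - anti_cst p.+1 (b - 1) / b.
Proof.
move=> nr b1; have b0 : 0 < b by lra.
have b10 : 0 < b - 1 by lra.
have := trig_tail_shift p b1 ltr01; have := anti_shift nr (lt0r_neq0 b0) ltr01.
by rewrite /anti_cst mulNr; lra.
Qed.
End Tails.

(** * Bounds uniform in the exponent, and the expansion of a tail *)

Section Bounds.
Variable R : realType.
Notation mu := (@lebesgue_measure R).
Implicit Types (p j : nat) (b s x y z rho : R).

Lemma sin_mean x : 0 <= x -> exists2 t, 0 <= t <= x & sin x = x * cos t.
Proof.
rewrite le_eqVlt => /predU1P[<-|x0]; first by exists 0; rewrite ?lexx// sin0 mul0r.
have [|t] := @MVT R sin cos 0 x x0 (fun y _ => is_derive_sin y).
  by apply: continuous_subspaceT; exact: continuous_sin.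
rewrite in_itv/= => /andP[t0 tx]; rewrite sin0 !subr0 => ->.
by exists t; [rewrite !ltW|rewrite mulrC].
Qed.

Lemma norm_sin_le x : `|sin x| <= `|x|.
Proof.
wlog x0 : x / 0 <= x => [h|].
  have [/h//|/ltW x0] := leP 0 x.
  by rewrite -normrN -sinN -[leRHS]normrN h// oppr_ge0.
have [t _ ->] := sin_mean x0.
by rewrite normrM ler_piMr// cos_max.
Qed.

(** [sin x = 2 * sin (x / 2) * cos (x / 2) >= x * cos (x / 2) ^ 2 = x * (1 + cos x) / 2], and
    [cos x >= 0]. *)
Lemma sin_ge_half x : 0 <= x <= pi / 2 -> x / 2 <= sin x.
Proof.
move=> /andP[x0 xp]; have pi4 := pihalf_lt2 R.
have x20 : 0 <= x / 2 by lra.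
have [t /andP[t0 tx] st] := sin_mean x20.
have cx : 0 <= cos x by apply: cos_ge0_pihalf; rewrite xp andbT; lra.
have ct : cos (x / 2) <= cos t.
  move: tx; rewrite le_eqVlt => /predU1P[->//|tx]; apply/ltW.
  by rewrite ltr_cos// in_itv/=; lra.
have c2 : cos x = cos (x / 2) ^+ 2 *+ 2 - 1 by rewrite -cos_mulr2n; congr cos; lra.
have s2 : sin x = (cos (x / 2) * sin (x / 2)) *+ 2 by rewrite -sin_mulr2n; congr sin; lra.
have c0 : 0 <= cos (x / 2) by apply: cos_ge0_pihalf; lra.
rewrite s2 st.
have : x / 2 * cos (x / 2) <= x / 2 * cos t by rewrite ler_wpM2l.
move=> /(ler_wpM2l c0); rewrite c2 in cx; nra.
Qed.

(** A geometric series dominates, since [(n + 4)! >= 12 * 2 ^ (n + 1)], with equality at [n = 0]. *)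
Lemma inv_fact_tail n : \sum_(i < n) ((i + 4)`!%:R)^-1 <= 12^-1 * (1 - 2^-1 ^+ n) :> R.
Proof.
elim: n => [|n ih]; first by rewrite big_ord0 expr0 subrr mulr0.
rewrite big_ord_recr/=; apply: le_trans (lerD ih (_ : _ <= 12^-1 * 2^-1 ^+ n.+1)) _; last first.
  by rewrite exprS; lra.
rewrite exprVn -invfM lef_pV2 ?posrE ?ltr0n ?fact_gt0 ?mulr_gt0 ?exprn_gt0//.
elim: n {ih} => [|n ih]; first by rewrite expr1 add0n -natrM ler_nat.
rewrite addSn factS natrM exprS mulrCA; apply: ler_pM => //.
by rewrite ler_nat addnC.
Qed.

(** The terms [j = 0] and [j = 2] carry the poles at the ends of [(0, 2)] and are split off; odd
    terms vanish. For [j >= 4] one has [j - s >= 2], so the rest is at most [1/2 * 1/12]. *)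
Lemma antis0_est s : 0 < s < 2 ->
  `|antis 0 s 1 + s^-1 + (2 * (2 - s))^-1| <= 24^-1.
Proof.
move=> /andP[s0 s2]; have [C _ hC] := antic_le 0 s.
have hc : pseries (antic 0 s) 1 n @[n --> \oo] --> antis 0 s 1 by exact: cvg_expmaj hC.
have hc4 : pseries (antic 0 s) 1 (n + 4)%N + s^-1 + (2 * (2 - s))^-1 @[n --> \oo] -->
    antis 0 s 1 + s^-1 + (2 * (2 - s))^-1.
  apply: cvgD; last exact: cvg_cst.
  by apply: cvgD; [rewrite cvg_shiftn|exact: cvg_cst].
have t0 : tau R 0 0 = 1 by rewrite /tau subrr mul0r cos0.
have t1 : tau R 0 1 = 0 by rewrite /tau subr0 mul1r cos_pihalf.
have t2 : tau R 0 2 = -1 by rewrite tau_double t0.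
have t3 : tau R 0 3 = 0 by rewrite tau_double t1 oppr0.
apply: (cvgr_to_le (cvg_norm hc4)).
apply: nearW => n.
rewrite /pseries /series/= addnC big_mkord big_split_ord/=.
rewrite !big_ord_recl big_ord0/= /antic/= /bump/= !add1n !expr1n !mulr1.
rewrite t0 t1 t2 t3 !mul0r (_ : 2`! = 2%N)//; set X := \sum_(i < n) _.
rewrite (_ : _ + _ + s^-1 + _ = X); last by field; lra.
apply: (le_trans (ler_norm_sum _ _ _)).
apply: (@le_trans _ _ (2^-1 * \sum_(i < n) ((i + 4)`!%:R)^-1)).
  rewrite mulr_sumr; apply: ler_sum => i _.
  rewrite expr1n mulr1 normrM -[leRHS]mul1r; apply: ler_pM => //; first exact: tau_le1.
  have i4 : 4 <= (4 + i)%:R :> R by rewrite ler_nat leq_addr.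
  rewrite normfV normrM invfM [(i + 4)%N]addnC [X in _ * X^-1]ger0_norm// ler_wpM2r//.
  by rewrite lef_pV2 ?posrE ?normr_gt0 ?gt_eqF// ?ger0_norm; lra.
have := inv_fact_tail n; have : 0 <= 2^-1 ^+ n :> R by rewrite exprn_ge0.
lra.
Qed.

(** The direct bound [1 / s] blows up at [0]. One integration by parts starting from [s + 1], with
    [trig 4 = trig 0], gives [1 + (s + 1) / (s + 1)] instead. *)
Lemma trig_tail0_le2 s : 0 < s -> `|trig_tail 0 s 1 1| <= 2 :> R.
Proof.
move=> s0.
have s1 : 1 < s + 1 by rewrite ltrDr.
have := trig_tail_shift 3 s1 ltr01; rewrite (addrK 1 s) powR1 mul1r.
have -> : trig_tail 4 s 1 1 = trig_tail 0 s 1 1 :> R.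
  by rewrite (trig_tailSS 2)// (trig_tailSS 0)// opprK.
move=> e.
have h : trig_tail 0 s 1 1 = trig 3 1 - (s + 1) * trig_tail 3 (s + 1) 1 1.
  have sn : s + 1 != 0 by lra.
  have -> : trig 3 1 = (s + 1) * (trig 3 1 / (s + 1)) :> R by field.
  by rewrite -e; field.
rewrite h; apply: (le_trans (ler_normB _ _)).
have -> : 2 = 1 + 1 :> R by [].
apply: lerD; first exact: norm_trig.
rewrite normrM ger0_norm; last lra.
have := trig_tail_le 3 1 (lt_trans ltr01 s1) ltr01 => /(ler_wpM2l (ltW (lt_trans ltr01 s1))).
by rewrite powR1 mul1r mulfV//; lra.
Qed.

(** Each lower bound keeps one pole. Bounding the tail by [1 / s] sacrifices the pole at [0] and
    keeps the one at [2]; bounding it by [2] keeps the pole at [0]. *)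
Lemma anti_cst0_bounds s : 0 < s < 2 ->
  [/\ - anti_cst 0 s <= 2 / s + (2 * (2 - s))^-1 + 24^-1,
      (2 * (2 - s))^-1 - 24^-1 <= - anti_cst 0 s &
      s^-1 - 2 <= - anti_cst 0 s].
Proof.
move=> s02; have /andP[s0 s2] := s02.
have := antis0_est s02; rewrite ler_norml => /andP[e1 e2].
have := trig_tail0_le2 s0; rewrite ler_norml => /andP[v1 v2].
have := trig_tail_le 0 1 s0 ltr01; rewrite powR1 ler_norml mul1r => /andP[v3 v4].
have q : 24^-1 <= (2 * (2 - s))^-1.
  by rewrite lef_pV2 ?posrE//; lra.
rewrite /anti_cst /anti powR1 mul1r; split; lra.
Qed.

(* The reflection formula would give [anti_gamma p b = pi] for nonresonant [p] and [b]; two-sided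
   bounds, obtained by shifting [b] into the interval [(0, 2)], are enough. *)
Definition anti_gamma p b := -2 * sin ((b - p%:R) * (pi / 2)) * anti_cst p b * Gamma (b + 1).

Lemma anti_gammaSS p b : 0 < b -> anti_gamma p.+2 b = anti_gamma p b.
Proof.
move=> b0; rewrite /anti_gamma.
have -> : anti_cst p.+2 b = - anti_cst p b.
  rewrite /anti_cst trig_tailSS// opprD; congr (_ + _).
  rewrite /anti -mulrN; congr (_ * _).
  have [C _ hC] := antic_le p b.
  rewrite /antis -limN; last exact: cvg_expmaj hC.
  congr (limn _); apply/funext => n; rewrite fctE /pseries /series/= -sumrN.
  by apply: eq_bigr => i _; rewrite /antic tauSS !mulNr.
have -> : sin ((b - p.+2%:R) * (pi / 2)) = - sin ((b - p%:R) * (pi / 2)).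
  rewrite (_ : (b - p%:R) * (pi / 2) = (b - p.+2%:R) * (pi / 2) + pi); last first.
    by rewrite -addn2 natrD; field.
  by rewrite sinDpi opprK.
ring.
Qed.

(** The factor [- 1 / b] of [anti_cst_shift] is cancelled by [Gamma (b + 1) = b * Gamma b] and by
    the sign of the sine, whose angle moves by [pi]. *)
Lemma anti_gamma_shift p b : nonresonant p b -> 1 < b -> anti_gamma p b = anti_gamma p.+1 (b - 1).
Proof.
move=> nr b1; rewrite /anti_gamma (anti_cst_shift nr b1).
have -> : Gamma (b + 1) = b * Gamma b by exact: GammaS (ltW b1).
have -> : b - 1 + 1 = b by rewrite subrK.
have -> : sin ((b - 1 - p.+1%:R) * (pi / 2)) = - sin ((b - p%:R) * (pi / 2)).
  rewrite (_ : (b - p%:R) * (pi / 2) = (b - 1 - p.+1%:R) * (pi / 2) + pi); last first.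
    by rewrite -natr1; field.
  by rewrite sinDpi opprK.
by field; lra.
Qed.

(** The value is [2 * (S * - K) * G], where [S] is comparable to the distance from [s] to the nearer
    end of [(0, 2)] and so absorbs the poles of [K]. From [5 / 192 <= S * - K <= 6] and
    [exp (- 1) <= G <= 3] come both constants. *)
Lemma anti_gamma_base s : 0 < s < 2 -> 5 / 96 * expR (- 1) <= anti_gamma 0 s <= 36.
Proof.
move=> s02; have /andP[s0 s2] := s02; have [k1 k2 k3] := anti_cst0_bounds s02.
have g1 : expR (- 1) <= Gamma (s + 1).
  by have := Gamma_ge (ltW s0) ltr01; rewrite powR1 mul1r.
have g2 : Gamma (s + 1) <= 3 by apply: Gamma_le3; rewrite !ltW.
have pi2 := pi_ge2 R; have pi4 := pihalf_lt2 R.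
rewrite /anti_gamma subr0.
set S := sin _; set K := anti_cst 0 s in k1 k2 k3 *; set G := Gamma _ in g1 g2 *.
have S1 : s <= 1 -> s / 2 <= S.
  move=> s1; apply: (@le_trans _ _ (s * (pi / 2) / 2)); first nra.
  by apply: sin_ge_half; nra.
have S2 : 1 <= s -> (2 - s) / 2 <= S.
  move=> s1; have -> : S = sin ((2 - s) * (pi / 2)).
    rewrite /S (_ : (2 - s) * (pi / 2) = pi - s * (pi / 2)); last by field.
    by rewrite sinB sinpi cospi; ring.
  apply: (@le_trans _ _ ((2 - s) * (pi / 2) / 2)); first nra.
  by apply: sin_ge_half; nra.
have S3 : S <= s * 2.
  apply: le_trans (ler_norm _) _; apply: le_trans (norm_sin_le _) _.
  by rewrite ger0_norm; nra.
have S4 : S <= (2 - s) * 2.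
  have -> : S = sin ((2 - s) * (pi / 2)).
    rewrite /S (_ : (2 - s) * (pi / 2) = pi - s * (pi / 2)); last by field.
    by rewrite sinB sinpi cospi; ring.
  apply: le_trans (ler_norm _) _; apply: le_trans (norm_sin_le _) _.
  by rewrite ger0_norm; nra.
have S0 : 0 <= S by have [/S1|/ltW/S2] := leP s 1; lra.
have S5 : S <= 1 by exact: sin_le1.
have u0 : 0 < 2 - s by lra.
have si : s * s^-1 = 1 by rewrite mulfV// gt_eqF.
have ti : (2 - s) * (2 * (2 - s))^-1 = 2^-1 by field; lra.
have si0 : 0 < s^-1 by rewrite invr_gt0.
have ti0 : 0 < (2 * (2 - s))^-1 by rewrite invr_gt0; lra.
(* The range [1/4 < s < 1] decides the constant: there [S >= 1/8] and [- K >= 1/4 - 1/24 = 5/24]. *)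
have K1 : 5 / 192 <= S * - K.
  have [s1|s1] := leP 1 s.
    have := S2 s1; nra.
  have := S1 (ltW s1) => S1'.
  have [s4|s4] := leP s 4^-1.
    nra.
  have q : 4^-1 <= (2 * (2 - s))^-1 by rewrite lef_pV2 ?posrE//; lra.
  have -> : 5 / 192 = 8^-1 * (5 / 24) :> R by field.
  by apply: ler_pM; lra.
have K2 : S * - K <= 6.
  have h1 : S * (2 / s) <= 4.
    by rewrite mulrA ler_pdivrMr//; lra.
  have h2 : S * (2 * (2 - s))^-1 <= 1 by nra.
  nra.
have -> : -2 * S * K * G = 2 * (S * - K) * G by ring.
have e0 := expR_gt0 (- 1 : R).
nra.
Qed.

(** Shifts bring [b] into [(0, 1]], and the period [2] in [p] leaves [p = 0] or [p = 1]. The pair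
    [p = 1], [b = 1] is resonant, so for [p = 1] one shift backwards leads to [p = 0] and [b + 1] in
    [(1, 2)]. *)
Lemma anti_gamma_bounds p b : 0 < b -> nonresonant p b ->
  5 / 96 * expR (- 1) <= anti_gamma p b <= 36.
Proof.
have base q c : 0 < c <= 1 -> nonresonant q c -> 5 / 96 * expR (- 1) <= anti_gamma q c <= 36.
  move=> /andP[c0 c1]; elim/ltn_ind: q => -[|[|q]] ih nr.
  - by apply: anti_gamma_base; lra.
  - have c11 : c < 1.
      rewrite lt_neqAle c1 andbT; apply/negP => /eqP c1'.
      have : tau R 1 1 = 0 by apply: nr; rewrite c1'.
      by rewrite /tau subrr mul0r cos0 => /eqP; rewrite oner_eq0.
    rewrite -(addrK 1 c) -anti_gamma_shift ?ltrDr//; first by apply: anti_gamma_base; lra.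
    move=> j jc; have [->//|/eqP] := eqVneq (tau R 0 j) 0.
    have j1 : (0 < j)%N by rewrite -(ltr_nat R) jc; lra.
    have j2 : (j < 2)%N by rewrite -(ltr_nat R) jc; lra.
    have -> : j = 1%N by case: j j1 j2 {jc} => [|[|]].
    by rewrite /tau subr0 mul1r cos_pihalf.
  - rewrite anti_gammaSS//; apply: ih => // j jc.
    by apply: oppr_inj; rewrite -tauSS oppr0 nr.
move=> b0.
have [n bn] : exists n : nat, b <= n%:R + 1.
  by exists (Num.truncn b); rewrite natr1 ltW// truncnS_gt.
elim: n p b b0 bn => [|n ih] p b b0 bn nr; first by apply: base => //; rewrite b0; lra.
have [b1|b1] := leP b 1; first by apply: base => //; rewrite b0.
rewrite anti_gamma_shift//; apply: ih; [lra| |exact: nonresonantS].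
by move: bn; rewrite -natr1; lra.
Qed.

(** The phase is evaluated at [j] and not at [p], so that its zero at [b = j] visibly removes the
    small divisor: from [|sin t| <= |t|] the quotient is at most [pi], whatever [b] is. *)
Definition tail_coef p b j : R := 2 * sin ((b - j%:R) * (pi / 2)) * tau R p j / (j%:R - b).

Lemma tail_coef_le p b j : `|tail_coef p b j| <= 4.
Proof.
rewrite /tail_coef; have [->|jb] := eqVneq (j%:R - b) 0; first by rewrite invr0 mulr0 normr0.
rewrite normrM normfV ler_pdivrMr ?normr_gt0// normrM -[leRHS]mulr1.
apply: ler_pM => //; last exact: tau_le1.
have -> : 4 = 2 * 2 :> R by rewrite -natrM.
rewrite normrM (ger0_norm (ler0n R 2)).
rewrite -mulrA ler_wpM2l//; apply: le_trans (norm_sin_le _) _.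
have pi2 := pihalf_lt2 R; have pi0 := pi_ge0 R.
rewrite normrM distrC mulrC ler_wpM2r// ger0_norm; lra.
Qed.

Lemma tail_coefE p b j :
  2 * sin ((b - p%:R) * (pi / 2)) * (tau R p j / (j%:R - b)) = tail_coef p b j * tau R p j.
Proof.
rewrite /tail_coef.
rewrite (_ : (b - p%:R) * (pi / 2) = (b - j%:R) * (pi / 2) + (j%:R - p%:R) * (pi / 2)); last by ring.
rewrite sinD -/(tau R p j).
have := sin_tau R p j; set S := sin ((j%:R - p%:R) * _) => h.
rewrite [LHS](_ : _ = 2 * (sin ((b - j%:R) * (pi / 2)) * tau R p j * tau R p j
    + cos ((b - j%:R) * (pi / 2)) * (S * tau R p j)) / (j%:R - b)); last by ring.
by rewrite h mulr0 addr0; ring.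
Qed.

Lemma resonant_sin0 p b : ~ nonresonant p b -> sin ((b - p%:R) * (pi / 2)) = 0.
Proof.
move=> /existsNP[j /not_implyP[jb tj]]; rewrite -jb.
by have /eqP := sin_tau R p j; rewrite mulf_eq0 => /orP[/eqP//|/eqP].
Qed.

(** The tail is multiplied by the phase before it is expanded: at a resonance the phase,
    [anti_gamma] and all coefficients vanish, and no logarithm appears. Otherwise this is
    [trig_tailE] written as a series. *)
Lemma trig_tail_series p b rho z : 0 < b -> 0 < rho -> 0 <= z ->
  series (fun j => tail_coef p b j * rho `^ (j%:R - b) * tau R p j * z ^+ j / j`!%:R) @ \oo -->
  -2 * sin ((b - p%:R) * (pi / 2)) * trig_tail p b rho z - anti_gamma p b * (z `^ b / Gamma (b + 1)).
Proof.
move=> b0 r0 z0.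
have uE j : tail_coef p b j * rho `^ (j%:R - b) * tau R p j * z ^+ j / j`!%:R =
   2 * sin ((b - p%:R) * (pi / 2)) * (tau R p j / (j%:R - b) * rho `^ (j%:R - b) * z ^+ j / j`!%:R).
  transitivity (tail_coef p b j * tau R p j * (rho `^ (j%:R - b) * z ^+ j / j`!%:R)); first by ring.
  by rewrite -tail_coefE; ring.
have [nr|/resonant_sin0 s0] := pselect (nonresonant p b); last first.
  rewrite s0 !(mulr0, mul0r) /anti_gamma s0 !(mulr0, mul0r) subrr.
  apply: cvg_near_cst; near=> n; rewrite /series/= big1// => i _.
  by rewrite uE s0 !(mulr0, mul0r).
rewrite (_ : series _ = fun n => 2 * sin ((b - p%:R) * (pi / 2)) *
   series (fun j => tau R p j / (j%:R - b) * rho `^ (j%:R - b) * z ^+ j / j`!%:R) n); last first.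
  by apply/funext => n; rewrite /series/= mulr_sumr; apply: eq_bigr => i _.
have rj j : rho `^ (j%:R - b) = rho ^+ j * rho `^ (- b).
  by rewrite powRD ?(gt_eqF r0) ?implybT// powR_mulrn ?ltW.
(* [trig_tailE] needs [z > 0]. At [z = 0] only the term [j = 0] of the series survives, and
   [0 ^ b = 0]. *)
move: z0; rewrite le_eqVlt => /predU1P[<-|z0].
  rewrite powR0 ?gt_eqF// mul0r mulr0 subr0.
  rewrite (_ : _ * trig_tail _ _ _ _ = 2 * sin ((b - p%:R) * (pi / 2)) * (- tau R p 0 * rho `^ (- b) / b)).
    apply: cvgMr; apply: cvg_near_cst; near=> n.
    rewrite -[n]prednK; last by near: n; exact: nbhs_infty_gt.
    rewrite /series/= big_nat_recl//= big1 ?addr0; last by move=> i _; rewrite expr0n mulr0 mul0r.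
    by rewrite !sub0r expr0 fact0 divr1; field; lra.
  rewrite /trig_tail; under eq_Rintegral do rewrite mulr0 mulrC.
  rewrite RintegralZl//; last exact: integrable_powRN.
  have -> : trig p 0 = tau R p 0 by rewrite /trig /tau mulrBl mul0r.
  by rewrite Rintegral_powRN//; ring.
have [C _ hC] := antic_le p b.
have hs := cvg_expmaj (x := rho * z) hC.
have -> : -2 * sin ((b - p%:R) * (pi / 2)) * trig_tail p b rho z - anti_gamma p b * (z `^ b / Gamma (b + 1)) =
   2 * sin ((b - p%:R) * (pi / 2)) * (rho `^ (- b) * antis p b (rho * z)).
  have G0 : Gamma (b + 1) != 0 by rewrite gt_eqF// Gamma_gt0// ltW.
  rewrite trig_tailE// /anti_gamma /anti powRM ?ltW//.
  have zz : z `^ b * z `^ (- b) = 1 by rewrite -powRD ?(gt_eqF z0) ?implybT// subrr powRr0.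
  rewrite (_ : z `^ b * _ = z `^ b * anti_cst p b
      - (z `^ b * z `^ (- b)) * (rho `^ (- b) * antis p b (rho * z))); last by ring.
  by rewrite zz mul1r; field.
apply: cvgMr.
rewrite (_ : series _ = fun n => rho `^ (- b) * pseries (antic p b) (rho * z) n); first exact: cvgMr.
apply/funext => n; rewrite /pseries /series/= mulr_sumr; apply: eq_bigr => i _.
by rewrite /antic rj exprMn invfM; ring.
Unshelve. all: by end_near. Qed.

End Bounds.

(** * A Paley-Wiener theorem *)

Section NonnegativeCone.
Variable R : realType.
Implicit Types (f g : R -> R) (h z : R).

Definition cdiff h f z : R := (f (z + h) - f (z - h)) / 2.
Definition cmean h f z : R := (f (z + h) + f (z - h)) / 2.

(** Polynomials with nonnegative coefficients, given by closure rules on functions: only their sign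
    on [z >= 0] and their stability under [cdiff] matter. *)
Inductive nnpoly : (R -> R) -> Prop :=
| nnpoly_cst c : 0 <= c -> nnpoly (fun=> c)
| nnpoly_id : nnpoly id
| nnpolyD f g : nnpoly f -> nnpoly g -> nnpoly (fun z => f z + g z)
| nnpolyM f g : nnpoly f -> nnpoly g -> nnpoly (fun z => f z * g z).

Lemma nnpoly_ge0 f z : nnpoly f -> 0 <= z -> 0 <= f z.
Proof.
move=> nf z0; elim: nf => //= *; first exact: addr_ge0.
exact: mulr_ge0.
Qed.

Lemma nnpolyX n : nnpoly (fun z => z ^+ n).
Proof.
elim: n => [|n ih]; first exact: nnpoly_cst.
rewrite (_ : (fun _ => _) = (fun z => z * z ^+ n)); last by apply/funext => z; rewrite exprS.
exact: nnpolyM nnpoly_id ih.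
Qed.

(* The product rule for [cdiff] involves [cmean], whence the joint induction. *)
Lemma nnpoly_cdiff_cmean h f : 0 <= h -> nnpoly f -> nnpoly (cdiff h f) /\ nnpoly (cmean h f).
Proof.
move=> h0; elim.
- move=> c c0; split.
    rewrite (_ : cdiff h _ = fun=> 0); first exact: nnpoly_cst.
    by apply/funext => z; rewrite /cdiff subrr mul0r.
  rewrite (_ : cmean h _ = fun=> c); first exact: nnpoly_cst.
  by apply/funext => z; rewrite /cmean; field.
- split.
    rewrite (_ : cdiff h _ = fun=> h); first exact: nnpoly_cst.
    by apply/funext => z; rewrite /cdiff; field.
  rewrite (_ : cmean h _ = id); first exact: nnpoly_id.
  by apply/funext => z; rewrite /cmean; field.
- move=> {}f g _ [df mf] _ [dg mg]; split.
    rewrite (_ : cdiff h _ = fun z => cdiff h f z + cdiff h g z); first exact: nnpolyD.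
    by apply/funext => z; rewrite /cdiff; field.
  rewrite (_ : cmean h _ = fun z => cmean h f z + cmean h g z); first exact: nnpolyD.
  by apply/funext => z; rewrite /cmean; field.
- move=> {}f g _ [df mf] _ [dg mg]; split.
    rewrite (_ : cdiff h _ = fun z => cdiff h f z * cmean h g z + cmean h f z * cdiff h g z).
      by apply: nnpolyD; exact: nnpolyM.
    by apply/funext => z; rewrite /cdiff /cmean; field.
  rewrite (_ : cmean h _ = fun z => cmean h f z * cmean h g z + cdiff h f z * cdiff h g z).
    by apply: nnpolyD; exact: nnpolyM.
  by apply/funext => z; rewrite /cdiff /cmean; field.
Qed.

Lemma iter_cdiff_exp_ge0 h m j z : 0 <= h -> 0 <= z -> 0 <= iter m (cdiff h) (fun z => z ^+ j) z.
Proof.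
move=> h0 z0; apply: nnpoly_ge0 => //; elim: m => [|m ih] /=; first exact: nnpolyX.
by have [] := nnpoly_cdiff_cmean h0 ih.
Qed.

Definition sinhr (x : R) : R := (expR x - expR (- x)) / 2.

Lemma sinhr_ge0 x : 0 <= x -> 0 <= sinhr x.
Proof. by move=> x0; rewrite divr_ge0// subr_ge0 ler_expR; lra. Qed.

(** [exp (rho * z)] is an eigenfunction of [cdiff h] with eigenvalue [sinhr (rho * h)]; the operator
    is applied to its Taylor series termwise. *)
Lemma cvg_iter_cdiff_exp h m rho z :
  series (fun j => rho ^+ j / j`!%:R * iter m (cdiff h) (fun z => z ^+ j) z) @ \oo -->
  sinhr (rho * h) ^+ m * expR (rho * z).
Proof.
elim: m z => [|m ih] z /=.
  rewrite expr0 mul1r (_ : (fun j => _) = exp_coeff (rho * z)).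
    exact: is_cvg_series_exp_coeff.
  by apply/funext => j; rewrite /exp_coeff/= exprMn mulrAC.
rewrite (_ : series _ = fun n => 2^-1 *
  (series (fun j => rho ^+ j / j`!%:R * iter m (cdiff h) (fun z => z ^+ j) (z + h)) n -
   series (fun j => rho ^+ j / j`!%:R * iter m (cdiff h) (fun z => z ^+ j) (z - h)) n)); last first.
  apply/funext => n; rewrite /series/= -sumrB mulr_sumr; apply: eq_bigr => i _.
  by rewrite {1}/cdiff; ring.
rewrite (_ : _ ^+ m.+1 * _ = 2^-1 * (sinhr (rho * h) ^+ m * expR (rho * (z + h)) -
   sinhr (rho * h) ^+ m * expR (rho * (z - h)))).
  by apply: cvgMr; apply: cvgB.
by rewrite (mulrDr rho z h) (mulrBr rho z h) !expRD exprS {1}/sinhr; ring.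
Qed.

Lemma sinhr_le t : 0 <= t < 1 -> sinhr t <= t / (1 - t).
Proof.
move=> /andP[t0 t1]; have u0 : 0 < 1 - t by lra.
have h1 : 1 - t <= expR (- t) by have := expR_ge1Dx (- t); lra.
have h2 : expR t <= (1 - t)^-1.
  by rewrite -[expR t]invrK -expRN lef_pV2 ?posrE ?expR_gt0.
have h3 : (1 - t) * (1 - t)^-1 = 1 by rewrite mulfV// gt_eqF.
have h4 : 0 < (1 - t)^-1 by rewrite invr_gt0.
rewrite /sinhr; nra.
Qed.

End NonnegativeCone.

(** * Limits of [sin (h x) / h] and of [exp (- u ^ n)] *)

Section Limits.
Variable R : realType.
Implicit Types x y : R.

Lemma cvg_exprn (T : Type) (F : set_system T) (FF : Filter F) (f : T -> R) (l : R) n :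
  f x @[x --> F] --> l -> f x ^+ n @[x --> F] --> l ^+ n.
Proof. by move=> fl; exact: (cvg_comp _ _ fl (@exprn_continuous _ n l)). Qed.

Lemma norm_sin_sub y : `|sin y - y| <= `|y| * y ^+ 2.
Proof.
wlog y0 : y / 0 <= y => [h|].
  have [/h//|/ltW y0] := leP 0 y.
  have yN : 0 <= - y by rewrite oppr_ge0.
  have := h _ yN; rewrite sinN normrN sqrrN (_ : - sin y - - y = - (sin y - y)); last by ring.
  by rewrite normrN.
have [t /andP[t0 ty] ->] := sin_mean y0.
rewrite -[X in _ - X]mulr1 -mulrBr normrM ler_wpM2l//.
have -> : cos t - 1 = - (2 * sin (t / 2) ^+ 2).
  by have := cos_mulr2n (t / 2); rewrite (_ : t / 2 *+ 2 = t) ?cos2sin2; [lra|lra].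
rewrite normrN ger0_norm; last by rewrite mulr_ge0 ?sqr_ge0.
have t20 : 0 <= t / 2 by lra.
have := norm_sin_le (t / 2); rewrite (ger0_norm t20).
move=> h; have : `|sin (t / 2)| ^+ 2 <= (t / 2) ^+ 2 by rewrite lerXn2r ?nnegrE//; lra.
rewrite real_normK ?num_real// => h2.
have : t ^+ 2 <= y ^+ 2 by rewrite lerXn2r ?nnegrE.
by have t22 := sqr_ge0 t; rewrite expr_div_n in h2; lra.
Qed.

Lemma cvg_sin_div (h : nat -> R) x : (forall n, 0 < h n) -> h n @[n --> \oo] --> 0 ->
  sin (h n * x) / h n @[n --> \oo] --> x.
Proof.
move=> h0 hcv.
have hz : `|x| * (h n * x) ^+ 2 @[n --> \oo] --> 0.
  rewrite (_ : 0 = `|x| * (0 * x) ^+ 2); last by rewrite mul0r expr0n mulr0.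
  by apply: cvgMr; apply: cvg_exprn; apply: cvgMl.
apply/cvgrPdist_le => e e0; near=> n.
have le : `|x - sin (h n * x) / h n| <= `|x| * (h n * x) ^+ 2.
  have -> : x - sin (h n * x) / h n = - (sin (h n * x) - h n * x) / h n.
    by field; rewrite gt_eqF.
  rewrite mulNr normrN normrM normfV [X in _ / X]gtr0_norm// ler_pdivrMr//.
  apply: le_trans (norm_sin_sub _) _; rewrite normrM [X in X * _ * _]gtr0_norm//.
  by rewrite le_eqVlt; apply/orP; left; apply/eqP; ring.
apply: le_trans le _; near: n.
by apply: (cvgr_le 0).
Unshelve. all: by end_near. Qed.

Lemma cvg_expRN_expr (u : R) : 0 <= u ->
  expR (- u ^+ n) @[n --> \oo] --> (if u < 1 then 1 else if u == 1 then expR (-1) else 0 : R).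
Proof.
move=> u0; case: ifPn => [u1|].
  rewrite -[X in _ --> X]expR0 -[X in expR X]oppr0; apply: continuous_cvg; first exact: continuous_expR.
  by apply: cvgN; apply: cvg_expr; rewrite ger0_norm.
rewrite -leNgt => u1; case: eqVneq => [->|un1].
  by under eq_fun do rewrite expr1n; exact: cvg_cst.
have {}u1 : 1 < u by rewrite lt_neqAle eq_sym un1.
have up : 0 < u by exact: lt_trans u1.
apply: (@squeeze_cvgr _ _ _ _ (fun=> 0) (fun n => u^-1 ^+ n)).
- near=> n; rewrite expR_ge0/= exprVn expRN lef_pV2 ?posrE ?expR_gt0 ?exprn_gt0//.
  by apply: le_trans (expR_ge1Dx _); rewrite lerDr.
- exact: cvg_cst.
- by apply: cvg_expr; rewrite ger0_norm ?invr_ge0// invf_lt1.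
Unshelve. all: by end_near. Qed.

End Limits.

(** * Functionals whose cosine and sine transforms have exponential type [rho] *)

Section PaleyWiener.
Variable R : realType.
Implicit Types (f g : R -> R) (x y z a s : R).

Definition bounded_mfun f := measurable_fun [set: measurableTypeR R] f /\ exists M, forall x, `|f x| <= M.

Definition bounded_cvg_functional (L : (R -> R) -> R) :=
  (forall k f g, bounded_mfun f -> bounded_mfun g -> L (fun x => k * f x + g x) = k * L f + L g) /\
  (forall (f_ : nat -> R -> R) f M, (forall n, measurable_fun [set: measurableTypeR R] (f_ n)) ->
     (forall n x, `|f_ n x| <= M) -> (forall x, f_ n x @[n --> \oo] --> f x) ->
     L (f_ n) @[n --> \oo] --> L f).

Lemma bounded_mfun_cst c : bounded_mfun (fun=> c).
Proof. by split; [exact: measurable_cst|exists `|c|]. Qed.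

Lemma bounded_mfunD f g : bounded_mfun f -> bounded_mfun g -> bounded_mfun (fun x => f x + g x).
Proof.
move=> [mf [M hM]] [mg [N hN]]; split; first exact: measurable_funD.
by exists (M + N) => x; apply: le_trans (ler_normD _ _) _; exact: lerD.
Qed.

Lemma bounded_mfunM f g : bounded_mfun f -> bounded_mfun g -> bounded_mfun (fun x => f x * g x).
Proof.
move=> [mf [M hM]] [mg [N hN]]; split; first exact: measurable_funM.
by exists (M * N) => x; rewrite normrM; exact: ler_pM.
Qed.

Lemma bounded_mfunZ k f : bounded_mfun f -> bounded_mfun (fun x => k * f x).
Proof. by move=> bf; apply: bounded_mfunM => //; exact: bounded_mfun_cst. Qed.

Lemma bounded_mfunX n f : bounded_mfun f -> bounded_mfun (fun x => f x ^+ n).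
Proof.
move=> bf; elim: n => [|n ih]; first exact: bounded_mfun_cst.
rewrite (_ : (fun _ => _) = (fun x => f x * f x ^+ n)); last by apply/funext => z; rewrite exprS.
exact: bounded_mfunM.
Qed.

Lemma bounded_mfun_sum n (f_ : nat -> R -> R) : (forall i, bounded_mfun (f_ i)) ->
  bounded_mfun (fun x => \sum_(i < n) f_ i x).
Proof.
move=> bf; elim: n => [|n ih].
  rewrite (_ : (fun _ => _) = fun=> 0); first exact: bounded_mfun_cst.
  by apply/funext => x; rewrite big_ord0.
rewrite (_ : (fun _ => _) = (fun x => \sum_(i < n) f_ i x + f_ n x)); first exact: bounded_mfunD.
by apply/funext => x; rewrite big_ord_recr.
Qed.

Lemma bounded_mfun_indic (A : set (measurableTypeR R)) : measurable A -> bounded_mfun (\1_A : R -> R).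
Proof.
move=> mA; split; first exact: measurable_indic.
by exists 1 => x; rewrite indicE; case: (_ \in _); rewrite ?normr1 ?normr0.
Qed.

Lemma bounded_mfun_trig p z : bounded_mfun (fun x => trig p (x * z)).
Proof.
split; last by exists 1 => x; exact: norm_trig.
apply: continuous_measurable_fun => x.
by apply: continuous_comp; [exact: cvgMl|exact: continuous_trig].
Qed.

Lemma tau_sign p j : (-1) ^+ j * tau R p j = (-1) ^+ p * tau R p j :> R.
Proof.
elim/ltn_ind: p j => -[|[|p]] ihp j; last by rewrite tauSS !mulrN ihp// !exprS; ring.
- elim/ltn_ind: j {ihp} => -[|[|j]] ihj;
    last by rewrite tau_double 2!exprS mulrA mulN1r opprK mul1r !mulrN ihj.
    by [].
  by rewrite /tau subr0 mul1r cos_pihalf !mulr0.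
- elim/ltn_ind: j {ihp} => -[|[|j]] ihj;
    last by rewrite tau_double 2!exprS mulrA mulN1r opprK mul1r !mulrN ihj.
    by rewrite /tau sub0r mulN1r cosN cos_pihalf !mulr0.
  by [].
Qed.

Lemma trigN p y : trig p (- y) = (-1) ^+ p * trig p y :> R.
Proof.
elim/ltn_ind: p => -[|[|p]] ih.
- by rewrite !trig0 cosN mul1r.
- by rewrite !trig1 sinN expr1 mulN1r.
- by rewrite !trigSS ih// 2!exprS; ring.
Qed.

(** Multiplication by [sin (h * x)] becomes the operator [cdiff h] in the frequency [z], while [p]
    goes up by one. *)
Lemma sin_trig p x z (h : R) : sin (h * x) * trig p (x * z) =
  (trig p.+1 (x * (z + h)) - trig p.+1 (x * (z - h))) / 2.
Proof.
rewrite !trigS /trig; set t := p%:R * _.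
rewrite (_ : x * (z + h) - t = (x * z - t) + h * x); last by ring.
rewrite (_ : x * (z - h) - t = (x * z - t) - h * x); last by ring.
by move: (x * z - t) => X; rewrite sinD sinB; field.
Qed.

Section Functional.
Variable L : (R -> R) -> R.
Hypothesis bL : bounded_cvg_functional L.

Lemma functional0 : L (fun=> 0) = 0.
Proof.
have := bL.1 1 (fun=> 0) (fun=> 0) (bounded_mfun_cst 0) (bounded_mfun_cst 0).
under [X in L X = _]eq_fun do rewrite mulr0 addr0.
by lra.
Qed.

Lemma functionalZ k f : bounded_mfun f -> L (fun x => k * f x) = k * L f.
Proof.
move=> bf; have := bL.1 k _ _ bf (bounded_mfun_cst 0); rewrite functional0 addr0 => <-.
by congr L; apply/funext => x; rewrite addr0.
Qed.

Lemma functionalD f g : bounded_mfun f -> bounded_mfun g -> L (fun x => f x + g x) = L f + L g.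
Proof.
move=> bf bg; have := bL.1 1 _ _ bf bg; rewrite mul1r => <-.
by congr L; apply/funext => x; rewrite mul1r.
Qed.

Lemma functionalB f g : bounded_mfun f -> bounded_mfun g -> L (fun x => f x - g x) = L f - L g.
Proof.
move=> bf bg; rewrite -mulN1r -functionalZ// -functionalD//; last exact: bounded_mfunZ.
by congr L; apply/funext => x; rewrite mulN1r.
Qed.

Lemma functional_sum n (f_ : nat -> R -> R) : (forall i, bounded_mfun (f_ i)) ->
  L (fun x => \sum_(i < n) f_ i x) = \sum_(i < n) L (f_ i).
Proof.
move=> bf; elim: n => [|n ih].
  by rewrite big_ord0 -[RHS]functional0; congr L; apply/funext => x; rewrite big_ord0.
rewrite big_ord_recr/= -ih -functionalD//; last exact: bounded_mfun_sum.
by congr L; apply/funext => x; rewrite big_ord_recr.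
Qed.

Section Entire.
Variables (d_ : nat -> R) (C rho : R).
Hypothesis rho0 : 0 < rho.
Hypothesis dC : forall j, `|d_ j| <= C * rho ^+ j.
Hypothesis Ld : forall p z, (p < 2)%N -> 0 <= z ->
  series (fun j => d_ j * tau R p j * z ^+ j / j`!%:R) @ \oo --> L (fun x => trig p (x * z)).

Let C0 : 0 <= C.
Proof. by have := le_trans (normr_ge0 _) (dC 0); rewrite expr0 mulr1. Qed.

(** Iterated differences at [0] reach negative [z] and raise [p]. Parity ([tau_sign], [trigN]) and
    the sign rule for [p.+2] extend [Ld] to all of these. *)
Lemma functional_trig p z :
  series (fun j => d_ j / j`!%:R * tau R p j * z ^+ j) @ \oo --> L (fun x => trig p (x * z)).
Proof.
elim/ltn_ind: p => p ih.
have [p2|p2] := ltnP p 2.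
  have [z0|/ltW z0] := leP 0 z.
    rewrite (_ : (fun j => _) = (fun j => d_ j * tau R p j * z ^+ j / j`!%:R)); first exact: Ld.
    by apply/funext => j; ring.
  rewrite (_ : series _ = fun n => (-1) ^+ p * series (fun j => d_ j * tau R p j * (- z) ^+ j / j`!%:R) n).
    rewrite (_ : L _ = (-1) ^+ p * L (fun x => trig p (x * - z))).
      by apply: cvgMr; apply: Ld => //; rewrite oppr_ge0.
    rewrite -functionalZ; last exact: bounded_mfun_trig.
    by congr L; apply/funext => x; rewrite mulrN trigN mulrA -exprMn mulrNN mulr1 expr1n mul1r.
  apply/funext => n; rewrite /series/= mulr_sumr; apply: eq_bigr => i _.
  have e := tau_sign p i; rewrite (exprNn z).
  transitivity (d_ i * (((-1) ^+ p * tau R p i) * (-1) ^+ i) * z ^+ i / i`!%:R); last by ring.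
  have ee : (-1) ^+ i * (-1) ^+ i = 1 :> R by rewrite -exprMn mulrNN mulr1 expr1n.
  rewrite -e; transitivity (d_ i / i`!%:R * tau R p i * z ^+ i * ((-1) ^+ i * (-1) ^+ i)); last by ring.
  by rewrite ee mulr1.
case: p p2 ih => [|[|p]]// _ ih.
rewrite (_ : series _ = fun n => -1 * series (fun j => d_ j / j`!%:R * tau R p j * z ^+ j) n).
  rewrite (_ : L _ = -1 * L (fun x => trig p (x * z))); first by apply: cvgMr; exact: ih.
  rewrite -functionalZ; last exact: bounded_mfun_trig.
  by congr L; apply/funext => x; rewrite trigSS mulN1r.
apply/funext => n; rewrite /series/= mulr_sumr; apply: eq_bigr => i _.
by rewrite tauSS; ring.
Qed.

Lemma functional_sin_trig h m p z :
  series (fun j => d_ j / j`!%:R * tau R (p + m) j * iter m (cdiff h) (fun z => z ^+ j) z) @ \oo -->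
  L (fun x => sin (h * x) ^+ m * trig p (x * z)).
Proof.
elim: m p z => [|m ih] p z /=.
  rewrite addn0 (_ : L _ = L (fun x => trig p (x * z))); first exact: functional_trig.
  by congr L; apply/funext => x; rewrite mul1r.
have bm q u : bounded_mfun (fun x => sin (h * x) ^+ m * trig q (x * u)).
  apply: bounded_mfunM; last exact: bounded_mfun_trig.
  apply: bounded_mfunX; rewrite (_ : (fun _ => _) = (fun x => trig 1 (x * h))).
    exact: bounded_mfun_trig.
  by apply/funext => x; rewrite trig1 mulrC.
rewrite (_ : L _ = 2^-1 * (L (fun x => sin (h * x) ^+ m * trig p.+1 (x * (z + h))) -
   L (fun x => sin (h * x) ^+ m * trig p.+1 (x * (z - h))))).
  rewrite (_ : series _ = fun n => 2^-1 *
    (series (fun j => d_ j / j`!%:R * tau R (p.+1 + m) j * iter m (cdiff h) (fun z => z ^+ j) (z + h)) n -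
     series (fun j => d_ j / j`!%:R * tau R (p.+1 + m) j * iter m (cdiff h) (fun z => z ^+ j) (z - h)) n)).
    by apply: cvgMr; apply: cvgB; exact: ih.
  apply/funext => n; rewrite /series/= -sumrB mulr_sumr; apply: eq_bigr => i _.
  by rewrite {1}/cdiff addSnnS; ring.
rewrite -functionalB// -functionalZ; last first.
  by apply: bounded_mfunD => //; rewrite (_ : (fun _ => _) = (fun x =>
      -1 * (sin (h * x) ^+ m * trig p.+1 (x * (z - h))))); [exact: bounded_mfunZ|apply/funext => x;
      rewrite mulN1r].
congr L; apply/funext => x; rewrite exprSr -mulrA sin_trig; ring.
Qed.

(** The differences of [z ^ j] at [0] are nonnegative, so replacing [d_ j] by [C * rho ^ j] termwise
    yields exactly the differences of [C * exp (rho * z)] at [0]. *)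
Lemma functional_sinX h m : 0 <= h -> `|L (fun x => sin (h * x) ^+ m)| <= C * sinhr (rho * h) ^+ m.
Proof.
move=> h0; have := @functional_sin_trig h m 0 0.
rewrite (_ : L _ = L (fun x => sin (h * x) ^+ m)); last first.
  by congr L; apply/funext => x; rewrite mulr0 trig0 cos0 mulr1.
move=> hs; have := @cvg_iter_cdiff_exp R h m rho 0; rewrite mulr0 expR0 mulr1 => hc.
apply: (ler_cvg_to (cvg_norm hs) (cvgMr (a := C) hc)).
apply: nearW => n; rewrite /series/= mulr_sumr.
apply: le_trans (ler_norm_sum _ _ _) _; apply: ler_sum => j _.
have dn := iter_cdiff_exp_ge0 m j h0 (lexx 0).
rewrite normrM [X in _ * X]ger0_norm// mulrA ler_wpM2r//.
rewrite normrM -[leRHS]mulr1; apply: ler_pM => //; last exact: tau_le1.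
by rewrite normrM [X in _ * X]ger0_norm// mulrA ler_wpM2r.
Qed.

(** In the eyes of [L], [sin (h * x) / h] has size [sinhr (rho * h) / h], which stays near [rho] for
    small [h], whereas its supremum is [1 / h]. *)
Lemma functional_affine_sin h a n : 0 < h ->
  `|L (fun x => (sin (h * x) / h - a) ^+ n)| <= C * (sinhr (rho * h) / h + `|a|) ^+ n.
Proof.
move=> h0.
have bs i : bounded_mfun (fun x => sin (h * x) ^+ i).
  apply: bounded_mfunX; rewrite (_ : (fun _ => _) = (fun x => trig 1 (x * h))).
    exact: bounded_mfun_trig.
  by apply/funext => x; rewrite trig1 mulrC.
pose c (i : nat) : R := (- a) ^+ (n - i) * h^-1 ^+ i * 'C(n, i)%:R.
rewrite (_ : L _ = \sum_(i < n.+1) L (fun x => c i * sin (h * x) ^+ i)); last first.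
  rewrite -(functional_sum n.+1 (f_ := fun i x => c i * sin (h * x) ^+ i)); last by move=> i;
      exact: bounded_mfunZ.
  congr L; apply/funext => x; rewrite [_ / h - a]addrC exprDn; apply: eq_bigr => i _.
  by rewrite /c exprMn -[LHS]mulr_natr; ring.
apply: le_trans (ler_norm_sum _ _ _) _.
rewrite [sinhr _ / _ + _]addrC exprDn mulr_sumr; apply: ler_sum => i _.
rewrite functionalZ// normrM /c.
rewrite -[X in _ <= C * X]mulr_natr exprMn normrM normrM !normrX normrN (ger0_norm (ler0n R 'C(n, i))).
rewrite [X in _ * X ^+ i * _]ger0_norm ?invr_ge0 ?(ltW h0)//.
have k0 : 0 <= `|a| ^+ (n - i) * h^-1 ^+ i * ('C(n, i))%:R.
  by rewrite !mulr_ge0 ?exprn_ge0// invr_ge0 ltW.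
apply: le_trans (ler_wpM2l k0 (functional_sinX i (ltW h0))) _.
by rewrite le_eqVlt; apply/orP; left; apply/eqP; ring.
Qed.

(** For fixed [h] the base of the power is a bounded function of [x], so the exponential series
    converges boundedly and [L] acts termwise. The term [i = 0] is [L 1]; [functional_affine_sin]
    bounds the others. *)
Lemma functional_bump h a s K : 0 < h -> 0 < s ->
  `|L (fun x => expR (- ((sin (h * x) / h - a) / s) ^+ K)) - L (fun=> 1)| <=
  C * (expR (((sinhr (rho * h) / h + `|a|) / s) ^+ K) - 1).
Proof.
move=> h0 s0.
pose y x := (sin (h * x) / h - a).
pose q := sinhr (rho * h) / h + `|a|.
have q0 : 0 <= q by rewrite addr_ge0// divr_ge0 ?sinhr_ge0 ?mulr_ge0// ltW.
have by_ n : bounded_mfun (fun x => y x ^+ n).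
  apply: bounded_mfunX; apply: bounded_mfunD; last exact: bounded_mfun_cst.
  rewrite (_ : (fun _ => _) = (fun x => h^-1 * trig 1 (x * h))).
    by apply: bounded_mfunZ; exact: bounded_mfun_trig.
  by apply/funext => x; rewrite trig1 mulrC [x * h]mulrC.
pose t (i : nat) (x : R) : R := ((-1) ^+ i / i`!%:R * s^-1 ^+ (K * i)) * y x ^+ (K * i).
have bt i : bounded_mfun (t i) by exact: bounded_mfunZ.
have tE i x : t i x = exp_coeff (- (y x / s) ^+ K) i.
  by rewrite /t /exp_coeff/= (exprNn ((y x / s) ^+ K)) -exprM exprMn; ring.
have [_ [M hM]] := by_ 1%N.
have M0 : 0 <= M by exact: le_trans (normr_ge0 _) (hM 0).
have hc : L (fun x => \sum_(i < n) t i x) @[n --> \oo] --> L (fun x => expR (- (y x / s) ^+ K)).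
  apply: (bL.2 _ _ (expR ((M / s) ^+ K))).
  - by move=> n; have [] := bounded_mfun_sum n bt.
  - move=> n x.
    have h1 : `|\sum_(i < n) t i x| <= series (exp_coeff ((M / s) ^+ K)) n.
      rewrite /series/= big_mkord; apply: le_trans (ler_norm_sum _ _ _) _; apply: ler_sum => i _.
      rewrite tE /exp_coeff/= normrM [X in _ * X]ger0_norm// ler_wpM2r// normrX normrN normrX.
      rewrite lerXn2r ?nnegrE ?exprn_ge0 ?divr_ge0 ?(ltW s0)// lerXn2r ?nnegrE ?divr_ge0 ?(ltW s0)//.
      rewrite normrM normfV (gtr0_norm s0) ler_wpM2r ?invr_ge0 ?(ltW s0)//.
      by have := hM x; rewrite expr1.
    apply: le_trans h1 _; apply: nondecreasing_cvgn_le; last exact: is_cvg_series_exp_coeff.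
    apply: nondecreasing_series => i _ _;
        rewrite /exp_coeff/= divr_ge0// exprn_ge0// exprn_ge0// divr_ge0// ltW//.
  - move=> x; rewrite (_ : (fun n => _) = series (exp_coeff (- (y x / s) ^+ K))).
      exact: is_cvg_series_exp_coeff.
    by apply/funext => n; rewrite /series/= big_mkord; apply: eq_bigr => i _.
have hc1 : L (fun x => \sum_(i < n.+1) t i x) - L (fun=> 1) @[n --> \oo] -->
    L (fun x => expR (- (y x / s) ^+ K)) - L (fun=> 1).
  by apply: cvgB; [rewrite (cvg_shiftS (fun n => L (fun x => \sum_(i < n) t i x)))|exact: cvg_cst].
have he : C * (series (exp_coeff ((q / s) ^+ K)) n.+1 - 1) @[n --> \oo] --> C * (expR ((q / s) ^+ K) - 1).
  apply: cvgMr; apply: cvgB; last exact: cvg_cst.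
  by rewrite (cvg_shiftS (series (exp_coeff ((q / s) ^+ K)))); exact: is_cvg_series_exp_coeff.
apply: (ler_cvg_to (cvg_norm hc1) he).
apply: nearW => n.
rewrite functional_sum// big_ord_recl/= /series/= big_mkord big_ord_recl/=.
rewrite (_ : t 0 = fun=> 1); last first.
  by apply/funext => x; rewrite /t muln0 !expr0 fact0 divr1 !mulr1.
rewrite addrAC subrr add0r /exp_coeff/= expr0 fact0 divr1 addrAC subrr add0r mulr_sumr.
apply: le_trans (ler_norm_sum _ _ _) _; apply: ler_sum => i _.
rewrite functionalZ// normrM.
have := functional_affine_sin a (K * bump 0 i) h0.
move=> /(ler_wpM2l (normr_ge0 ((-1) ^+ bump 0 i / (bump 0 i)`!%:R * s^-1 ^+ (K * bump 0 i)))) le.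
apply: le_trans le _.
rewrite !normrM normrX normrN1 expr1n mul1r.
rewrite [X in X * _ * _]ger0_norm// [X in _ * X * _]ger0_norm ?exprn_ge0 ?invr_ge0 ?(ltW s0)//.
by rewrite -exprM -/q exprMn le_eqVlt; apply/orP; left; apply/eqP; ring.
Qed.

(** The even exponent keeps every bump between [0] and [1]; this allows [h -> 0] although the limit
    [x] of [sin (h * x) / h] is unbounded. *)
Lemma functional_bump_limit a s K : 0 < s ->
  `|L (fun x => expR (- (((x - a) / s) ^+ K.*2))) - L (fun=> 1)| <=
  C * (expR (((rho + `|a|) / s) ^+ K.*2) - 1).
Proof.
move=> s0.
pose h n : R := n.+1%:R^-1.
have h0 n : 0 < h n by rewrite invr_gt0 ltr0n.
have hcv : h n @[n --> \oo] --> 0 by exact: cvg_harmonic.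
have hL : L (fun x => expR (- ((sin (h n * x) / h n - a) / s) ^+ K.*2)) - L (fun=> 1) @[n --> \oo] -->
    L (fun x => expR (- (((x - a) / s) ^+ K.*2))) - L (fun=> 1).
  apply: cvgB; last exact: cvg_cst.
  apply: (bL.2 _ _ 1).
  - move=> n; apply: continuous_measurable_fun => x.
    apply: continuous_comp; last exact: continuous_expR.
    apply: cvgN; apply: cvg_exprn; apply: cvgMl; apply: cvgB; last exact: cvg_cst.
    by apply: cvgMl; apply: continuous_comp; [exact: cvgMr|exact: continuous_sin].
  - move=> n x; rewrite ger0_norm ?expR_ge0// expR_le1 oppr_le0.
    by rewrite -mul2n exprM exprn_ge0// sqr_ge0.
  - move=> x; apply: continuous_cvg; first exact: continuous_expR.
    apply: cvgN; apply: cvg_exprn; apply: cvgMl; apply: cvgB; last exact: cvg_cst.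
    exact: cvg_sin_div.
have hR : C * (expR (((rho / (1 - rho * h n) + `|a|) / s) ^+ K.*2) - 1) @[n --> \oo] -->
    C * (expR (((rho + `|a|) / s) ^+ K.*2) - 1).
  apply: cvgMr; apply: cvgB; last exact: cvg_cst.
  apply: continuous_cvg; first exact: continuous_expR.
  apply: cvg_exprn; apply: cvgMl; apply: cvgD; last exact: cvg_cst.
  rewrite -[X in _ --> X]divr1; apply: cvgMr; apply: cvgV; first exact: oner_neq0.
  rewrite -[X in _ --> X]subr0; apply: cvgB; first exact: cvg_cst.
  by rewrite -(mulr0 rho); exact: cvgMr.
apply: (ler_cvg_to (cvg_norm hL) hR).
near=> n; apply: le_trans (functional_bump _ _ (h0 n) s0) _.
rewrite ler_wpM2l// lerD2r ler_expR.
have rh : rho * h n < 1.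
  have : h n < rho^-1 by near: n; apply: (cvgr_lt 0) => //; rewrite invr_gt0.
  by rewrite -(ltr_pM2l rho0) mulfV// gt_eqF.
have le1 : sinhr (rho * h n) / h n <= rho / (1 - rho * h n).
  rewrite ler_pdivrMr//; apply: le_trans (sinhr_le _) _; last by rewrite mulrAC.
  by rewrite rh mulr_ge0// ltW.
rewrite lerXn2r ?nnegrE ?divr_ge0 ?addr_ge0 ?(ltW s0)//.
- by rewrite divr_ge0 ?sinhr_ge0 ?mulr_ge0// ltW.
- by rewrite divr_ge0 ?(ltW rho0)//; lra.
- by rewrite ler_wpM2r ?invr_ge0 ?(ltW s0)// lerD2r.
Unshelve. all: by end_near. Qed.

(** As the exponent grows, the error tends to [C * (exp 0 - 1) = 0] because [(rho + |a|) / s < 1].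
    The bumps tend to the indicator of the ball, except for the value [exp (- 1)] where
    [|x - a| = s]. *)
Lemma functional_ball a s : rho + `|a| < s ->
  L (fun x => \1_(`]a - s, a + s[%classic) x + expR (-1) * \1_[set a - s; a + s] x) = L (fun=> 1).
Proof.
move=> ras; have s0 : 0 < s by apply: le_lt_trans ras; rewrite addr_ge0// ltW.
have hL : L (fun x => expR (- (((x - a) / s) ^+ n.*2))) - L (fun=> 1) @[n --> \oo] -->
   L (fun x => \1_(`]a - s, a + s[%classic) x + expR (-1) * \1_[set a - s; a + s] x) - L (fun=> 1).
  apply: cvgB; last exact: cvg_cst.
  apply: (bL.2 _ _ 1).
  - move=> n; apply: continuous_measurable_fun => x.
    apply: continuous_comp; last exact: continuous_expR.
    by apply: cvgN; apply: cvg_exprn; apply: cvgMl; apply: cvgB; [exact: cvg_id|exact: cvg_cst].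
  - move=> n x; rewrite ger0_norm ?expR_ge0// expR_le1 oppr_le0.
    by rewrite -mul2n exprM exprn_ge0// sqr_ge0.
  - move=> x; have := @cvg_expRN_expr _ (((x - a) / s) ^+ 2) (sqr_ge0 _).
    under eq_fun do rewrite -exprM mul2n.
    rewrite (_ : (if _ then _ else _) = \1_(`]a - s, a + s[%classic) x + expR (-1) * \1_[set a - s;
        a + s] x)//.
    set v := (x - a) / s; have xv : x = a + v * s by rewrite /v; field; rewrite gt_eqF.
    have u1 : (x \in (`]a - s, a + s[%classic : set R)) = (v ^+ 2 < 1).
      rewrite mem_setE -[v ^+ 2]real_normK ?num_real// expr_lt1// ltr_norml in_itv/= xv.
      by apply/andP/andP => -[h1 h2]; split; nra.
    have u2 : (x \in [set a - s; a + s]) = (v ^+ 2 == 1).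
      rewrite sqrf_eq1; apply/idP/orP; rewrite inE/=.
        by move=> [e|e]; [right|left]; rewrite /v e; apply/eqP; field; rewrite gt_eqF.
      by move=> [/eqP e|/eqP e]; [right|left]; rewrite xv e; ring.
    rewrite !indicE u1 u2; case: ltgtP => _; rewrite ?mulr0 ?addr0 ?mulr1 ?add0r//.
have q0 : 0 <= (rho + `|a|) / s by rewrite divr_ge0 ?addr_ge0// ltW.
have q1 : (rho + `|a|) / s < 1 by rewrite ltr_pdivrMr// mul1r.
have hR : C * (expR (((rho + `|a|) / s) ^+ n.*2) - 1) @[n --> \oo] --> C * (expR 0 - 1).
  apply: cvgMr; apply: cvgB; last exact: cvg_cst.
  apply: continuous_cvg; first exact: continuous_expR.
  under eq_fun do rewrite -mul2n exprM.
  apply: cvg_expr; rewrite ger0_norm ?exprn_ge0// expr_lt1//.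
move: hR; rewrite expR0 subrr mulr0 => hR.
apply/eqP; rewrite -subr_eq0 -normr_le0.
apply: (ler_cvg_to (cvg_norm hL) hR).
by apply: nearW => n; exact: functional_bump_limit.
Qed.

Lemma functional_indic_cvg (A_ : nat -> set (measurableTypeR R)) (A : set (measurableTypeR R)) :
  (forall n, measurable (A_ n)) -> (forall x, \forall n \near \oo, (x \in A_ n) = (x \in A)) ->
  L \1_(A_ n) @[n --> \oo] --> L \1_A.
Proof.
move=> mA h; apply: (bL.2 _ _ 1).
- by move=> n; exact: measurable_indic.
- by move=> n x; rewrite indicE; case: (_ \in _); rewrite ?normr1 ?normr0.
- move=> x; apply: cvg_near_cst; apply: filterS (h x) => n; rewrite !indicE => ->//.
Qed.

(** Balls of radius [s + 1 / n.+1] shrink to the interval, and no fixed point lies on their boundary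
    for large [n], which disposes of the weight [exp (- 1)]. The free center lets [al] and [be] vary
    independently. *)
Lemma functional_itv_cc (al be : R) : al < - rho -> rho < be ->
  L \1_(`[al, be]%classic : set (measurableTypeR R)) = L (fun=> 1).
Proof.
move=> ar br; have r0 := rho0; have ab : al < be by lra.
pose a : R := (al + be) / 2; pose s : R := (be - al) / 2.
have ras : rho + `|a| < s by rewrite -ltrBrDl ltr_norml /a /s; apply/andP; split; lra.
pose h n : R := n.+1%:R^-1.
have h0 n : 0 < h n by rewrite invr_gt0 ltr0n.
have hcv : h n @[n --> \oo] --> 0 by exact: cvg_harmonic.
pose g (n : nat) (x : R) : R := \1_(`]a - (s + h n), a + (s + h n)[%classic) x
    + expR (-1) * \1_[set a - (s + h n); a + (s + h n)] x.
have gc : L (g n) @[n --> \oo] --> L \1_(`[al, be]%classic : set (measurableTypeR R)).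
  apply: (bL.2 _ _ (1 + expR (-1))).
  - move=> n; apply: measurable_funD; first by apply: measurable_indic; exact: measurable_itv.
    apply: measurable_funM => //; apply: measurable_indic.
    by apply: measurableU; exact: measurable_set1.
  - move=> n x; rewrite /g; apply: le_trans (ler_normD _ _) _; apply: lerD.
      by rewrite indicE; case: (_ \in _); rewrite ?normr1 ?normr0.
    rewrite normrM ger0_norm ?expR_ge0// ler_piMr ?expR_ge0//.
    by rewrite indicE; case: (_ \in _); rewrite ?normr1 ?normr0.
  - move=> x; apply: cvg_near_cst.
    have [xI|xI] := boolP (x \in `[al, be]).
      apply: nearW => n; rewrite /g !indicE !mem_setE xI.
      have -> : x \in `]a - (s + h n), a + (s + h n)[.
        have := h0 n; move: xI; rewrite !in_itv/= => /andP[h1 h2] h3.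
        by apply/andP; split; rewrite /a /s; lra.
      have -> : (x \in [set a - (s + h n); a + (s + h n)]) = false.
        have := h0 n; move: xI; rewrite !in_itv/= => /andP[h1 h2] h3.
        by apply/negbTE/negP; rewrite inE/= => -[]; rewrite /a /s; lra.
      by rewrite mulr0 addr0.
    have hm : 0 < Num.max (x - be) (al - x).
      by move: xI; rewrite in_itv/= negb_and -!ltNge lt_max !subr_gt0 orbC.
    near=> n; rewrite /g !indicE !mem_setE (negbTE xI).
    have hx : h n < Num.max (x - be) (al - x) by near: n; exact: (cvgr_lt 0).
    move: hx; rewrite lt_max => hx.
    have -> : (x \in `]a - (s + h n), a + (s + h n)[) = false.
      apply/negbTE; rewrite in_itv/= negb_and -!leNgt.
      by case/orP: hx => hx; apply/orP; [right|left]; rewrite /a /s; lra.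
    have -> : (x \in [set a - (s + h n); a + (s + h n)]) = false.
      have h3 := h0 n.
      have l1 : a - (s + h n) = al - h n by rewrite /a /s; lra.
      have l2 : a + (s + h n) = be + h n by rewrite /a /s; lra.
      apply/negbTE/negP; rewrite inE/= l1 l2 => -[] e; move: hx; rewrite e => /orP[]; lra.
    by rewrite mulr0 addr0.
have gE n : L (g n) = L (fun=> 1).
  by apply: functional_ball; apply: lt_trans ras _; rewrite ltrDl.
have : L (g n) @[n --> \oo] --> L (fun=> 1).
  by apply: cvg_near_cst; apply: nearW.
by move=> h1; exact: (cvg_unique _ gc h1).
Unshelve. all: by end_near. Qed.

Let LI (A : set (measurableTypeR R)) := L \1_A.

Let LIU (A B : set (measurableTypeR R)) : measurable A -> measurable B -> A `&` B = set0 ->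
  LI (A `|` B) = LI A + LI B.
Proof.
move=> mA mB AB; rewrite /LI -functionalD; [|exact: bounded_mfun_indic..].
congr L; apply/funext => x; rewrite !indicE in_setU.
have [xA|xA] := boolP (x \in A); have [xB|xB] := boolP (x \in B); rewrite /= ?addr0 ?add0r//.
by exfalso; move: xA xB; rewrite !inE => xA xB; have : (A `&` B) x by []; rewrite AB.
Qed.

Let LIT : LI setT = L (fun=> 1).
Proof. by congr L; apply/funext => x; rewrite indicE in_setT. Qed.

Let near_natr (x : R) : \forall n \near \oo, x < n%:R.
Proof. by near=> n; near: n; apply: nbhs_infty_gtr. Unshelve. all: by end_near. Qed.

Let near_harmonic (e : R) : 0 < e -> \forall n \near \oo, n.+1%:R^-1 < e.
Proof. by move=> e0; apply: (cvgr_lt 0) => //; exact: cvg_harmonic. Qed.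

(** For [be > rho], letting the left end go to [-oo] shows that []-oo, be]] carries all of [L 1], so
    its complement carries nothing. The endpoint [rho] is reached from above. *)
Lemma functional_itv_oy (be : R) : rho <= be -> LI `]be, +oo[%classic = 0.
Proof.
have gt b : rho < b -> LI `]b, +oo[%classic = 0.
  move=> rb.
  have h1 : LI `]-oo, b]%classic = L (fun=> 1).
    have hc : LI `[- rho - n.+1%:R, b]%classic @[n --> \oo] --> LI `]-oo, b]%classic.
      apply: functional_indic_cvg => [n|x]; first exact: measurable_itv.
      apply: filterS (near_natr (- rho - x)) => n hn.
      rewrite !mem_setE !in_itv/= (_ : _ <= x)//; move: hn; rewrite -natr1; lra.
    have hc' : LI `[- rho - n.+1%:R, b]%classic @[n --> \oo] --> L (fun=> 1).
      apply: cvg_near_cst; apply: nearW => n; apply: functional_itv_cc => //.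
      by have := ltr0Sn R n; lra.
    exact: (cvg_unique _ hc hc').
  have := @LIU `]-oo, b]%classic `]b, +oo[%classic (measurable_itv _) (measurable_itv _).
  rewrite h1 (_ : _ `|` _ = setT) ?LIT; last first.
    by apply/seteqP; split => // x _ /=; rewrite !in_itv/= andbT; case: leP; [left|right].
  move=> /(_ _) e; have /e : `]-oo, b]%classic `&` `]b, +oo[%classic = set0 :> set (measurableTypeR R).
    by apply/seteqP; split => // x []/=; rewrite !in_itv/= andbT leNgt => /negbTE ->.
  lra.
rewrite le_eqVlt => /predU1P[<-|]; last exact: gt.
have hc : LI `]rho + n.+1%:R^-1, +oo[%classic @[n --> \oo] --> LI `]rho, +oo[%classic.
  apply: functional_indic_cvg => [n|x]; first exact: measurable_itv.
  have [xr|xr] := ltP rho x.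
    have xr' : 0 < x - rho by lra.
    by apply: filterS (near_harmonic xr') => n hn; rewrite !mem_setE !in_itv/= !andbT xr -ltrBrDl.
  apply: nearW => n; rewrite !mem_setE !in_itv/= !andbT [RHS]ltNge xr/=.
  have : 0 < n.+1%:R^-1 :> R by rewrite invr_gt0 ltr0n.
  by move=> n0; apply/negbTE; rewrite -leNgt; apply: le_trans xr _; rewrite lerDl ltW.
have hc' : LI `]rho + n.+1%:R^-1, +oo[%classic @[n --> \oo] --> 0.
  by apply: cvg_near_cst; apply: nearW => n; apply: gt; rewrite ltrDl invr_gt0 ltr0n.
exact: (cvg_unique _ hc hc').
Qed.

Lemma functional_itv_No (al : R) : al <= - rho -> LI `]-oo, al[%classic = 0.
Proof.
have gt b : b < - rho -> LI `]-oo, b[%classic = 0.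
  move=> rb.
  have h1 : LI `[b, +oo[%classic = L (fun=> 1).
    have hc : LI `[b, rho + n.+1%:R]%classic @[n --> \oo] --> LI `[b, +oo[%classic.
      apply: functional_indic_cvg => [n|x]; first exact: measurable_itv.
      apply: filterS (near_natr (x - rho)) => n hn.
      rewrite !mem_setE !in_itv/= (_ : x <= _)//; move: hn; rewrite -natr1; lra.
    have hc' : LI `[b, rho + n.+1%:R]%classic @[n --> \oo] --> L (fun=> 1).
      apply: cvg_near_cst; apply: nearW => n; apply: functional_itv_cc => //.
      by have := ltr0Sn R n; lra.
    exact: (cvg_unique _ hc hc').
  have := @LIU `]-oo, b[%classic `[b, +oo[%classic (measurable_itv _) (measurable_itv _).
  rewrite h1 (_ : _ `|` _ = setT) ?LIT; last first.
    by apply/seteqP; split => // x _ /=; rewrite !in_itv/= andbT; case: ltP; [left|right].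
  move=> /(_ _) e; have /e : `]-oo, b[%classic `&` `[b, +oo[%classic = set0 :> set (measurableTypeR R).
    by apply/seteqP; split => // x []/=; rewrite !in_itv/= andbT ltNge => /negbTE ->.
  lra.
rewrite le_eqVlt => /predU1P[->|]; last exact: gt.
have hc : LI `]-oo, - rho - n.+1%:R^-1[%classic @[n --> \oo] --> LI `]-oo, - rho[%classic.
  apply: functional_indic_cvg => [n|x]; first exact: measurable_itv.
  have [xr|xr] := ltP x (- rho).
    have xr' : 0 < - rho - x by lra.
    by apply: filterS (near_harmonic xr') => n hn; rewrite !mem_setE !in_itv/= xr ltrBrDl -ltrBrDr.
  apply: nearW => n; rewrite !mem_setE !in_itv/= [RHS]ltNge xr/=.
  have : 0 < n.+1%:R^-1 :> R by rewrite invr_gt0 ltr0n.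
  by move=> n0; apply/negbTE; rewrite -leNgt; apply: le_trans _ xr; rewrite lerBlDr lerDl ltW.
have hc' : LI `]-oo, - rho - n.+1%:R^-1[%classic @[n --> \oo] --> 0.
  by apply: cvg_near_cst; apply: nearW => n; apply: gt; rewrite ltrBlDr ltrDl invr_gt0 ltr0n.
exact: (cvg_unique _ hc hc').
Qed.

(* Paley-Wiener: a transform that is entire of exponential type [rho] comes from [[- rho, rho]]. *)
Lemma functional_outside (B : set (measurableTypeR R)) : measurable B ->
  B `<=` [set x | rho < `|x|] -> L \1_B = 0.
Proof.
move=> mB Bout; have r0 := rho0; pose out : set (measurableTypeR R) := [set x | rho < `|x|].
have outE : out = `]-oo, - rho[%classic `|` `]rho, +oo[%classic.
  by apply/seteqP; split => x; rewrite /out/= !in_itv/= andbT ltr_normr ltrNr orbC => /orP.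
have mout : measurable out by rewrite outE; apply: measurableU; exact: measurable_itv.
(* [L 1] need not vanish; tracing on [out] makes [P] true of [setT], so that it passes to
   complements in the Dynkin argument over the rays []b, +oo[]. *)
pose P (A : set (measurableTypeR R)) := LI (A `&` out) = 0.
have PT : P setT.
  rewrite /P setTI outE LIU; [|exact: measurable_itv..|].
    by rewrite functional_itv_oy// functional_itv_No// addr0.
  by apply/seteqP; split => // x []/=; rewrite !in_itv/= andbT; lra.
suff : P B by rewrite /P (setIidl Bout).
have mBG : <<s @RGenOInfty.G R >> B by have := mB; rewrite [measurable]RGenOInfty.measurableE.
apply: (@dynkin_induction _ (measurableTypeR R) (@RGenOInfty.G R) P) mBG => //.
- exact: RGenOInfty.measurableE.
- move=> _ _ [x ->] [y ->]; exists (Num.max x y); apply/seteqP; split => z /=.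
    by rewrite !in_itv/= !andbT gt_max => -[-> ->].
  by rewrite !in_itv/= !andbT gt_max => /andP[].
- move=> _ [b ->]; rewrite /P.
  have [rb|rb] := leP rho b.
    rewrite setIidl ?functional_itv_oy//.
    by move=> x /=; rewrite /out/= in_itv/= andbT ltr_normr => bx; apply/orP; left; exact: le_lt_trans bx.
  have [rb'|rb'] := leP (- rho) b.
    rewrite (_ : _ `&` _ = `]rho, +oo[%classic) ?functional_itv_oy//.
    by apply/seteqP; split => x /=; rewrite /out/= !in_itv/= !andbT ltr_normr; [move=> [bx /orP[]];
        lra|move=> rx; split; [lra|apply/orP; left]].
  have nb : `]-oo, b]%classic `<=` out.
    by move=> x /=; rewrite in_itv/= /out/= ltr_normr => xb; apply/orP; right; lra.
  have Lb : LI `]-oo, b]%classic = 0.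
    have hc : LI `]-oo, b + n.+1%:R^-1[%classic @[n --> \oo] --> LI `]-oo, b]%classic.
      apply: functional_indic_cvg => [n|x]; first exact: measurable_itv.
      have [xr|xr] := leP x b.
        apply: nearW => n; rewrite !mem_setE !in_itv/= xr.
        by apply/idP; apply: le_lt_trans xr _; rewrite ltrDl invr_gt0 ltr0n.
      have xr' : 0 < x - b by lra.
      apply: filterS (near_harmonic xr') => n hn; rewrite !mem_setE !in_itv/= [RHS]leNgt xr/=.
      by apply/negbTE; rewrite -leNgt -lerBrDl ltW.
    have hc' : LI `]-oo, b + n.+1%:R^-1[%classic @[n --> \oo] --> 0.
      have bb : 0 < - rho - b by lra.
      apply: cvg_near_cst; apply: filterS (near_harmonic bb) => n hn.
      by apply: functional_itv_No; rewrite -lerBrDl ltW.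
    exact: (cvg_unique _ hc hc').
  have outb : out = `]-oo, b]%classic `|` (`]b, +oo[%classic `&` out).
    apply/seteqP; split => x.
      by move=> ox; have [xb|xb] := leP x b; [left|right]; rewrite /= in_itv/= ?andbT.
    by move=> [/nb//|[]].
  have := PT; rewrite /P setTI {1}outb LIU ?Lb ?add0r//; first exact: measurableI.
  rewrite setIA (_ : `]-oo, b]%classic `&` _ = set0) ?set0I//.
  by apply/seteqP; split => // x []/=; rewrite !in_itv/= andbT leNgt => /negbTE ->.
- move=> A mA PA.
  have outA : out = (A `&` out) `|` (~` A `&` out) by rewrite -setIUl setUv setTI.
  have := PT; rewrite /P setTI {1}outA.
  rewrite LIU ?PA ?add0r//; [exact: measurableI|by apply: measurableI => //; exact: measurableC|].
  by rewrite setIACA setICr set0I.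
- move=> F mF tF PF; rewrite /P setI_bigcupl.
  pose G n := \bigcup_(k in `I_n) (F k `&` out).
  have mG n : measurable (G n).
    by apply: bigcup_measurable => // k _; exact: measurableI.
  have hc : LI (G n) @[n --> \oo] --> LI (\bigcup_k (F k `&` out)).
    apply: functional_indic_cvg => // x.
    have [[k _ kx]|nx] := pselect ((\bigcup_k (F k `&` out)) x).
      near=> n; rewrite [RHS]mem_set; last by exists k.
      rewrite mem_set//; exists k => //=; near: n; exact: nbhs_infty_gt.
    apply: nearW => n; rewrite [RHS]memNset// memNset// => -[k _ kx]; apply: nx; by exists k.
  have hG n : LI (G n) = 0.
    elim: n => [|n ih].
      rewrite /G II0 bigcup_set0 /LI -[RHS]functional0; congr L; apply/funext => x; by rewrite indic0.
    rewrite /G IIS bigcup_setU bigcup_set1 LIU; [|exact: mG|exact: measurableI|].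
      by rewrite (PF n) -/(G n) ih addr0.
    apply/seteqP; split => // x [[k /= kn [Fk _]] [Fn _]].
    have nk : n = k by apply: (tF n k) => //; exists x.
    by rewrite nk ltnn in kn.
  have hc' : LI (G n) @[n --> \oo] --> 0 by apply: cvg_near_cst; exact: nearW.
  exact: (cvg_unique _ hc hc').
Unshelve. all: by end_near. Qed.

End Entire.
End Functional.
End PaleyWiener.

(** * Series and unordered sums *)

Section Series.
Variable R : realType.
Implicit Types (a b s t : nat -> R).

Lemma series_lim_ge a n : (forall k, 0 <= a k) -> cvgn (series a) -> series a n <= limn (series a).
Proof.
move=> a0 ca; apply: nondecreasing_cvgn_le => //.
by apply/nondecreasing_seqP => k; rewrite /series/= big_nat_recr//= lerDl.
Qed.

Lemma series_diff_lim_le s a (l : R) n : (forall k, `|s k| <= a k) ->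
  cvgn (series a) -> series s @ \oo --> l -> `|l - series s n| <= limn (series a) - series a n.
Proof.
move=> sa ca cs.
have h1 : `|series s m - series s n| @[m --> \oo] --> `|l - series s n|.
  by apply: cvg_norm; apply: cvgB => //; exact: cvg_cst.
have h2 : series a m - series a n @[m --> \oo] --> limn (series a) - series a n.
  by apply: cvgB => //; exact: cvg_cst.
apply: (ler_cvg_to h1 h2); near=> m.
have nm : (n <= m)%N by near: m; exact: nbhs_infty_ge.
rewrite !sub_series_geq//; apply: le_trans (ler_norm_sum _ _ _) _.
by apply: ler_sum => i _.
Unshelve. all: by end_near. Qed.

(** Cutting row [k] at [m] costs at most [a k * (B - series b m)], hence at most
    [A * (B - series b m)] for any number of rows, and this tends to [0]. *)
Lemma series_exchange (f : nat -> nat -> R) a b s t (l : R) :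
  (forall k, 0 <= a k) -> (forall j, 0 <= b j) -> (forall k j, `|f k j| <= a k * b j) ->
  cvgn (series a) -> cvgn (series b) ->
  (forall k, series (f k) @ \oo --> s k) -> (forall j, series (f^~ j) @ \oo --> t j) ->
  series s @ \oo --> l -> series t @ \oo --> l.
Proof.
move=> a0 b0 fab ca cb fs ft sl.
set A := limn (series a); set B := limn (series b).
have key m : `|l - series t m| <= A * (B - series b m).
  have h1 : `|series s n - \sum_(0 <= j < m) series (f^~ j) n| @[n --> \oo] --> `|l - series t m|.
    apply: cvg_norm; apply: cvgB => //; elim: m => [|m ih].
      by under eq_fun do rewrite big_nil; rewrite /series/= big_nil; exact: cvg_cst.
    under eq_fun do rewrite big_nat_recr//=.
    by rewrite /series/= big_nat_recr//=; apply: cvgD => //; exact: ft.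
  have h2 : series a n * (B - series b m) @[n --> \oo] --> A * (B - series b m) by apply: cvgMl.
  apply: (ler_cvg_to h1 h2); apply: nearW => n.
  rewrite /series/= exchange_big/= -sumrB mulr_suml; apply: le_trans (ler_norm_sum _ _ _) _.
  apply: ler_sum => k _.
  have cab : cvgn (series (fun j => a k * b j)) by exact: is_cvg_seriesZ.
  apply: le_trans (series_diff_lim_le m (fab k) cab (fs k)) _.
  have e n' : series (fun j => a k * b j) n' = a k * series b n' by rewrite /series/= mulr_sumr.
  rewrite e (_ : limn _ = a k * B) ?mulrBr//.
  by apply: cvg_lim => //; rewrite (funext e : series _ = _); exact: cvgMr.
have h0 : A * (B - series b m) @[m --> \oo] --> (0 : R).
  rewrite -(mulr0 A) -(subrr B); apply: cvgMr; apply: cvgB => //; exact: cvg_cst.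
apply/cvgrPdist_le => e e0; near=> m; apply: le_trans (key m) _.
by near: m; exact: (cvgr_le 0 h0).
Unshelve. all: by end_near. Qed.

End Series.

(** * Unordered sums and their relation to enumerated series *)

Section HasSum.
Variables (R : realType) (T : choiceType).
Implicit Types (D : set T) (f g : T -> R) (l m : R).

Lemma has_sumD D f g l m : has_sum D f l -> has_sum D g m -> has_sum D (fun i => f i + g i) (l + m).
Proof.
move=> hf hg e e0; have e20 : 0 < e / 2 by rewrite divr_gt0.
have [F [fF FD hF]] := hf _ e20; have [G [fG GD hG]] := hg _ e20.
exists (F `|` G); split; [by rewrite finite_setU|by move=> x [/FD|/GD]|].
move=> H fH FGH HD; rewrite fsbig_split//= opprD addrACA.
apply: le_lt_trans (ler_normD _ _) _; rewrite [e]splitr ltrD//.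
  by apply: hF => // x Fx; apply: FGH; left.
by apply: hG => // x Fx; apply: FGH; right.
Qed.

Lemma has_sumN D f l : has_sum D f l -> has_sum D (fun i => - f i) (- l).
Proof.
move=> hf e e0; have [F [fF FD hF]] := hf _ e0; exists F; split=> // H fH FH HD.
by rewrite fsbig_finite//= sumrN -fsbig_finite// -opprD normrN hF.
Qed.

Lemma has_sumB D f g l m : has_sum D f l -> has_sum D g m -> has_sum D (fun i => f i - g i) (l - m).
Proof. by move=> hf /has_sumN; exact: has_sumD. Qed.

Lemma eq_has_sum D f g l : (forall i, D i -> f i = g i) -> has_sum D f l -> has_sum D g l.
Proof.
move=> fg hf e e0; have [F [fF FD hF]] := hf _ e0; exists F; split=> // H fH FH HD.
by rewrite -(@eq_fsbigr _ _ _ _ f g) ?hF// => i /set_mem /HD /fg.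
Qed.

Lemma has_sum_support (D E : set T) f l : D `<=` E -> (forall i, E i -> ~ D i -> f i = 0) ->
  has_sum D f l <-> has_sum E f l.
Proof.
move=> DE f0; have fsum F : F `<=` E -> \sum_(i \in F `&` D) f i = \sum_(i \in F) f i.
  move=> FE; apply: fsbig_widen => // x [Fx nx] /=.
  by apply: f0; [exact: FE|move=> Dx; exact: nx].
split=> hf e e0; have [F [fF FD hF]] := hf _ e0.
  exists F; split=> //; first exact: subset_trans DE.
  move=> H fH FH HE; rewrite -fsum//; apply: hF; [exact: finite_setIl| |exact: subIsetr].
  by move=> x Fx; split; [exact: FH|exact: FD].
exists (F `&` D); split; [exact: finite_setIl|exact: subIsetr|].
move=> H fH FDH HD.
have -> : \sum_(i \in H) f i = \sum_(i \in H `|` F) f i.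
  rewrite -[RHS]fsum; last by move=> x [/HD/DE|/FD].
  congr (\sum_(i \in _) _); apply/seteqP; split=> x; first by move=> Hx; split; [left|exact: HD].
  by move=> [[//|Fx] Dx]; exact: FDH.
apply: hF; [by rewrite finite_setU|by move=> x; right|by move=> x [/HD/DE|/FD]].
Qed.

Section Enumeration.
Variables (e : nat -> T) (D : set T).
Hypothesis inj_e : injective e.
Hypothesis ran_e : range e = D.

Lemma finite_sub_enum F : finite_set F -> F `<=` D -> \forall n \near \oo, F `<=` e @` `I_n.
Proof.
move=> /finite_seqP[s ->]; elim: s => [|x s ih] sD; first by apply: nearW => n y.
have : D x by apply: sD; rewrite /= mem_head.
rewrite -ran_e => -[k _ kx].
have sD' : [set` s] `<=` D by move=> y /= ys; apply: sD; rewrite /= inE ys orbT.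
near=> n => y /=; rewrite inE => /predU1P[->|ys].
  by exists k => //=; near: n; exact: nbhs_infty_gt.
have : [set` s] `<=` e @` `I_n by near: n; exact: ih.
exact.
Unshelve. all: by end_near. Qed.

Lemma fsum_enum F n f : finite_set F -> F `<=` e @` `I_n ->
  \sum_(i \in F) f i = \sum_(0 <= k < n) (if e k \in F then f (e k) else 0).
Proof.
move=> fF Fn; have -> : F = e @` (`I_n `&` e @^-1` F).
  apply/seteqP; split=> x; last by move=> [k [_ Fk] <-].
  by move=> Fx; have [k kn kx] := Fn _ Fx; exists k => //; split=> //=; rewrite kx.
rewrite fsbig_image; last by move=> x y _ _; exact: inj_e.
rewrite fsbig_mkcondr -fsbig_ord big_mkord; apply: eq_bigr => k _.
rewrite (_ : (_ \in _) = (e k \in e @` (`I_n `&` e @^-1` F)))//.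
apply/idP/idP; rewrite !inE/= => h; first by exists k => //; split=> //=.
by move: h => [j [_ Fj] <-].
Qed.

Lemma has_sum_series f l : has_sum D f l -> series (f \o e) @ \oo --> l.
Proof.
move=> hf; apply/cvgrPdist_lt => d d0.
have [F [fF FD hF]] := hf _ d0.
apply: filterS (finite_sub_enum fF FD) => n Fn.
have := hF (e @` `I_n) (finite_image _ (finite_II _)) Fn.
rewrite fsbig_image; last by move=> x y _ _; exact: inj_e.
rewrite -fsbig_ord distrC /series/= big_mkord; apply.
by move=> x [k _ <-]; rewrite -ran_e; exists k.
Qed.

(** A finite set containing the first [N] indices adds to them only part of the tail, which absolute
    convergence makes small. *)
Lemma series_has_sum f l : cvgn (series (fun k => `|f (e k)|)) -> series (f \o e) @ \oo --> l ->
  has_sum D f l.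
Proof.
move=> ca cf d d0; have d20 : 0 < d / 2 by rewrite divr_gt0.
set A := limn (series (fun k => `|f (e k)|)).
have [N hN1 hN2] : exists2 N, `|l - series (f \o e) N| < d / 2 & A - series (fun k => `|f (e k)|) N < d / 2.
  have h1 : \forall n \near \oo, `|l - series (f \o e) n| < d / 2 by move/cvgrPdist_lt : cf; exact.
  have h2 : \forall n \near \oo, `|A - series (fun k => `|f (e k)|) n| < d / 2 by move/cvgrPdist_lt : ca;
      exact.
  have [N _ hN] := filterI h1 h2; exists N; first by have [] := hN N (leqnn N).
  by have [_] := hN N (leqnn N); apply: le_lt_trans; exact: ler_norm.
exists (e @` `I_N); split; [exact/finite_image/finite_II|by rewrite -ran_e; exact: image_subset|].
move=> F fF NF FD; have [M _ hM] := finite_sub_enum fF FD.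
pose P := maxn M N; have /(fsum_enum f fF) -> := hM P (leq_maxl _ _).
have NP : (N <= P)%N by exact: leq_maxr.
rewrite (@big_cat_nat _ _ _ N)//=.
rewrite (eq_big_nat _ _ (F2 := f \o e)); last first.
  by move=> k /andP[_ kN]; rewrite mem_set//; apply: NF; exists k.
rewrite addrAC -/(series (f \o e) N) [d]splitr; apply: le_lt_trans (ler_normD _ _) _; apply: ltrD.
  by rewrite distrC.
apply: le_lt_trans hN2; apply: le_trans (ler_norm_sum _ _ _) _.
apply: (@le_trans _ _ (\sum_(N <= k < P) `|f (e k)|)).
  by apply: ler_sum => k _; case: ifP => _; rewrite ?normr0.
by rewrite -sub_series_geq// lerD2r; apply: series_lim_ge.
Qed.

End Enumeration.
End HasSum.

(** * Consequences of (S1) and (S2) for the exponents *)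

Section Exponents.
Variables (R : realType) (c : R) (S : set R).
Hypothesis sS : subsemigroup_nonneg S.
Hypothesis S1S : S1 S.
Hypothesis S2S : S2 c S.

Let Spos : set R := S `&` [set b | 0 < b].

Lemma exponents_base_ge1 : 0 < c -> 1 <= c.
Proof.
move=> c0; have [fin] := S2S 0; rewrite expr1; apply: le_trans.
rewrite ler1n cardfs_gt0; apply/fset0Pn; exists 0.
by rewrite in_fset_set// mem_set//; split; [exact: (S1S 0)|rewrite /= lexx ltr01].
Qed.

(** (S2) leaves finitely many exponents in [(0, 1)]. The gap [b0] makes densities integrable at
    infinity and allows constants to be absorbed into [K ^ b]. *)
Lemma exponents_min : exists2 b0, 0 < b0 & forall b, Spos b -> b0 <= b.
Proof.
have [fin _] := S2S 0.
have {}fin : finite_set (Spos `&` [set x | x < 1]).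
  by apply: sub_finite_set fin => x [[Sx /= x0] /= x1]; split => //=; rewrite ltW.
have [s sE] := (finite_seqP _).1 fin.
have hs b : b \in s -> 0 < b by move=> bs; have : [set` s] b by []; rewrite -sE => -[[]].
exists (\big[Order.min/1]_(b <- s) b).
  by elim: s hs {sE} => [|b s ih] hs;
      rewrite ?big_nil ?ltr01// big_cons lt_min hs ?mem_head//= ih// => d ds; rewrite hs// inE ds orbT.
move=> b Sb; have [b1|b1] := leP 1 b.
  apply: le_trans b1; elim: s {sE hs} => [|d s ih]; first by rewrite big_nil.
  by rewrite big_cons ge_min ih orbT.
have : b \in s by have : [set` s] b by rewrite -sE; split.
elim: s {sE hs} => // d s ih; rewrite inE big_cons ge_min => /predU1P[->|/ih ->].
  by rewrite lexx.
by rewrite orbT.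
Qed.

Lemma exponents_enum : exists e : nat -> R, injective e /\ range e = Spos.
Proof.
have cS : countable Spos.
  apply: (@sub_countable _ _ _ (\bigcup_n (S `&` [set x | n%:R <= x < n.+1%:R]))).
    apply: subset_card_le => x [Sx /= x0]; exists (Num.truncn x) => //; split => //=.
    by apply: truncn_itv; exact: ltW.
  by apply: bigcup_countable => // n _; apply: finite_set_countable; have [] := S2S n.
have iS : infinite_set Spos.
  move=> fS; have : finite_set ((fun n : nat => n.+1%:R : R) @^-1` Spos).
    apply: finite_preimage fS => x y _ _ /eqP; by rewrite eqr_nat => /eqP[].
  rewrite (_ : _ @^-1` _ = setT); first exact: infinite_nat.
  by apply/seteqP; split=> // n _; split; [exact: S1S|rewrite /= ltr0n].
have /card_esym/card_set_bijP[e [fe inj sur]] := eq_card_nat cS iS.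
exists e; split; first by move=> x y; apply: inj; rewrite inE.
apply/seteqP; split=> x; last exact: sur.
by move=> [k _ <-]; exact: fe.
Qed.

(** Since [q <= 1], each of the at most [c ^ n.+1] exponents in [[n, n + 1)] contributes at most
    [q ^ n]; the sum is below [c * \sum_n (q * c) ^ n]. *)
Lemma exponents_summable (e : nat -> R) q : injective e -> range e `<=` S -> 0 < c -> 0 < q -> q * c < 1 ->
  cvgn (series (fun k => q `^ e k)).
Proof.
move=> inj_e eS c0 q0 qc.
have q1 : q <= 1.
  rewrite leNgt; apply/negP => q1; have := exponents_base_ge1 c0; nra.
apply: nondecreasing_is_cvgn.
  by apply/nondecreasing_seqP => k; rewrite /series/= big_nat_recr//= lerDl powR_ge0.
exists (c / (1 - q * c)) => _ [n _ <-].
have Se k : S (e k) by apply: eS; exists k.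
have e0 k : 0 <= e k by have [h _] := sS; exact: h.
pose m k := Num.truncn (e k).
pose M := (\max_(k < n) m k).+1.
have mM (k : 'I_n) : (m k < M)%N by rewrite ltnS; exact: (leq_bigmax k).
rewrite /series/= big_mkord (partition_big (fun k : 'I_n => Ordinal (mM k)) xpredT)//=.
apply: (@le_trans _ _ (\sum_(i < M) c * (q * c) ^+ i)).
  apply: ler_sum => i _.
  apply: (@le_trans _ _ (\sum_(k < n | Ordinal (mM k) == i) q ^+ i)).
    apply: ler_sum => k /eqP <-/=; rewrite -powR_mulrn ?(ltW q0)//.
    by apply: ger_powR; [rewrite q0|have /andP[] := truncn_itv (e0 k)].
  rewrite sumr_const exprMn mulrCA -exprS -[leLHS]mulr_natr ler_wpM2l ?exprn_ge0 ?(ltW q0)//.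
  have [fin] := S2S i; apply: le_trans; rewrite ler_nat.
  rewrite -[leqLHS]/#|[pred k : 'I_n | Ordinal (mM k) == i]| cardE -(size_map (fun k : 'I_n => e k)).
  apply: uniq_leq_size; first by rewrite map_inj_uniq ?enum_uniq// => x y /inj_e; exact: val_inj.
  move=> _ /mapP[k + ->]; rewrite mem_enum inE => /eqP ki; rewrite in_fset_set// mem_set//.
  by split=> //=; rewrite -ki/=; exact: truncn_itv.
rewrite -mulr_sumr ler_wpM2l ?(ltW c0)//.
rewrite -[(_ - _)^-1]mul1r ler_pdivlMr; last by lra.
have := subrX1 (q * c) M; have : 0 <= (q * c) ^+ M by rewrite exprn_ge0// mulr_ge0 ?ltW.
lra.
Qed.

End Exponents.

(** * Densities and their transforms *)

Section Reflection.
Variable R : realType.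
Notation mu := (@lebesgue_measure R).

Lemma measurable_oppR : measurable_fun [set: measurableTypeR R] (-%R : measurableTypeR R -> measurableTypeR
    R).
Proof. by apply: continuous_measurable_fun => x; exact: opp_continuous. Qed.

Let opp : measurableTypeR R -> measurableTypeR R := -%R.
Let mopp : measurable_fun setT opp := measurable_oppR.

Lemma lebesgue_measure_oppr (A : set (measurableTypeR R)) : measurable A ->
  pushforward mu opp A = mu A.
Proof.
move=> mA; apply/esym.
pose mo : {mfun measurableTypeR R >-> measurableTypeR R} :=
  MeasurableFun.Pack (MeasurableFun.Class (isMeasurableFun.Build _ _ _ _ _ mopp)).
apply: (lebesgue_measure_unique (mu := pushforward mu mo)) => // X /ocitvP[->|[[a b] /= ab ->]].
  by rewrite !measure0.
rewrite /pushforward (_ : _ @^-1` _ = `[- b, - a[%classic); last first.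
  by apply/seteqP; split => x /=; rewrite /opp !in_itv/= ltrNr lerNl andbC.
rewrite !lebesgue_measure_itv/= !lte_fin ltrN2.
by case: ifP => _ //; rewrite opprK addrC.
Qed.

Lemma integrable_oppr (D : set (measurableTypeR R)) (f : R -> R) : measurable D -> measurable_fun [set:
    measurableTypeR R] f ->
  mu.-integrable (opp @^-1` D) (EFin \o (fun x => f (- x))) ->
  mu.-integrable D (EFin \o f) /\ \int[mu]_(x in D) f x = \int[mu]_(x in opp @^-1` D) f (- x).
Proof.
move=> mD mf fi; have mf' : measurable_fun setT (EFin \o f) by exact/measurable_EFinP.
pose mo : {mfun measurableTypeR R >-> measurableTypeR R} :=
  MeasurableFun.Pack (MeasurableFun.Class (isMeasurableFun.Build _ _ _ _ _ mopp)).
have muE : forall A, measurable A -> A `<=` D -> mu A = pushforward mu mo A.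
  by move=> A mA _; rewrite lebesgue_measure_oppr.
split.
  have := integrable_pushforward mopp mf' fi mD.
  move=> /integrableP[mDf h]; apply/integrableP; split=> //.
  by rewrite (eq_measure_integral (pushforward mu mo)).
rewrite /Rintegral (eq_measure_integral (pushforward mu mo))//.
by rewrite (integral_pushforward mopp mf' fi mD).
Qed.

End Reflection.

(** * Folding the set [|x| >= rho] onto a half-line *)

Section BothTails.
Variable R : realType.
Notation mu := (@lebesgue_measure R).
Implicit Types (rho b z : R).

Definition far rho : set (measurableTypeR R) := [set x | rho <= `|x|].

Lemma farE rho : far rho = `]-oo, - rho]%classic `|` `[rho, +oo[%classic.
Proof.
by apply/seteqP; split => x; rewrite /far/= !in_itv/= andbT ler_normr lerNr orbC => /orP.
Qed.

Lemma measurable_far rho : measurable (far rho).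
Proof. by rewrite farE; apply: measurableU; exact: measurable_itv. Qed.

Lemma far_integral rho (f : R -> R) : 0 < rho -> measurable_fun [set: measurableTypeR R] f ->
  mu.-integrable `[rho, +oo[ (EFin \o f) -> mu.-integrable `[rho, +oo[ (EFin \o (fun x => f (- x))) ->
  mu.-integrable (far rho) (EFin \o f) /\
  \int[mu]_(x in far rho) f x = \int[mu]_(x in `[rho, +oo[) (f x + f (- x)).
Proof.
move=> r0 mf i1 i2.
have E : -%R @^-1` `]-oo, - rho]%classic = `[rho, +oo[%classic :> set R.
  by apply/seteqP; split => x /=; rewrite !in_itv/= ?andbT lerN2.
have [|i3 e3] := @integrable_oppr R `]-oo, - rho]%classic f (measurable_itv _) mf.
  by rewrite E.
have i4 : mu.-integrable (far rho) (EFin \o f).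
  rewrite farE; apply/integrableP; split; first by apply/measurable_EFinP; exact: measurable_funTS.
  rewrite ge0_integral_setU//; [|exact: measurable_itv..| |].
  - by move/integrableP : i1 => [_ h1]; move/integrableP : i3 => [_ h3]; exact: lte_add_pinfty.
  - by apply: measurableT_comp => //; apply/measurable_EFinP; exact: measurable_funTS.
  - by apply/disj_setPS => x []/=; rewrite !in_itv/= andbT; lra.
split=> //.
rewrite RintegralD// farE Rintegral_setU//.
- by rewrite e3 E addrC.
- by rewrite -farE.
- apply/disj_setPS => x []/=; rewrite !in_itv/= andbT; lra.
Qed.

End BothTails.

(** * The density attached to one exponent and its transforms *)

Section Density.
Variable R : realType.
Notation mu := (@lebesgue_measure R).
Implicit Types (rho b z x : R) (p : nat) (u : nat -> R).

Definition phase p b : R := -2 * sin ((b - p%:R) * (pi / 2)).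

Lemma phase_le p b : `|phase p b| <= 2.
Proof. by rewrite /phase normrM normrN (ger0_norm (ler0n _ 2)) ler_piMr// ler_norml sin_geN1 sin_le1. Qed.

(* With [u 0 +i* u 1 = a * i_pow b] this is [Im (a * inv_pow x (b + 1))], written as the sum of its
   even and odd parts. *)
Definition dens u b x : R :=
  `|x| `^ (- b - 1) * ((phase 0 b * u 0 + Num.sg x * (phase 1 b * u 1)) / 2).

Lemma dens_le u b x : `|dens u b x| <= `|x| `^ (- b - 1) * (`|u 0| + `|u 1|).
Proof.
rewrite /dens normrM [X in X * _ <= _]ger0_norm ?powR_ge0// ler_wpM2l ?powR_ge0//.
rewrite normrM [X in _ * X]ger0_norm// ler_pdivrMr// mulrDl.
apply: le_trans (ler_normD _ _) _; apply: lerD.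
  by rewrite normrM mulrC ler_wpM2l// phase_le.
rewrite normrM -[leRHS]mul1r ler_pM//; first by rewrite normr_sg; case: (_ != _).
by rewrite normrM mulrC ler_wpM2l// phase_le.
Qed.

Lemma measurable_norm_powR b : measurable_fun [set: measurableTypeR R] (fun x : R => `|x| `^ b).
Proof.
by apply: (measurableT_comp (f := @powR R ^~ b)); [exact: measurable_powR|exact: normr_measurable].
Qed.

Lemma measurable_dens u b : measurable_fun [set: measurableTypeR R] (dens u b).
Proof.
have msg : measurable_fun [set: measurableTypeR R] (Num.sg : R -> R).
  rewrite (_ : Num.sg = fun x : R =>
      \1_(`]0, +oo[%classic : set (measurableTypeR R)) x
      - \1_(`]-oo, 0[%classic : set (measurableTypeR R)) x).
    by apply: measurable_funB; apply: measurable_indic; exact: measurable_itv.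
  apply/funext => x; rewrite !indicE !mem_setE !in_itv/= andbT.
  by case: (ltrgtP x 0) => [x0|x0|->]; rewrite ?(ltr0_sg x0) ?(gtr0_sg x0) ?sgr0 ?subr0 ?sub0r.
apply: measurable_funM; first exact: measurable_norm_powR.
apply: measurable_funM => //; apply: measurable_funD => //.
exact: measurable_funM.
Qed.

Lemma measurable_trig p z : measurable_fun [set: measurableTypeR R] (fun x : R => trig p (x * z)).
Proof. by have [] := @bounded_mfun_trig R p z. Qed.

(** Folding [x] and [- x] together keeps only the half of [dens] with the parity of [trig p],
    doubled; hence [u p] alone appears. *)
Lemma dens_trig_integral p u b rho z : (p < 2)%N -> 0 < b -> 0 < rho ->
  mu.-integrable (far rho) (EFin \o (fun x => trig p (x * z) * dens u b x)) /\
  \int[mu]_(x in far rho) (trig p (x * z) * dens u b x) = u p * (phase p b * trig_tail p b rho z).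
Proof.
move=> p2 b0 r0; pose f x := trig p (x * z) * dens u b x.
have mf : measurable_fun [set: measurableTypeR R] f.
  by apply: measurable_funM; [exact: measurable_trig|exact: measurable_dens].
have fb x : rho <= `|x| -> `|f x| <= (`|u 0| + `|u 1|) * `|x| `^ (- b - 1).
  by move=> _; rewrite normrM mulrC [leRHS]mulrC -[leRHS]mulr1 ler_pM// ?norm_trig// dens_le.
have ib := @integrableZ_real _ (measurableTypeR R) R mu _ (`|u 0|
    + `|u 1|) _ (measurable_itv _) (integrable_powRN b0 r0).
have i1 : mu.-integrable `[rho, +oo[ (EFin \o f).
  apply: le_integrable_real ib => //; first exact: measurable_funTS.
  move=> x /=; rewrite in_itv/= andbT => rx; have x0 := le_trans (ltW r0) rx.
  by rewrite -{2}(ger0_norm x0) fb// ger0_norm.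
have i2 : mu.-integrable `[rho, +oo[ (EFin \o (fun x => f (- x))).
  apply: le_integrable_real ib => //.
    by apply: measurable_funTS; exact: (measurableT_comp mf (@measurable_oppR R)).
  move=> x /=; rewrite in_itv/= andbT => rx; have x0 := le_trans (ltW r0) rx.
  by have := fb (- x); rewrite normrN (ger0_norm x0); apply.
have [i3 ->] := far_integral r0 mf i1 i2; split=> //.
rewrite /trig_tail mulrA -RintegralZl//; last exact: integrable_powR_trig.
apply: eq_Rintegral => x; rewrite inE/= in_itv/= andbT => rx; have x0 := lt_le_trans r0 rx.
rewrite /f /dens normrN sgrN mulNr trigN (gtr0_norm x0) (gtr0_sg x0).
by case: p p2 {f mf fb i1 i2 i3} => [|[|]]// _; rewrite ?expr0 ?expr1; field.
Qed.

Lemma integrable_far_powRN b rho : 0 < b -> 0 < rho ->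
  mu.-integrable (far rho) (EFin \o (fun x : R => `|x| `^ (- b - 1))).
Proof.
move=> b0 r0; have i1 : mu.-integrable `[rho, +oo[ (EFin \o (fun x : R => `|x| `^ (- b - 1))).
  apply: eq_integrable (integrable_powRN b0 r0) => // x.
  by rewrite inE/= in_itv/= andbT => rx; rewrite ger0_norm// (le_trans (ltW r0)).
have [] // := @far_integral R rho (fun x : R => `|x| `^ (- b - 1)) r0 (measurable_norm_powR _) i1.
by apply: eq_integrable i1 => // x _; rewrite /= normrN.
Qed.

(** [(z * rho) ^ s <= T ^ s <= exp T * Gamma (s + 1)] with [T = z * rho + 1], by [Gamma_ge]; the
    added [1] keeps [T] positive at [z = 0]. *)
Lemma powR_Gamma_le z rho s : 0 <= z -> 0 < rho -> 0 <= s ->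
  z `^ s / Gamma (s + 1) <= expR (z * rho + 1) * rho `^ (- s).
Proof.
move=> z0 r0 s0; have T0 : 0 < z * rho + 1 by rewrite ltr_wpDl// mulr_ge0// ltW.
rewrite ler_pdivrMr ?Gamma_gt0//.
have := Gamma_ge s0 T0; set T := z * rho + 1 => h.
apply: le_trans (_ : T `^ s * rho `^ (- s) <= _).
  by rewrite powRN ler_pdivlMr ?powR_gt0// -powRM ?(ltW r0)// ge0_ler_powR// ?nnegrE ?mulr_ge0 ?(ltW r0)
      ?(ltW T0)// lerDl.
by rewrite mulrAC ler_wpM2r ?powR_ge0// mulrC -ler_pdivrMr ?expR_gt0// -expRN.
Qed.

End Density.

(** * Transforms of the full density: singular part plus entire part *)

Section TailTransform.
Variable R : realType.
Notation mu := (@lebesgue_measure R).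
Variables (be : nat -> R) (U : nat -> nat -> R) (rho b0 : R) (g : R -> R).
Hypothesis rho0 : 0 < rho.
Hypothesis b00 : 0 < b0.
Hypothesis b0_le : forall k, b0 <= be k.
Hypothesis summ : cvgn (series (fun k => (`|U 0 k| + `|U 1 k|) * rho `^ (- be k))).
Hypothesis gE : forall x, rho <= `|x| -> series (fun k => dens (U^~ k) (be k) x) @ \oo --> g x.

Let N k := (`|U 0 k| + `|U 1 k|) * rho `^ (- be k).
Let W : R := limn (series N).
Let N0 k : 0 <= N k. Proof. by rewrite mulr_ge0 ?powR_ge0// addr_ge0. Qed.
Let NW n : series N n <= W. Proof. exact: series_lim_ge. Qed.
Let W0 : 0 <= W. Proof. by apply: le_trans (NW 0); rewrite /series/= big_nil. Qed.
Let be0 k : 0 < be k. Proof. exact: lt_le_trans (b0_le k). Qed.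

Let NU p k : (p < 2)%N -> `|U p k| * rho `^ (- be k) <= N k.
Proof. by case: p => [|[|]]// _; rewrite ler_wpM2r ?powR_ge0// ?lerDl ?lerDr. Qed.

(** For [|x| >= rho], [(|x| / rho) ^ (- be k) <= (|x| / rho) ^ (- b0)]; so [G] dominates all partial
    sums of the density, and it is integrable as [b0 > 0]. *)
Let G (x : R) : R := W * rho `^ b0 * `|x| `^ (- b0 - 1).

Let dens_sum_le x n : rho <= `|x| -> \sum_(0 <= k < n) `|dens (U^~ k) (be k) x| <= G x.
Proof.
move=> rx; have x0 := lt_le_trans rho0 rx.
rewrite /G mulrAC -mulrA; apply: (@le_trans _ _ (series N n * (`|x| `^ (- b0 - 1) * rho `^ b0))); last first.
  by rewrite ler_wpM2r ?NW// mulr_ge0 ?powR_ge0.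
rewrite /series/= mulr_suml; apply: ler_sum => k _; apply: le_trans (dens_le _ _ _) _.
rewrite /N mulrC -mulrA ler_wpM2l ?addr_ge0//.
rewrite (_ : - be k - 1 = (- b0 - 1) + (b0 - be k)); last by ring.
rewrite powRD ?(gt_eqF x0) ?implybT// [leRHS]mulrCA ler_wpM2l ?powR_ge0//.
rewrite -powRD ?(gt_eqF rho0) ?implybT// (addrC (- be k)) -[b0 - be k]opprB !powRN.
rewrite lef_pV2 ?posrE ?powR_gt0//; apply: ge0_ler_powR => //; rewrite ?nnegrE ?subr_ge0//; exact: ltW.
Qed.

Lemma summable_dens x : rho <= `|x| -> cvgn (series (fun k => `|dens (U^~ k) (be k) x|)).
Proof.
move=> rx; apply: nondecreasing_is_cvgn.
  by apply/nondecreasing_seqP => k; rewrite /series/= big_nat_recr//= lerDl.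
by exists (G x) => _ [n _ <-]; exact: dens_sum_le.
Qed.

Lemma integrable_density : mu.-integrable (far rho) (EFin \o g).
Proof.
have mg : measurable_fun (far rho) g.
  apply: (measurable_fun_cvg (h := fun n x => series (fun k => dens (U^~ k) (be k) x) n)) => //.
  move=> n; apply: measurable_funTS; rewrite /series/=; apply: measurable_sum => k.
  exact: measurable_dens.
apply: (le_integrable_real (measurable_far _) mg _ (integrableZ_real (W
    * rho `^ b0) (measurable_far _) (integrable_far_powRN b00 rho0))).
move=> x rx; have hc : (fun _ : nat => G x) @ \oo --> G x by exact: cvg_cst.
rewrite -/(G x); apply: (ler_cvg_to (cvg_norm (gE rx)) hc); apply: nearW => n.
by apply: le_trans (ler_norm_sum _ _ _) _; exact: dens_sum_le.
Qed.

Let T p z := \int[mu]_(x in far rho) (trig p (x * z) * g x).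

Lemma cvg_tail_transform p z : (p < 2)%N ->
  series (fun k => U p k * (phase p (be k) * trig_tail p (be k) rho z)) @ \oo --> T p z.
Proof.
move=> p2; pose f_ n x := trig p (x * z) * series (fun k => dens (U^~ k) (be k) x) n.
have fE n : mu.-integrable (far rho) (EFin \o f_ n) /\ \int[mu]_(x in far rho) f_ n x =
    series (fun k => U p k * (phase p (be k) * trig_tail p (be k) rho z)) n.
  elim: n => [|n [ih1 ih2]].
    rewrite /series/= big_nil.
    have f0 : f_ 0 = fun=> 0 by apply/funext => x; rewrite /f_ /series/= big_nil mulr0.
    rewrite f0; split; first exact: integrable0.
    by rewrite /Rintegral integral0.
  have [i1 e1] := dens_trig_integral (U^~ n) z p2 (be0 n) rho0.
  have fS : f_ n.+1 = fun x => f_ n x + trig p (x * z) * dens (U^~ n) (be n) x.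
    by apply/funext => x; rewrite /f_ /series/= big_nat_recr//= mulrDr.
  rewrite fS; split; first exact: (integrableD_real (measurable_far _) ih1 i1).
  by rewrite (RintegralD (measurable_far rho) ih1 i1) ih2 e1 /series/= big_nat_recr.
rewrite (_ : series _ = fun n => \int[mu]_(x in far rho) f_ n x); last by apply/funext => n; have [] := fE n.
apply: (@Rintegral_dominated _ _ _ mu _ _ _ G); first exact: measurable_far.
- by move=> n; have [/measurable_int/measurable_EFinP] := fE n.
- by move=> x rx; apply: cvgMr; exact: gE.
- move=> n x rx; rewrite normrM -[leRHS]mul1r ler_pM// ?norm_trig//.
  by apply: le_trans (ler_norm_sum _ _ _) _; exact: dens_sum_le.
- exact: (integrableZ_real (W * rho `^ b0) (measurable_far _) (integrable_far_powRN b00 rho0)).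
Qed.

Let term p z k := U p k * (anti_gamma p (be k) * (z `^ be k / Gamma (be k + 1))).

Lemma norm_anti_gamma_le p b : 0 < b -> `|anti_gamma p b| <= 36 :> R.
Proof.
move=> b0'; have [nr|/resonant_sin0 s0] := pselect (nonresonant p b).
  have /andP[h1 h2] := anti_gamma_bounds b0' nr.
  by rewrite ger0_norm//; apply: le_trans h1; rewrite mulr_ge0 ?expR_ge0.
by rewrite /anti_gamma s0 !(mulr0, mul0r) normr0.
Qed.

Lemma summable_singular_part p z : (p < 2)%N -> 0 <= z -> cvgn (series (fun k => `|term p z k|)).
Proof.
move=> p2 z0.
apply: (@series_le_cvg _ _ (fun k => 36 * expR (z * rho + 1) * N k)) => //.
- by move=> k; rewrite mulr_ge0// mulr_ge0 ?expR_ge0.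
- move=> k; have w0 : 0 <= z `^ be k / Gamma (be k + 1).
    by rewrite divr_ge0 ?powR_ge0// ltW// Gamma_gt0// ltW.
  rewrite /term/= normrM [X in _ * X <= _]normrM (ger0_norm w0) mulrCA -[leRHS]mulrA.
  apply: ler_pM => //; [exact: mulr_ge0|exact: norm_anti_gamma_le|].
  apply: le_trans (ler_wpM2l (normr_ge0 _) (powR_Gamma_le z0 rho0 (ltW (be0 k)))) _.
  by rewrite mulrCA ler_wpM2l ?expR_ge0// NU.
- exact: is_cvg_seriesZ.
Qed.

(** The power series of [trig_tail_series] summed over all exponents. Its growth [C * rho ^ j] is
    the exponential type [rho]. *)
Definition regular_coef p j : R :=
  limn (series (fun k => U p k * (tail_coef p (be k) j * rho `^ (j%:R - be k)))).

Let regular_term_le p j k : (p < 2)%N ->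
  `|U p k * (tail_coef p (be k) j * rho `^ (j%:R - be k))| <= 4 * rho ^+ j * N k.
Proof.
move=> p2; have -> : rho `^ (j%:R - be k) = rho ^+ j * rho `^ (- be k).
  by rewrite powRD ?(gt_eqF rho0) ?implybT// powR_mulrn ?ltW.
rewrite normrM normrM (ger0_norm (_ : 0 <= rho ^+ j * _)); last first.
  by rewrite mulr_ge0 ?powR_ge0// exprn_ge0// ltW.
rewrite (_ : `|U p k| * _ = `|tail_coef p (be k) j| * rho ^+ j * (`|U p k| * rho `^ (- be k))); last by ring.
apply: ler_pM; [by rewrite mulr_ge0// exprn_ge0// ltW|by rewrite mulr_ge0 ?powR_ge0| |exact: NU].
by rewrite ler_wpM2r ?tail_coef_le// exprn_ge0// ltW.
Qed.

Lemma cvg_regular_coef p j : (p < 2)%N ->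
  series (fun k => U p k * (tail_coef p (be k) j * rho `^ (j%:R - be k))) @ \oo --> regular_coef p j.
Proof.
move=> p2; apply: normed_cvg; apply: (@series_le_cvg _ _ (fun k => 4 * rho ^+ j * N k)) => //=.
- by move=> k; rewrite mulr_ge0// mulr_ge0// exprn_ge0// ltW.
- by move=> k; exact: regular_term_le.
- exact: is_cvg_seriesZ.
Qed.

Lemma regular_coef_le : exists C, forall p j, (p < 2)%N -> `|regular_coef p j| <= C * rho ^+ j.
Proof.
exists (4 * W) => p j p2; rewrite mulrAC.
have cN : cvgn (series (fun k => 4 * rho ^+ j * N k)) by exact: is_cvg_seriesZ.
have := series_diff_lim_le 0 (fun k => @regular_term_le p j k p2) cN (@cvg_regular_coef p j p2).
by rewrite /series/= !big_nil !subr0 -/(series _) lim_seriesZ.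
Qed.

(** Sums over exponents and over powers are interchanged. The majorant is a product, [N k] times
    [4 * (rho * z) ^ j / j!], because [tail_coef_le] is uniform in the exponent. *)
Lemma regular_series p z : (p < 2)%N -> 0 <= z ->
  series (fun j => regular_coef p j * tau R p j * z ^+ j / j`!%:R) @ \oo -->
  T p z - limn (series (term p z)).
Proof.
move=> p2 z0.
pose s k := U p k * (phase p (be k) * trig_tail p (be k) rho z) - term p z k.
pose f k j := U p k * (tail_coef p (be k) j * rho `^ (j%:R - be k)) * (tau R p j * z ^+ j / j`!%:R).
apply: (@series_exchange _ f N (fun j => 4 * exp_coeff (rho * z) j) s) => //.
- by move=> j; rewrite mulr_ge0// exp_coeff_ge0// mulr_ge0// ltW.
- move=> k j; rewrite /f normrM (_ : N k * _ = 4 * rho ^+ j * N k * (z ^+ j / j`!%:R)); last first.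
    by rewrite /exp_coeff/= exprMn; ring.
  apply: ler_pM => //; first exact: regular_term_le.
  rewrite -mulrA normrM [X in _ * X <= _]ger0_norm ?divr_ge0 ?exprn_ge0//.
  by rewrite ler_piMl ?divr_ge0 ?exprn_ge0// tau_le1.
- by apply: is_cvg_seriesZ; exact: is_cvg_series_exp_coeff.
- move=> k; rewrite (_ : series _ = fun n => U p k * series (fun j =>
    tail_coef p (be k) j * rho `^ (j%:R - be k) * tau R p j * z ^+ j / j`!%:R) n).
    rewrite (_ : s k = U p k * (phase p (be k) * trig_tail p (be k) rho z
        - anti_gamma p (be k) * (z `^ be k / Gamma (be k + 1)))); last by rewrite /s /term; ring.
    by apply: cvgMr; exact: trig_tail_series.
  by apply/funext => n; rewrite /series/= mulr_sumr; apply: eq_bigr => j _; rewrite /f; ring.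
- move=> j; rewrite (_ : series _ = fun n => series (fun k =>
    U p k * (tail_coef p (be k) j * rho `^ (j%:R - be k))) n * (tau R p j * z ^+ j / j`!%:R)).
    by rewrite (_ : _ * _ * _ / _ = regular_coef p j * (tau R p j * z ^+ j / j`!%:R)); [apply: cvgMl;
        exact: cvg_regular_coef|ring].
  by apply/funext => n; rewrite /series/= mulr_suml.
- rewrite (_ : series s = series (fun k =>
    U p k * (phase p (be k) * trig_tail p (be k) rho z)) - series (term p z)).
    by apply: cvgB; [exact: cvg_tail_transform|apply: normed_cvg; exact: summable_singular_part].
  by apply/funext => n; rewrite fctE /series/= -sumrB.
Qed.

End TailTransform.

(** * Integrals as functionals, and the transform of [mu] near the origin *)

Section Functionals.
Variable R : realType.
Implicit Types (f g : R -> R) (L : (R -> R) -> R) (D B : set (measurableTypeR R)).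

Lemma integral_functional (nu : {measure set (measurableTypeR R) -> \bar R}) D g : measurable D ->
  nu.-integrable D (EFin \o g) ->
  bounded_cvg_functional (fun f => \int[nu]_(x in D) (f x * g x)).
Proof.
move=> mD ig.
have mg : measurable_fun D g by apply/measurable_EFinP; exact: measurable_int ig.
have ing : nu.-integrable D (EFin \o (fun x => `|g x|)).
  by apply: (le_integrable_real mD _ _ (integrable_norm ig)) => //; [exact: measurableT_comp|move=> x _;
      rewrite normr_id].
have ifg f : bounded_mfun f -> nu.-integrable D (EFin \o (fun x => f x * g x)).
  move=> [mf [M hM]]; apply: (le_integrable_real mD _ _ (integrableZ_real M mD ing)).
    by apply: measurable_funM => //; exact: measurable_funTS.
  by move=> x _; rewrite normrM ler_wpM2r.
split=> [k f h bf bh|f_ f M mf_ hM cf].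
  rewrite -RintegralZl ?ifg// -RintegralD ?ifg//; last exact: integrableZ_real (ifg _ _).
  by apply: eq_Rintegral => x _; ring.
apply: (@Rintegral_dominated _ _ _ nu D _ _ (fun x => M * `|g x|)) => //.
- by move=> n; apply: measurable_funM => //; exact: measurable_funTS.
- by move=> x _; exact: cvgMl.
- by move=> n x _; rewrite normrM ler_wpM2r.
- exact: integrableZ_real.
Qed.

Lemma functional_diff L L' : bounded_cvg_functional L -> bounded_cvg_functional L' ->
  bounded_cvg_functional (fun f => L f - L' f).
Proof.
move=> bL bL'; split=> [k f g bf bg|f_ f M mf hM cf].
  by rewrite bL.1// bL'.1//; ring.
by apply: cvgB; [exact: bL.2 cf|exact: bL'.2 cf].
Qed.

(* Binary digits: [f = \sum_n 2^-n.+1 * \1_(B_ n)] for [f] with values in [[0, 1[]. *)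
Lemma functional_eq0 L : bounded_cvg_functional L -> (forall B, measurable B -> L \1_B = 0) ->
  forall f, bounded_mfun f -> L f = 0.
Proof.
move=> bL L1; have unit01 f : measurable_fun [set: measurableTypeR R] f -> (forall x,
    0 <= f x < 1) -> L f = 0.
  move=> mf f01.
  pose bit (h : R -> R) : set (measurableTypeR R) := h @^-1` `[2^-1, +oo[%classic.
  (* [F n] is what remains of [f] after [n] binary digits, rescaled by [2 ^ n]; [L] does not see the
     digits already removed. *)
  pose F n := iter n (fun h x => 2 * h x - \1_(bit h) x) f.
  have FP n : measurable_fun [set: measurableTypeR R] (F n) /\ forall x, 0 <= F n x < 1.
    elim: n => [//|n [mF F01]]; split=> [|x] /=.
      apply: measurable_funB; first exact: measurable_funM.
      by apply: measurable_indic; rewrite -[X in measurable X]setTI; apply: mF => //; exact: measurable_itv.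
    have /andP[h1 h2] := F01 x; rewrite indicE.
    have -> : (x \in bit (F n)) = (2^-1 <= F n x).
      by apply/idP/idP; rewrite inE /bit /preimage /mkset /= in_itv/= andbT.
    by move: (F n x) h1 h2 => t h1 h2; apply/andP; case: (leP 2^-1 t) => h;
        rewrite /= ?mulr1n ?mulr0n ?subr0; split; lra.
  have bF n : bounded_mfun (F n).
    split; [by have [] := FP n|exists 1 => x].
    by have [_ /(_ x)/andP[h1 h2]] := FP n; rewrite ger0_norm// ltW.
  have LF n : L f = L (fun x => 2^-1 ^+ n * F n x).
    elim: n => [|n ->]; first by congr L; apply/funext => x; rewrite mul1r.
    have mb : measurable (bit (F n)).
      by rewrite -[X in measurable X]setTI; apply: (FP n).1 => //; exact: measurable_itv.
    rewrite !(functionalZ bL)// exprSr -mulrA; congr (_ * _).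
    rewrite (functionalB bL) ?L1 ?(functionalZ bL) ?subr0//;
        [|exact: bounded_mfunZ|exact: bounded_mfun_indic].
    by field.
  have h1 : L (fun x => 2^-1 ^+ n * F n x) @[n --> \oo] --> L (fun=> 0).
    apply: (bL.2 _ _ 1).
    - by move=> n; have [] := bounded_mfunZ (2^-1 ^+ n) (bF n).
    - move=> n x; have [_ /(_ x)/andP[h1 h2]] := FP n.
      rewrite ger0_norm ?mulr_ge0 ?exprn_ge0 ?invr_ge0//.
      rewrite -[leRHS]mulr1 ler_pM ?exprn_ge0 ?invr_ge0 ?exprn_ile1 ?invr_ge0 ?invf_le1 ?ler1n ?(ltW h2)//.
    - move=> x; apply: (@squeeze_cvgr _ _ _ _ (fun=> 0) (fun n => 2^-1 ^+ n)).
      + apply: nearW => n; have [_ /(_ x)/andP[h1 h2]] := FP n.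
        by rewrite mulr_ge0 ?exprn_ge0 ?invr_ge0//= ler_piMr ?exprn_ge0 ?invr_ge0 ?(ltW h2).
      + exact: cvg_cst.
      + by apply: cvg_expr; rewrite ger0_norm ?invr_ge0// invf_lt1// ltr1n.
  have h2 : L (fun x => 2^-1 ^+ n * F n x) @[n --> \oo] --> L f.
    by apply: cvg_near_cst; apply: nearW => n; rewrite -LF.
  by rewrite -(functional0 bL); exact: (cvg_unique _ h2 h1).
move=> f [mf [M hM]]; have M0 : 0 <= M by exact: le_trans (hM 0).
(* [k * (f + M)] takes values in [[0, 2 * M / (2 * M + 1)]], inside [[0, 1[]. *)
pose k := (2 * M + 1)^-1; have k0 : 0 < k by rewrite invr_gt0; lra.
have := bL.1 k f (fun=> k * M) (conj mf (ex_intro _ M hM)) (bounded_mfun_cst _).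
have kM : k * (2 * M + 1) = 1 by rewrite mulVf// gt_eqF//; lra.
rewrite [X in X = _]unit01; last 2 first.
- by apply: measurable_funD => //; exact: measurable_funM.
- by move=> x; have := hM x; rewrite ler_norml => /andP[h1 h2]; apply/andP; split; nra.
rewrite [X in _ + X]unit01; last 2 first.
- exact: measurable_cst.
- by move=> x; apply/andP; split; nra.
by rewrite addr0 => /esym/eqP; rewrite mulf_eq0 (gt_eqF k0) => /eqP.
Qed.

Lemma Rintegral_indicM (nu : {measure set (measurableTypeR R) -> \bar R}) D B g : measurable D ->
    measurable B ->
  \int[nu]_(x in D) (\1_B x * g x) = \int[nu]_(x in B `&` D) g x.
Proof.
move=> mD mB; rewrite setIC Rintegral_mkcondr; apply: eq_Rintegral => x _.
by rewrite indicE patchE; case: ifP => _; rewrite ?mul1r ?mul0r.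
Qed.

Variable mu : probability (measurableTypeR R) R.

Lemma bounded_integrable D f : measurable D -> bounded_mfun f -> mu.-integrable D (EFin \o f).
Proof.
move=> mD [mf [M hM]]; apply: (@le_integrable_real _ _ _ mu _ _ (fun=> M)) => //.
  exact: measurable_funTS.
exact: finite_measure_integrable_cst.
Qed.

Lemma Rintegral_probability_cst (k : R) : \int[mu]_x k = k.
Proof.
transitivity (k * fine (mu setT)); first exact: Rintegral_cst.
have := @probability_setT _ _ _ mu => /= ->; by rewrite mulr1.
Qed.

Definition moment rho j : R := \int[mu]_(x in ~` far rho) x ^+ j.

Let in_near rho (x : R) : (~` far rho) x -> `|x| < rho.
Proof. by rewrite /far/= => /negP; rewrite -ltNge. Qed.

Lemma moment_le rho j : 0 < rho -> `|moment rho j| <= rho ^+ j.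
Proof.
move=> r0; have mD : measurable (~` far rho) by apply: measurableC; exact: measurable_far.
rewrite /moment; apply: le_trans (norm_Rintegral_le (g := fun=> rho ^+ j) mD _ _ _) _.
- by apply: measurable_funTS; exact: measurable_funX.
- by move=> x /in_near/ltW h; rewrite normrX lerXn2r ?nnegrE// ltW.
- exact: finite_measure_integrable_cst.
rewrite Rintegral_cst// ler_piMr ?exprn_ge0 ?(ltW r0)//.
by rewrite -lee_fin fineK ?probability_le1// fin_num_measure.
Qed.

Lemma near_series rho p z : 0 < rho -> 0 <= z ->
  series (fun j => moment rho j * tau R p j * z ^+ j / j`!%:R) @ \oo -->
  \int[mu]_(x in ~` far rho) trig p (x * z).
Proof.
move=> r0 z0; have mD : measurable (~` far rho) by apply: measurableC; exact: measurable_far.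
pose f n (x : R) := series (fun j => tau R p j * (x * z) ^+ j / j`!%:R) n.
have mf n : measurable_fun [set: measurableTypeR R] (f n).
  rewrite /f /series/=; apply: measurable_sum => j.
  apply: measurable_funM => //; apply: measurable_funM => //; apply: measurable_funX.
  exact: measurable_funM.
have iX j : mu.-integrable (~` far rho) (EFin \o (fun x => x ^+ j)).
  apply: (@le_integrable_real _ _ _ mu _ _ (fun=> rho ^+ j)) => //.
  - by move=> x /in_near/ltW h; rewrite normrX lerXn2r ?nnegrE// ltW.
  - exact: finite_measure_integrable_cst.
have fE n : mu.-integrable (~` far rho) (EFin \o f n) /\
   series (fun j => moment rho j * tau R p j * z ^+ j / j`!%:R) n = \int[mu]_(x in ~` far rho) f n x.
  elim: n => [|n [ih1 ih2]].
    have -> : f 0 = fun=> 0 by apply/funext => x; rewrite /f /series/= big_nil.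
    split; first exact: integrable0.
    by rewrite /Rintegral integral0 /series/= big_nil.
  have fS : f n.+1 = fun x => f n x + tau R p n * z ^+ n / n`!%:R * x ^+ n.
    by apply/funext => x; rewrite /f /series/= big_nat_recr//= exprMn; congr (_ + _); ring.
  have i1 := integrableZ_real (tau R p n * z ^+ n / n`!%:R) mD (iX n).
  rewrite fS; split; first exact: (integrableD_real mD ih1 i1).
  rewrite (RintegralD mD ih1 i1) -ih2 RintegralZl// /series/= big_nat_recr//=; congr (_ + _).
  by rewrite -/(moment _ _); ring.
rewrite (_ : series _ = fun n => \int[mu]_(x in ~` far rho) f n x); last by apply/funext => n;
    have [] := fE n.
apply: (@Rintegral_dominated _ _ _ mu _ _ _ (fun=> expR (rho * z))) => //.
- by move=> n; exact: measurable_funTS.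
- by move=> x _; exact: cvg_trig.
- move=> n x /in_near/ltW xr; apply: le_trans (ler_norm_sum _ _ _) _.
  apply: (@le_trans _ _ (series (exp_coeff (rho * z)) n)).
    apply: ler_sum => j _; rewrite /exp_coeff/= -mulrA normrM -[leRHS]mul1r ler_pM ?tau_le1//.
    rewrite normrM normrX normrM (ger0_norm z0) (ger0_norm (_ : 0 <= j`!%:R^-1))//.
    by rewrite ler_wpM2r// lerXn2r ?nnegrE ?mulr_ge0 ?(ltW r0)// ler_wpM2r.
  apply: (@series_lim_ge _ (exp_coeff (rho * z))); last exact: is_cvg_series_exp_coeff.
  by move=> j; rewrite exp_coeff_ge0// mulr_ge0// ltW.
- exact: finite_measure_integrable_cst.
Qed.

End Functionals.

(** * The two implications for real coefficients *)

Section Parity.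
Variable R : realType.
Implicit Types (p j : nat).

Lemma tau01 j : tau R 0 j * tau R 1 j = 0 /\ tau R 0 j ^+ 2 + tau R 1 j ^+ 2 = 1.
Proof.
have t1 : tau R 1 j = sin ((j%:R - 0%:R) * (pi / 2)).
  by rewrite /tau -cosBpihalf; congr cos; ring.
by rewrite t1; split; [rewrite mulrC; exact: sin_tau|exact: cos2Dsin2].
Qed.

Lemma tau_sqr p j : (p < 2)%N -> tau R p j = 0 \/ tau R p j ^+ 2 = 1.
Proof.
have [/eqP h1 h2] := tau01 j; move: h1; rewrite mulf_eq0 => /orP[]/eqP t0; move: h2; rewrite t0 expr0n.
  by rewrite add0r; case: p => [|[|]]// h _; [left|right].
by rewrite addr0; case: p => [|[|]]// h _; [right|left].
Qed.

(** The cosine sees only even [j] and the sine only odd [j], so two coefficient sequences merge into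
    the single one that [functional_outside] expects. *)
Lemma tau_merge (q : nat -> R) p j : (p < 2)%N ->
  (q 0 * tau R 0 j ^+ 2 + q 1 * tau R 1 j ^+ 2) * tau R p j = q p * tau R p j.
Proof.
have [h1 h2] := tau01 j; case: p => [|[|]]// _.
  have t : tau R 1 j ^+ 2 = 1 - tau R 0 j ^+ 2 by lra.
  have {}h1 : tau R 0 j * tau R 1 j ^+ 2 = 0 by rewrite expr2 mulrA h1 mul0r.
  rewrite mulrDl -(mulrA (q 1)) (mulrC (tau R 1 j ^+ 2)) h1 mulr0 addr0 -mulrA; congr (_ * _).
  by rewrite t mulrBr mulr1 in h1; lra.
have t : tau R 0 j ^+ 2 = 1 - tau R 1 j ^+ 2 by lra.
have {}h1 : tau R 0 j ^+ 2 * tau R 1 j = 0 by rewrite expr2 -mulrA h1 mulr0.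
rewrite mulrDl -(mulrA (q 0)) h1 mulr0 add0r -mulrA; congr (_ * _).
by rewrite t mulrBl mul1r in h1; lra.
Qed.

Lemma trig_at0 p : trig p 0 = tau R p 0.
Proof. by rewrite /trig /tau mulrBl mul0r. Qed.

End Parity.

Lemma series_at0 (R : realType) (a : nat -> R) :
  series (fun j => a j * 0 ^+ j / j`!%:R) @ \oo --> a 0.
Proof.
apply: cvg_near_cst; near=> n.
rewrite -[n]prednK; last by near: n; exact: nbhs_infty_gt.
rewrite /series/= big_nat_recl//= big1 ?addr0; last by move=> i _; rewrite expr0n mulr0 mul0r.
by rewrite expr0 fact0 mulr1 divr1.
Unshelve. all: by end_near. Qed.

(** * From density to transform and back *)

Section Transforms.
Variables (R : realType) (c : R) (S : set R) (mu : probability (measurableTypeR R) R).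
Hypothesis c0 : 0 < c.
Hypothesis sS : subsemigroup_nonneg S.
Hypothesis S1S : S1 S.
Hypothesis S2S : S2 c S.
Notation leb := (@lebesgue_measure R).
Implicit Types (p j : nat) (z b : R).

Let Spos : set R := S `&` [set b | 0 < b].

(** Both sides of the equivalence ask for bounds of the pure form [K ^ b]. As [b >= b0 > 0], the
    constant [M = max 1 C] is at most [M ^ (b / b0)]. *)
Lemma exponents_absorb (C A : R) : 0 < A ->
  exists2 K, A <= K & forall b, Spos b -> C * A `^ b <= K `^ b.
Proof.
move=> A0; have [b0 b00 b0_le] := exponents_min S2S.
pose M := Num.max 1 C; have M1 : 1 <= M by rewrite le_max lexx.
have M0 : 0 <= M by exact: le_trans M1.
exists (A * M `^ b0^-1).
  by rewrite ler_peMr ?(ltW A0)// -[leLHS](powRr0 M) ler_powR// invr_ge0 ltW.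
move=> b Sb; have b0b := b0_le _ Sb.
rewrite powRM ?powR_ge0 ?(ltW A0)// mulrC ler_wpM2l ?powR_ge0// -powRrM.
apply: (@le_trans _ _ M); first by rewrite le_max lexx orbT.
by rewrite -[leLHS]powRr1// ler_powR// mulrC ler_pdivlMr// mul1r.
Qed.

Let w z b := z `^ b / Gamma (b + 1).

Let w_nat z j : 0 <= z -> w z j%:R = z ^+ j / j`!%:R.
Proof. by move=> z0; rewrite /w Gamma_nat powR_mulrn. Qed.

Let natS : range (fun n : nat => n%:R : R) `<=` S.
Proof. by move=> _ [n _ <-]; exact: S1S. Qed.

Let inj_natr : injective (fun n : nat => n%:R : R).
Proof. by move=> m n /eqP; rewrite eqr_nat => /eqP. Qed.

Let powR_inv (x b : R) : 0 <= x -> x^-1 `^ b = x `^ (- b).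
Proof. by move=> x0; rewrite -powR_inv1// -powRrM mulN1r. Qed.

Let summable_U (e : nat -> R) (N : R -> R) C r rho : injective e -> range e = Spos -> 0 < r -> 0 < rho -> r
    * c < rho ->
  (forall b, Spos b -> 0 <= N b <= C * r `^ b) -> cvgn (series (fun k => N (e k) * rho `^ (- e k))).
Proof.
move=> inj_e ran_e r0 rho0 rc hN; have eS k : Spos (e k) by rewrite -ran_e; exists k.
apply: (@series_le_cvg _ _ (fun k => C * (r / rho) `^ e k)) => /=.
- by move=> k; have /andP[h _] := hN _ (eS k); rewrite mulr_ge0 ?powR_ge0.
- move=> k; have /andP[h1 h2] := hN _ (eS k).
  by rewrite mulr_ge0 ?powR_ge0//; have := le_trans h1 h2; rewrite pmulr_lge0// powR_gt0.
- move=> k; have /andP[h1 h2] := hN _ (eS k).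
  by rewrite powRM ?invr_ge0 ?(ltW r0) ?(ltW rho0)// powR_inv ?(ltW rho0)// mulrA ler_wpM2r ?powR_ge0.
- apply: is_cvg_seriesZ; apply: (exponents_summable sS S1S S2S inj_e _ c0); rewrite ?divr_gt0//.
    by rewrite ran_e; exact: subIsetl.
  by rewrite mulrAC ltr_pdivrMr// mul1r.
Qed.

Lemma density_fourier (u : nat -> R -> R) r rho g : 0 < r -> 0 < rho -> r * c < rho ->
  (forall p b, (p < 2)%N -> Spos b -> `|u p b| <= r `^ b) ->
  (forall x, rho <= `|x| -> has_sum Spos (fun b => dens (u^~ b) b x) (g x)) ->
  (forall B : set (measurableTypeR R),
      measurable B -> B `<=` far rho -> mu B = (\int[leb]_(x in B) (g x)%:E)%E) ->
  exists (v : nat -> R -> R) (A : R),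
    [/\ 0 < A, forall b, Spos b -> `|v 0 b| + `|v 1 b| <= A `^ b,
      forall p, (p < 2)%N -> v p 0 = tau R p 0 &
      forall p z, (p < 2)%N -> 0 < z -> has_sum S (fun b => v p b * w z b) (\int[mu]_x trig p (x * z))].
Proof.
move=> r0 rho0 rc ur gE muE.
have [e [inj_e ran_e]] := exponents_enum S1S S2S; have [b0 b00 b0_le] := exponents_min S2S.
have {}ran_e : range e = Spos by [].
have eS k : Spos (e k) by rewrite -ran_e; exists k.
have be k : b0 <= e k by exact: (b0_le _ (eS k)).
pose U p k := u p (e k).
have summ : cvgn (series (fun k => (`|U 0 k| + `|U 1 k|) * rho `^ (- e k))).
  apply: (@summable_U e (fun b => `|u 0 b| + `|u 1 b|) 2 r rho) => // b Sb.
  by rewrite addr_ge0// mulrDl mul1r lerD ?ur.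
have sgE x : rho <= `|x| -> series (fun k => dens (U^~ k) (e k) x) @ \oo --> g x.
  by move=> rx; exact: (has_sum_series inj_e ran_e (gE x rx)).
have ig := integrable_density rho0 b00 be summ sgE.
have mfar := measurable_far rho.
(* [muE] concerns sets only; the difference of the two integrals vanishes on indicators, hence on
   bounded functions by [functional_eq0]. *)
have farI f : bounded_mfun f -> \int[mu]_(x in far rho) f x = \int[leb]_(x in far rho) (f x * g x).
  have i1 : mu.-integrable (far rho) (EFin \o (fun=> 1)) by exact: bounded_integrable (bounded_mfun_cst 1).
  have bL := functional_diff (integral_functional mfar i1) (integral_functional mfar ig).
  move=> bf; have := functional_eq0 bL _ bf.
  under [X in X - _]eq_Rintegral do rewrite mulr1.
  move=> h; apply/eqP; rewrite -subr_eq0 h// => B mB; apply/eqP; rewrite subr_eq0; apply/eqP.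
  rewrite !Rintegral_indicM//; rewrite /Rintegral; congr fine.
  rewrite -muE; [|exact: measurableI|exact: subIsetr].
  by rewrite integral_cst ?mul1e//; exact: measurableI.
pose q p j := moment mu rho j + regular_coef e U rho p j.
have [C qC] := regular_coef_le rho0 summ.
have C0 : 0 <= C by have := le_trans (normr_ge0 _) (qC 0 0 isT); rewrite expr0 mulr1.
have qle p j : (p < 2)%N -> `|q p j| <= (1 + C) * rho ^+ j.
  move=> p2; apply: le_trans (ler_normD _ _) _; rewrite mulrDl mul1r.
  by apply: lerD; [exact: moment_le|exact: qC].
pose I p z := limn (series (fun k => U p k * (anti_gamma p (e k) * w z (e k)))).
have qs p z : (p < 2)%N -> 0 <= z ->
    series (fun j => q p j * tau R p j * z ^+ j / j`!%:R) @ \oo --> \int[mu]_x trig p (x * z) - I p z.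
  move=> p2 z0; have h1 := @near_series R mu rho p z rho0 z0.
  have h2 := regular_series rho0 b00 be summ sgE p2 z0.
  have bt := @bounded_mfun_trig R p z.
  have -> : \int[mu]_x trig p (x * z) = \int[mu]_(x in ~` far rho) trig p (x * z)
      + \int[mu]_(x in far rho) trig p (x * z).
    rewrite -Rintegral_setU ?setUv//; first by rewrite setUC setUv.
    - exact: measurableC.
    - by rewrite setUC setUv; exact: bounded_integrable.
    - by apply/disj_setPS => x [].
  rewrite farI// -addrA.
  rewrite (_ : series _ = series (fun j => moment mu rho j * tau R p j * z ^+ j / j`!%:R) +
     series (fun j => regular_coef e U rho p j * tau R p j * z ^+ j / j`!%:R)).
    exact: cvgD.
  by apply/funext => n; rewrite fctE /series/= -big_split/=; apply: eq_bigr => j _; rewrite /q; ring.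
(* [v1] comes from the singular part, [v2] from the power series, whose exponents are the integers,
   recognized by [b = truncn b]. A positive integer receives both. *)
pose v1 p b := if 0 < b then u p b * anti_gamma p b else 0.
pose v2 p b := if b == (Num.truncn b)%:R then q p (Num.truncn b) * tau R p (Num.truncn b) else 0.
pose v p b := v1 p b + v2 p b.
have v1le p b : (p < 2)%N -> Spos b -> `|v1 p b| <= 36 * (r + rho) `^ b.
  move=> p2 Sb; rewrite /v1 Sb.2 normrM mulrC ler_pM ?norm_anti_gamma_le ?Sb.2//.
  apply: le_trans (ur _ _ p2 Sb) _; apply: ge0_ler_powR;
      rewrite ?nnegrE ?addr_ge0 ?(ltW r0) ?(ltW rho0) ?lerDl ?(ltW rho0)//.
  exact: ltW Sb.2.
have v2le p b : (p < 2)%N -> Spos b -> `|v2 p b| <= (1 + C) * (r + rho) `^ b.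
  move=> p2 Sb; rewrite /v2; case: eqP => [bn|_]; last first.
    by rewrite normr0 mulr_ge0 ?powR_ge0// addr_ge0.
  rewrite [X in _ `^ X]bn powR_mulrn ?addr_ge0 ?(ltW r0) ?(ltW rho0)//.
  rewrite normrM -[leRHS]mulr1 ler_pM ?tau_le1//; apply: le_trans (qle _ _ p2) _.
  by rewrite ler_wpM2l ?addr_ge0// lerXn2r ?nnegrE ?addr_ge0 ?(ltW r0) ?(ltW rho0)// lerDr ltW.
have v2nat p j : v2 p j%:R = q p j * tau R p j by rewrite /v2 natrK eqxx.
have [A rA hA] := exponents_absorb (2 * (37 + C)) (addr_gt0 r0 rho0).
exists v, A; split.
- by apply: lt_le_trans rA; exact: addr_gt0.
- move=> b Sb; apply: le_trans (hA b Sb); rewrite mulr_natl mulrnAl mulr2n.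
  have vle p : (p < 2)%N -> `|v p b| <= (37 + C) * (r + rho) `^ b.
    move=> p2; apply: le_trans (ler_normD _ _) _; apply: le_trans (lerD (v1le _ _ p2 Sb) (v2le _ _ p2 Sb)) _.
    by rewrite -mulrDl ler_wpM2r ?powR_ge0//; lra.
  by apply: lerD; exact: vle.
(* The coefficient at [0] is read off at [z = 0], where the singular part vanishes and [mu]
   integrates the constant [trig p 0]. *)
- move=> p p2; rewrite /v /v1 ltxx add0r (v2nat p 0).
  have h := qs p 0 p2 (lexx 0); have h' := @series_at0 R (fun j => q p j * tau R p j).
  have -> : q p 0 * tau R p 0 = \int[mu]_x trig p (x * 0) - I p 0 by exact: (cvg_unique _ h' h).
  under eq_Rintegral do rewrite mulr0.
  rewrite Rintegral_probability_cst trig_at0 /I (_ : series _ = fun=> 0) ?lim_cst ?subr0//.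
  apply/funext => n; rewrite /series/= big1// => k _.
  by rewrite /w powR0 ?mul0r ?mulr0// gt_eqF// (eS k).2.
- move=> p z p2 z0.
  have h1 : has_sum S (fun b => v1 p b * w z b) (I p z).
    apply/(@has_sum_support _ _ Spos); first exact: subIsetl.
      by move=> b Sb nSb; rewrite /v1; case: ifP => [b_gt0|_]; [case: nSb|rewrite mul0r].
    have v1e k : v1 p (e k) * w z (e k) = U p k * (anti_gamma p (e k) * w z (e k)).
      by rewrite /v1 (eS k).2 -mulrA.
    have sp := summable_singular_part rho0 b00 be summ p2 (ltW z0).
    apply: (series_has_sum inj_e ran_e); first by under eq_fun do rewrite v1e.
    rewrite (_ : _ \o _ = fun k => U p k * (anti_gamma p (e k) * w z (e k))); last exact/funext.
    exact: normed_cvg.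
  have h2 : has_sum S (fun b => v2 p b * w z b) (\int[mu]_x trig p (x * z) - I p z).
    apply/(@has_sum_support _ _ (range (fun n : nat => n%:R))) => //.
      move=> b Sb nb; rewrite /v2; case: eqP => [bn|_]; last by rewrite mul0r.
      by case: nb; exists (Num.truncn b).
    have v2e j : v2 p j%:R * w z j%:R = q p j * tau R p j * z ^+ j / j`!%:R.
      by rewrite v2nat w_nat ?(ltW z0)// !mulrA.
    apply: (series_has_sum inj_natr erefl).
      apply: (@series_le_cvg _ _ (fun j => (1 + C) * exp_coeff (rho * z) j)) => /=.
      + by move=> j; exact: normr_ge0.
      + by move=> j; rewrite mulr_ge0 ?addr_ge0// exp_coeff_ge0// mulr_ge0// ltW.
      + move=> j; rewrite v2e /exp_coeff/= exprMn -mulrA normrM normrM.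
        rewrite (ger0_norm (_ : 0 <= z ^+ j / j`!%:R)); last by rewrite divr_ge0// exprn_ge0// ltW.
        rewrite -[in leRHS]mulrA mulrA ler_wpM2r ?divr_ge0 ?exprn_ge0 ?(ltW z0)//.
        by rewrite -[leRHS]mulr1 ler_pM ?tau_le1 ?qle.
      + by apply: is_cvg_seriesZ; exact: is_cvg_series_exp_coeff.
    rewrite (_ : _ \o _ = fun j => q p j * tau R p j * z ^+ j / j`!%:R); last exact/funext.
    by apply: qs => //; exact: ltW.
  have := has_sumD h1 h2; rewrite addrC subrK; apply: eq_has_sum => b _.
  by rewrite -mulrDl.
Qed.

Lemma fourier_density (v : nat -> R -> R) A : 0 < A ->
  (forall p b, (p < 2)%N -> Spos b -> `|v p b| <= A `^ b) ->
  (forall p, (p < 2)%N -> v p 0 = tau R p 0) ->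
  (forall p z, (p < 2)%N -> 0 < z -> has_sum S (fun b => v p b * w z b) (\int[mu]_x trig p (x * z))) ->
  exists (u : nat -> R -> R) (r rho : R) (g : R -> R),
    [/\ 0 < r, 0 < rho, r < c^-1 * rho,
      forall b, Spos b -> `|u 0 b| + `|u 1 b| <= r `^ b &
      (forall x, rho <= `|x| -> has_sum Spos (fun b => dens (u^~ b) b x) (g x)) /\
      (forall B : set (measurableTypeR R), measurable B -> B `<=` far rho ->
         mu B = (\int[leb]_(x in B) (g x)%:E)%E)].
Proof.
move=> A0 vA v0 hv.
have [e [inj_e ran_e]] := exponents_enum S1S S2S; have [b0 b00 b0_le] := exponents_min S2S.
have {}ran_e : range e = Spos by [].
have eS k : Spos (e k) by rewrite -ran_e; exists k.
have be k : b0 <= e k by exact: (b0_le _ (eS k)).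
pose K0 : R := (5 / 96 * expR (- 1))^-1.
have K1 : 0 < 5 / 96 * expR (- 1) :> R by rewrite mulr_gt0 ?expR_gt0.
have K00 : 0 < K0 by rewrite invr_gt0.
(* Only nonresonant coefficients are divided by [anti_gamma]; resonant ones are monomials and stay
   in the entire part. *)
pose u p b := if `[< nonresonant p b >] then v p b / anti_gamma p b else 0.
have uK p b : (p < 2)%N -> Spos b -> `|u p b| <= K0 * A `^ b.
  move=> p2 Sb; rewrite /u; case: asboolP => [nr|_]; last by rewrite normr0 mulr_ge0 ?powR_ge0// ltW.
  have /andP[h1 _] := anti_gamma_bounds Sb.2 nr.
  rewrite normrM mulrC ler_pM ?vA// normfV lef_pV2 ?posrE//.
    by apply: le_trans h1 _; exact: ler_norm.
  by rewrite normr_gt0 gt_eqF// (lt_le_trans K1).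
have [r rA hr] := exponents_absorb (2 * K0) A0.
have r0 : 0 < r by exact: lt_le_trans rA.
have ur b : Spos b -> `|u 0 b| + `|u 1 b| <= r `^ b.
  move=> Sb; apply: le_trans (hr b Sb); rewrite mulr_natl mulrnAl mulr2n.
  by apply: lerD; exact: uK.
have c1 := exponents_base_ge1 S1S S2S c0.
(* [r * c < rho] makes the density summable on [|x| >= rho], and [c >= 1] gives [A <= r <= rho],
   which bounds the monomials left over. *)
pose rho := r * c + 1.
have rc : r * c < rho by rewrite ltrDl.
have rho1 : 1 <= rho by rewrite lerDr mulr_ge0 ?ltW.
have rho0 : 0 < rho by exact: lt_le_trans rho1.
have Arho : A <= rho by apply: le_trans rA _; apply: le_trans (ltW rc); rewrite ler_peMr ?(ltW r0).
pose U p k := u p (e k).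
have summ : cvgn (series (fun k => (`|U 0 k| + `|U 1 k|) * rho `^ (- e k))).
  apply: (@summable_U e (fun b => `|u 0 b| + `|u 1 b|) 1 r rho) => // b Sb.
  by rewrite addr_ge0// mul1r ur.
pose g x := limn (series (fun k => dens (U^~ k) (e k) x)).
have sd x : rho <= `|x| -> cvgn (series (fun k => `|dens (U^~ k) (e k) x|)).
  exact: (summable_dens rho0 be summ).
have sgE x : rho <= `|x| -> series (fun k => dens (U^~ k) (e k) x) @ \oo --> g x.
  by move=> rx; apply: normed_cvg; exact: sd.
have ig := integrable_density rho0 b00 be summ sgE.
have mfar := measurable_far rho.
have [C qC] := regular_coef_le rho0 summ.
pose q p j := regular_coef e U rho p j.
(* The factor [tau] switches off the integers that are nonresonant for [p]; at the others
   [tau ^ 2 = 1] restores [v p j] in the series. *)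
pose m p j := v p j%:R * tau R p j.
pose I p z := limn (series (fun k => U p k * (anti_gamma p (e k) * w z (e k)))).
have mle p j : (p < 2)%N -> `|m p j| <= rho ^+ j.
  move=> p2; rewrite /m normrM -[leRHS]mulr1 ler_pM ?tau_le1//.
  case: j => [|j]; first by rewrite v0// expr0 tau_le1.
  have Sj : Spos j.+1%:R by split; [exact: S1S|rewrite /= ltr0n].
  apply: le_trans (vA _ _ p2 Sj) _.
  by rewrite powR_mulrn ?(ltW A0)// lerXn2r ?nnegrE ?(ltW A0) ?(ltW rho0).
have ms p z : (p < 2)%N -> 0 <= z ->
    series (fun j => m p j * tau R p j * z ^+ j / j`!%:R) @ \oo --> \int[mu]_x trig p (x * z) - I p z.
  move=> p2; rewrite le_eqVlt => /predU1P[<-|z0].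
    under eq_Rintegral do rewrite mulr0.
    rewrite Rintegral_probability_cst trig_at0 (_ : I p 0 = 0) ?subr0; last first.
      rewrite /I (_ : series _ = fun=> 0) ?lim_cst//; apply/funext => n; rewrite /series/= big1// => k _.
      by rewrite /w powR0 ?mul0r ?mulr0// gt_eqF// (eS k).2.
    have -> : tau R p 0 = m p 0 * tau R p 0.
      by rewrite /m v0//; have [->|h] := tau_sqr R 0 p2; [rewrite !mul0r|rewrite -mulrA -expr2 h mulr1].
    exact: (@series_at0 R (fun j => m p j * tau R p j)).
  pose f1 b := (if 0 < b then u p b * anti_gamma p b else 0) * w z b.
  have h1 : has_sum S f1 (I p z).
    apply/(@has_sum_support _ _ Spos); first exact: subIsetl.
      by move=> b Sb nSb; rewrite /f1; case: ifP => [b_gt0|_]; [case: nSb|rewrite mul0r].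
    have f1e k : f1 (e k) = U p k * (anti_gamma p (e k) * w z (e k)).
      by rewrite /f1 (eS k).2 -mulrA.
    have sp := summable_singular_part rho0 b00 be summ p2 (ltW z0).
    apply: (series_has_sum inj_e ran_e); first by under eq_fun do rewrite f1e.
    rewrite (_ : _ \o _ = fun k => U p k * (anti_gamma p (e k) * w z (e k))); last exact/funext.
    exact: normed_cvg.
  have h2 := has_sumB (hv p z p2 z0) h1.
  have nonres b : 0 < b -> nonresonant p b -> v p b * w z b - f1 b = 0.
    move=> b_gt0 nr; rewrite /f1 b_gt0 /u asboolT// -mulrBl divfK ?subrr ?mul0r//.
    by have /andP[h _] := anti_gamma_bounds b_gt0 nr; rewrite gt_eqF// (lt_le_trans K1).
  (* Outside the integers every exponent is nonresonant and its terms cancel, so an ordinary power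
     series remains. *)
  have {}h2 : has_sum (range (fun n : nat => n%:R)) (fun b =>
      v p b * w z b - f1 b) (\int[mu]_x trig p (x * z) - I p z).
    apply/(@has_sum_support _ _ _ S _ _ natS) => // b Sb nb; apply: nonres.
      have [h _] := sS; rewrite lt_neqAle h// andbT; apply/eqP => b_0; apply: nb; exists 0%N => //.
    by move=> j jb; case: nb; exists j.
  have := has_sum_series inj_natr erefl h2.
  rewrite (_ : _ \o _ = fun j => m p j * tau R p j * z ^+ j / j`!%:R)//.
  apply/funext => j /=; rewrite -mulrA -w_nat ?(ltW z0)// /m.
  case: j => [|j].
    by rewrite /f1 ltxx mul0r subr0 v0//; have [->|h] := tau_sqr R 0 p2;
        [rewrite !mul0r|rewrite -(mulrA (tau _ _ _)) -expr2 h mulr1].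
  have [nr|nr] := EM (nonresonant p (j.+1%:R : R)).
    by rewrite nonres ?ltr0n// (nr j.+1 erefl) mulr0 mul0r.
  rewrite /f1 ltr0n /u asboolF// mul0r mul0r subr0.
  move/existsNP : nr => [i /not_implyP[/eqP ij ti]]; move: ij ti; rewrite eqr_nat => /eqP -> ti.
  by have [//|h] := tau_sqr R j.+1 p2; rewrite -(mulrA (v _ _)) -expr2 h mulr1.
have qs p z (p2 : (p < 2)%N) (z0 : 0 <= z) := regular_series rho0 b00 be summ sgE p2 z0.
pose d j := (m 0 j - q 0 j) * tau R 0 j ^+ 2 + (m 1 j - q 1 j) * tau R 1 j ^+ 2.
have dC j : `|d j| <= (2 * (1 + C)) * rho ^+ j.
  have h p : (p < 2)%N -> `|(m p j - q p j) * tau R p j ^+ 2| <= (1 + C) * rho ^+ j.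
    move=> p2; rewrite normrM -[leRHS]mulr1 ler_pM//; last by rewrite normrX exprn_ile1// tau_le1.
    apply: le_trans (ler_normB _ _) _; rewrite mulrDl mul1r; apply: lerD; first exact: mle.
    exact: qC.
  rewrite mulr_natl mulrnAl mulr2n; apply: le_trans (ler_normD _ _) _.
  by apply: lerD; exact: h.
have i1 : mu.-integrable setT (EFin \o (fun=> 1)) by exact: bounded_integrable (bounded_mfun_cst 1).
have bL := functional_diff (integral_functional measurableT i1) (integral_functional mfar ig).
have Ld p z : (p < 2)%N -> 0 <= z -> series (fun j => d j * tau R p j * z ^+ j / j`!%:R) @ \oo -->
    \int[mu]_x (trig p (x * z) * 1) - \int[leb]_(x in far rho) (trig p (x * z) * g x).
  move=> p2 z0; under eq_Rintegral do rewrite mulr1.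
  rewrite (_ : series _ = series (fun j => m p j * tau R p j * z ^+ j / j`!%:R) -
     series (fun j => q p j * tau R p j * z ^+ j / j`!%:R)).
    have -> : \int[mu]_x trig p (x * z) - \int[leb]_(x in far rho) (trig p (x * z) * g x) =
      (\int[mu]_x trig p (x * z) - I p z) -
      (\int[leb]_(x in far rho) (trig p (x * z) * g x) - I p z) by ring.
    by apply: cvgB; [exact: ms|exact: qs].
  apply/funext => n; rewrite fctE /series/= -sumrB; apply: eq_bigr => j _.
  by rewrite /d (tau_merge (fun p => m p j - q p j) j p2); ring.
(* This gives vanishing on the open set [|x| > rho] only, whereas the class asks for a closed set;
   hence the radius [rho + 1] in the witness. *)
have L0 := functional_outside bL rho0 dC Ld.
exists u, r, (rho + 1), g; split=> //.
- by rewrite addr_gt0.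
- by rewrite ltr_pdivlMl// mulrC (lt_le_trans rc)// lerDl.
split=> [x rx|B mB Bfar].
  have rx' : rho <= `|x| by apply: le_trans rx; rewrite lerDl.
  by apply: (series_has_sum inj_e ran_e); [exact: sd|exact: sgE].
have Bfar' : B `<=` far rho by move=> x /Bfar; apply: le_trans; rewrite lerDl.
have Bout : B `<=` [set x | rho < `|x|] by move=> x /Bfar; apply: lt_le_trans; rewrite ltrDl.
have := L0 B mB Bout; rewrite !Rintegral_indicM// setIT (setIidl Bfar') => /eqP; rewrite subr_eq0 => /eqP.
rewrite /Rintegral integral_cst// mul1e => h.
have iB : leb.-integrable B (EFin \o g) by exact: integrableS ig.
by rewrite -[RHS]fineK ?(integrable_fin_num mB iB)// -h fineK// fin_num_measure.
Qed.

End Transforms.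

(** * Complex coefficients *)

Section ComplexForm.
Variable R : realType.
Implicit Types (S : set R) (x b t : R) (u : nat -> R -> R).
Local Open Scope complex_scope.

Lemma Re_sum (F : set R) (f : R -> R[i]) : finite_set F ->
  complex.Re (\sum_(i \in F) f i) = \sum_(i \in F) complex.Re (f i).
Proof. by move=> fF; rewrite !fsbig_finite//= (raddf_sum (@complex.Re R)). Qed.

Lemma Im_sum (F : set R) (f : R -> R[i]) : finite_set F ->
  complex.Im (\sum_(i \in F) f i) = \sum_(i \in F) complex.Im (f i).
Proof. by move=> fF; rewrite !fsbig_finite//= (raddf_sum (@complex.Im R)). Qed.

Lemma normc_Re_le (x : R[i]) (e : R) : `|x| <= e%:C -> `|complex.Re x| <= e.
Proof. by move=> xe; rewrite -lecR; apply: le_trans xe; exact: normc_ge_Re. Qed.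

Lemma normc_Im_le (x : R[i]) (e : R) : `|x| <= e%:C -> `|complex.Im x| <= e.
Proof.
move=> xe; have : `|'i * x| <= e%:C by rewrite normrM normCi mul1r.
by move=> /normc_Re_le; case: x {xe} => a b /=; rewrite mul0r mul1r sub0r normrN.
Qed.

Lemma normc_le (x : R[i]) : `|x| <= (`|complex.Re x| + `|complex.Im x|)%:C.
Proof.
case: x => a b; rewrite normc_def/= lecR -[leRHS]ger0_norm ?addr_ge0// -sqrtr_sqr ler_wsqrtr//.
by rewrite sqrrD !real_normK ?num_real// lerD2r lerDl mulrn_wge0// mulr_ge0.
Qed.

Lemma has_sum_complex S (f : R -> R[i]) (l : R[i]) :
  has_sum S f l <-> has_sum S (fun b => complex.Re (f b)) (complex.Re l) /\
                    has_sum S (fun b => complex.Im (f b)) (complex.Im l).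
Proof.
split=> [hf|[h1 h2]].
  have key e : 0 < e -> exists F0, [/\ finite_set F0, F0 `<=` S & forall F,
      finite_set F -> F0 `<=` F -> F `<=` S ->
      `|\sum_(i \in F) f i - l| < (e / 2)%:C].
    by move=> e0; apply: hf; rewrite ltcR divr_gt0.
  split=> e e0; have [F0 [fF FS hF]] := key e e0; exists F0; split=> // F fF' FF FS'.
    rewrite -Re_sum// -raddfB/=; apply: (@le_lt_trans _ _ (e / 2));
        last by rewrite ltr_pdivrMr// mulr_natr mulr2n ltrDl.
    by apply: normc_Re_le; apply: ltW; exact: hF.
  rewrite -Im_sum// -raddfB/=; apply: (@le_lt_trans _ _ (e / 2));
      last by rewrite ltr_pdivrMr// mulr_natr mulr2n ltrDl.
  by apply: normc_Im_le; apply: ltW; exact: hF.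
move=> e e0; have [a a0 ea] : exists2 a : R, 0 < a & e = a%:C.
  by move: e0; rewrite ltcE/= => /andP[/eqP ei er]; exists (complex.Re e) => //; apply/eqP;
      rewrite eq_complex/= eqxx ei eqxx.
have a20 : 0 < a / 2 by rewrite divr_gt0.
have [F1 [fF1 F1S hF1]] := h1 _ a20; have [F2 [fF2 F2S hF2]] := h2 _ a20.
exists (F1 `|` F2); split; [by rewrite finite_setU|by move=> x [/F1S|/F2S]|].
move=> F fF FF FS; rewrite ea; apply: le_lt_trans (normc_le _) _; rewrite ltcR [ltRHS]splitr.
rewrite !raddfB/= Re_sum// Im_sum//; apply: ltrD; [apply: hF1|apply: hF2] => // x Fx; apply: FF;
    [by left|by right].
Qed.

Lemma expiD t (s : R) : expi (t + s) = expi t * expi s.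
Proof. by rewrite /expi cosD sinD; apply/eqP; rewrite eq_complex/=; apply/andP; split; apply/eqP; ring. Qed.

Lemma expi0 : expi (0 : R) = 1.
Proof. by rewrite /expi cos0 sin0. Qed.

Lemma norm_expi t : `|expi t| = 1.
Proof. by rewrite normc_def/= cos2Dsin2 sqrtr1. Qed.

(** Rotation by [i ^ b] decouples the coordinates: [u 0] then meets only the cosine transform and
    [u 1] only the sine transform. [polar] undoes the rotation, and [parts] performs it. *)
Definition polar u b : R[i] := (u 0 b +i* u 1 b) * expi (- (pi * b / 2)).

Lemma polar_i_pow u b : polar u b * i_pow b = u 0 b +i* u 1 b.
Proof. by rewrite /polar /i_pow -mulrA -expiD addNr expi0 mulr1. Qed.

Lemma norm_polar_le u b : `|polar u b| <= (`|u 0 b| + `|u 1 b|)%:C.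
Proof. by rewrite normrM norm_expi mulr1; exact: (normc_le (_ +i* _)). Qed.

Definition parts (a : R -> R[i]) (p : nat) b : R :=
  if p == 0%N then complex.Re (a b * i_pow b) else complex.Im (a b * i_pow b).

Lemma polar_parts a : polar (parts a) = a.
Proof.
apply/funext => b; rewrite /polar /parts/= (_ : _ +i* _ = a b * i_pow b); last by case: (a b * i_pow b).
by rewrite -mulrA -expiD addrN expi0 mulr1.
Qed.

Lemma norm_parts_le a p b (e : R) : `|a b| <= e%:C -> `|parts a p b| <= e.
Proof.
move=> ae; have aie : `|a b * i_pow b| <= e%:C by rewrite normrM norm_expi mulr1.
by rewrite /parts; case: ifP => _; [exact: normc_Re_le|exact: normc_Im_le].
Qed.

(** With [t = pi * b / 2] the angle is [- t] for [x > 0] and [(b + 1) * pi - t = t + pi] for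
    [x < 0]: the part [- u 0 * sin t] is the same on both sides, and [u 1 * cos t] changes sign. *)
Lemma dens_polar u b x : x != 0 -> complex.Im (polar u b * inv_pow x (b + 1)) = dens (u^~ b) b x.
Proof.
move=> x0; rewrite /inv_pow /dens /phase.
have -> : sin ((b - 0%:R) * (pi / 2)) = sin (pi * b / 2) by congr sin; ring.
have -> : sin ((b - 1%:R) * (pi / 2)) = - cos (pi * b / 2).
  by rewrite -sinBpihalf; congr sin; lra.
have -> : - b - 1 = - (b + 1) :> R by ring.
case: ifPn => [xp|].
  by rewrite gtr0_sg// gtr0_norm// /polar /expi cosN sinN /=; field.
rewrite -leNgt le_eqVlt (negbTE x0) orFb => xn.
have -> : polar u b * (expi ((b + 1) * pi) * (`|x| `^ (- (b + 1)))%:C) =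
   (u 0 b +i* u 1 b) * expi (pi * b / 2 + pi) * (`|x| `^ (- (b + 1)))%:C.
  by rewrite /polar mulrA -(mulrA _ (expi _) (expi _)) -expiD; congr (_ * expi _ * _); lra.
by rewrite ltr0_sg// /expi cosDpi sinDpi /=; field.
Qed.

End ComplexForm.

Local Open Scope complex_scope.

Theorem theorem2p6 (R : realType) (c : R) (S : set R)
    (mu : probability (measurableTypeR R) R) :
  0 < c -> subsemigroup_nonneg S -> S1 S -> S2 c S ->
  (class_P c S mu <->
   exists (cc : R -> R[i]) (A : R),
     [/\ 0 < A,
         forall g : R, S g -> 0 < g -> `|cc g| <= (A `^ g)%:C,
         cc 0 = 1 &
         forall z : R, 0 < z ->
           has_sum S
             (fun g => cc g / (Gamma (g + 1))%:C * i_pow g * (z `^ g)%:C)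
             (fourier mu z)]).
Proof.
move=> c0 sS S1S S2S; split.
  move=> [a [r [rho [g [r0 rho0 rc ar [gE muE]]]]]].
  have rc' : r * c < rho by move: rc; rewrite ltr_pdivlMl// mulrC.
  have [|x rx|v [A [A0 vA v0 vF]]] :=
      @density_fourier R c S mu c0 sS S1S S2S (parts a) r rho g r0 rho0 rc' _ _ muE.
  - by move=> p b _ [Sb b0]; apply: norm_parts_le; exact: ar.
  - have x0 : x != 0 by rewrite -normr_gt0 (lt_le_trans rho0).
    by apply: eq_has_sum (gE x rx) => b _; rewrite -dens_polar// polar_parts.
  exists (polar v), A; split=> //.
  - move=> b Sb b0; apply: le_trans (norm_polar_le _ _) _; rewrite lecR; exact: vA.
  - rewrite /polar !v0// mulr0 mul0r oppr0 expi0 mulr1 -!trig_at0 trig0 trig1 cos0 sin0; reflexivity.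
  move=> z z0; rewrite (_ : (fun _ => _) = fun b => (v 0 b +i* v 1 b) * (z `^ b / Gamma (b + 1))%:C);
      last first.
    apply/funext => b; rewrite -polar_i_pow (mulrC (_ `^ _)) rmorphM fmorphV/=; ring.
  apply/has_sum_complex; split=> /=.
    under eq_Rintegral do rewrite -trig0.
    apply: eq_has_sum (vF 0 z isT z0) => b _; rewrite mulr0 subr0//.
  under eq_Rintegral do rewrite -trig1.
  by apply: eq_has_sum (vF 1 z isT z0) => b _; rewrite mulr0 add0r.
move=> [cc [A [A0 ccA cc0 ccF]]].
have vF p z : (p < 2)%N -> 0 < z ->
    has_sum S (fun b => parts cc p b * (z `^ b / Gamma (b + 1))) (\int[mu]_x trig p (x * z)).
  move=> p2 z0; have /has_sum_complex[h1 h2] := ccF z z0.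
  have E b : cc b / (Gamma (b + 1))%:C * i_pow b * (z `^ b)%:C = (cc b * i_pow b) * (z `^ b / Gamma (b
      + 1))%:C.
    by rewrite (mulrC (_ `^ _)) rmorphM fmorphV/=; ring.
  case: p p2 => [|[|]]// _.
    under eq_Rintegral do rewrite trig0.
    apply: eq_has_sum h1 => b _; rewrite E /parts/=; case: (cc b * i_pow b) => s t /=; ring.
  under eq_Rintegral do rewrite trig1.
  apply: eq_has_sum h2 => b _; rewrite E /parts/=; case: (cc b * i_pow b) => s t /=; ring.
have [|p p2|u [r [rho [g [r0 rho0 rc ur [gE muE]]]]]] :=
    @fourier_density R c S mu c0 sS S1S S2S (parts cc) A A0 _ _ vF.
- by move=> p b _ [Sb b0]; apply: norm_parts_le; exact: ccA.
- rewrite /parts /i_pow mulr0 mul0r cc0 expi0 mulr1 -trig_at0.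
  by case: p p2 => [|[|]]//= _; rewrite ?trig0 ?trig1 ?cos0 ?sin0.
exists (polar u), r, rho, g; split=> //.
- by move=> b Sb b0; apply: le_trans (norm_polar_le _ _) _; rewrite lecR; exact: ur.
- split=> // x rx; have x0 : x != 0 by rewrite -normr_gt0 (lt_le_trans rho0).
  by apply: eq_has_sum (gE x rx) => b _; rewrite dens_polar.
Qed.
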